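(* Let $G$ be a locally compact second countable unimodular group with a fixed Haar measure $m_G$. An ergodic probability preserving $G$-space $(X,\mu)$ is an induced action from a lattice in $G$ if and only if it admits a locally integrable cross section $Y$ satisfying $I_\mu(Y)=\iota_\mu(Y)$.
   Context: A Borel $G$-space is a standard Borel space $X$ with a jointly Borel action $G\times X\to X$, $(g,x)\mapsto g.x$. For $Y\subseteq X$ and $x\in X$ put $Y_x=\{g\in G: g.x\in Y\}$. A subset of $G$ is locally finite if it meets every compact set in a finite set. A cross section of a Borel $G$-space $X$ is a Borel set $Y\subseteq X$ with $Y_x$ nonempty and locally finite for every $x\in X$. A probability preserving $G$-space $(X,\mu)$ is a Borel $G$-space with a $G$-invariant Borel probability measure; it is ergodic if every $G$-invariant Borel set is $\mu$-null or $\mu$-conull. A locally integrable cross section of $(X,\mu)$ is a Borel set $Y\subseteq X$ such that $G.Y$ (a Borel set) is $\mu$-conull, $Y_x$ is locally finite for all $x\in G.Y$, and $\int_X|Y_x\cap K|\,d\mu(x)<\infty$ for every compact $K\subset G$. Transverse measure: let $\mu$ be a $G$-invariant $\sigma$-finite measure on a Borel $G$-space $X$ for which $Y$ is a cross section (of $X$, or of a conull invariant Borel subset). The transverse measure $\mu_Y$ on $Y$ is $\mu_Y(f)=\int_X\sum_{g\in Y_x}f(g.x)w(g)\,d\mu(x)$ for Borel $f:Y\to[0,+\infty]$, where $w:G\to[0,+\infty]$ is any Borel function with $\int_G w\,dm_G=1$; it is $\sigma$-finite and does not depend on $w$. The intensity is $\iota_\mu(Y)=\mu_Y(Y)$. Intersection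 covolume: let $Y^{[2]}=\{(g.y_1,g.y_2): g\in G,\ y_1,y_2\in Y\}\subseteq X\times X$, a Borel $G$-space under the diagonal action, having $Y\times Y$ as a cross section. There is exactly one $G$-invariant $\sigma$-finite Borel measure $\mu^{[2]}$ on $Y^{[2]}$ whose transverse measure on $Y\times Y$ is $\mu_Y\otimes\mu_Y$. Set $I_\mu(Y)=\mu^{[2]}(Y^{[2]})\in(0,+\infty]$. Induced action (Mackey): given a lattice $\Gamma<G$ and a probability preserving $\Gamma$-space $(Z,\zeta)$ (standard), let $\Gamma$ act on $G\times Z$ by $\gamma.(g,z)=(\gamma g,\gamma.z)$. The induced $G$-space is the quotient $\Gamma\backslash(G\times Z)$ with $G$ acting by $g_0.[g,z]=[g g_0^{-1},z]$ and with the $G$-invariant probability measure coming from $m_G\otimes\zeta$ (restricted to a fundamental domain of $\Gamma$ and normalized); equivalently it is $\Gamma\backslash G\times Z$ with measure $m_{\Gamma\backslash G}\otimes\zeta$ and the action $g_0.(\Gamma g,z)=(\Gamma g g_0^{-1},\lambda(g_0,\Gamma g).z)$ for the $\Gamma$-valued Borel cocycle $\lambda$ associated with a Borel section $\Gamma\backslash G\to G$. $(X,\mu)$ is an induced action from a lattice if it is isomorphic, as a probability preserving $G$-space (modulo null sets), to an induced $G$-space for some lattice $\Gamma<G$ and some $(Z,\zeta)$. *)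

(* Defs.v *)
From HB Require Import structures.
From mathcomp Require Import all_boot all_order all_algebra.
From mathcomp Require Import all_classical all_reals all_analysis.
From mathcomp Require Import measurable_realfun.
Set Implicit Arguments.
Unset Strict Implicit.
Unset Printing Implicit Defensive.
Import Order.TTheory GRing.Theory Num.Theory.
Import numFieldNormedType.Exports.

Local Open Scope classical_set_scope.
Local Open Scope quotient_scope.
Local Open Scope ring_scope.
Local Open Scope ereal_scope.

(* "Locally compact group" includes Hausdorff.  The group carries its Borel
   sigma-algebra as its measurable structure. *)
HB.mixin Record isLcscGroup d G
    of Group G & PointedTopological G & Measurable d G := {
  mulg_continuous : continuous (fun p : G * G => (p.1 * p.2)%g);
  invg_continuous : continuous (fun g : G => g^-1%g);
  lcsc_hausdorff : hausdorff_space G;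
  lcsc_locally_compact : locally_compact [set: G];
  lcsc_second_countable : @second_countable G;
  lcsc_borelE : @measurable d G = <<s @open G >>
}.

#[short(type="lcscGroupType")]
HB.structure Definition LcscGroup d :=
  {G of Group G & PointedTopological G & Measurable d G & isLcscGroup d G}.

Section haar.
Context (R : realType) d (G : lcscGroupType d).
Implicit Type m : {measure set G -> \bar R}.

Definition left_invariant m := forall (g : G) (A : set G), measurable A ->
  m [set (g * h)%g | h in A] = m A.

Definition right_invariant m := forall (g : G) (A : set G), measurable A ->
  m [set (h * g)%g | h in A] = m A.

(* Regularity is automatic, as G is second countable. *)
Definition haar_measure m := [/\ left_invariant m,
  forall K : set G, compact K -> m K < +oo & 0 < m setT].

Definition unimodular := forall m, haar_measure m -> right_invariant m.

End haar.
Arguments unimodular R {d} G.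

Definition standard_borel (R : realType) d (X : measurableType d) :=
  exists (P : completePseudoMetricType R) (f : X -> P),
    [/\ hausdorff_space P, @second_countable P, bijective f &
        @measurable d X = preimage_set_system setT f <<s @open P >>].

Record action (G : groupType) (X : Type) := Action {
  act :> G -> X -> X;
  act1 : forall x, act 1%g x = x;
  actM : forall g h x, act (g * h)%g x = act g (act h x)
}.

Section diagonal_action.
Context (G : groupType) (X : Type) (a : action G X).

Definition diag_act (g : G) (p : X * X) : X * X := (a g p.1, a g p.2).

Lemma diag_act1 p : diag_act 1%g p = p.
Proof. by case: p => x y; rewrite /diag_act !act1. Qed.

Lemma diag_actM g h p : diag_act (g * h)%g p = diag_act g (diag_act h p).
Proof. by rewrite /diag_act !actM. Qed.

Definition diag_action := Action diag_act1 diag_actM.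

End diagonal_action.

Definition invariant_measure (R : realType) (G : groupType) d
    (X : measurableType d) (a : action G X) (mu : {measure set X -> \bar R}) :=
  forall (g : G) (A : set X), measurable A -> mu (a g @^-1` A) = mu A.

Section borel_spaces.
Context (R : realType) dG (G : lcscGroupType dG) (mG : {measure set G -> \bar R}).
Context d (X : measurableType d) (a : action G X).

Definition borel_action := measurable_fun setT (fun p : G * X => a p.1 p.2).

Definition ergodic (mu : {measure set X -> \bar R}) :=
  forall A : set X, measurable A ->
    (forall g : G, a g @^-1` A = A) -> mu A = 0 \/ mu (~` A) = 0.

(* Y_x *)
Definition return_set (Y : set X) (x : X) : set G := [set g | Y (a g x)].

(* G.Y *)
Definition saturation (Y : set X) : set X :=
  [set x | exists g y, Y y /\ a g y = x].

Definition locally_finite (S : set G) :=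
  forall K : set G, compact K -> finite_set (S `&` K).

Definition locally_integrable_cross_section
    (mu : {measure set X -> \bar R}) (Y : set X) :=
  [/\ measurable Y, mu.-negligible (~` saturation Y),
      forall x, saturation Y x -> locally_finite (return_set Y x) &
      forall K : set G, compact K ->
        \int[mu]_x (counting (return_set Y x `&` K) : \bar R) < +oo].

Definition weight (w : G -> \bar R) :=
  [/\ measurable_fun setT w, forall g, 0 <= w g & \int[mG]_g w g = 1].

(* Measures on Y are extended by 0 to X. *)
Definition is_transverse_measure (mu : {measure set X -> \bar R}) (Y : set X)
    (nu : {measure set X -> \bar R}) :=
  nu.-negligible (~` Y) /\
  forall (w : G -> \bar R) (f : X -> \bar R), weight w ->
    measurable_fun Y f -> (forall y, Y y -> 0 <= f y) ->
    \int[nu]_(y in Y) f y =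
    \int[mu]_x \esum_(g in return_set Y x) (f (a g x) * w g).

End borel_spaces.

Section zero_measure.
Context d (X : measurableType d) (R : realType).

Definition zero_measure : set X -> \bar R := mzero.
HB.instance Definition _ := Measure.on zero_measure.

Let zero_fin : fin_num_fun zero_measure.
Proof. by []. Qed.

HB.instance Definition _ := Measure_isFinite.Build d X R zero_measure zero_fin.

End zero_measure.

Section intersection_covolume.
Context (R : realType) dG (G : lcscGroupType dG) (mG : {measure set G -> \bar R}).
Context d (X : measurableType d) (a : action G X).
Variables (mu : {measure set X -> \bar R}) (Y : set X).

(* xget selects the measure with the stated property; the default value is
   used only if there is none, which does not happen for cross sections. *)
Definition transverse_measure : {sigma_finite_measure set X -> \bar R} :=
  @xget {classic {sigma_finite_measure set X -> \bar R}} (@zero_measure d X R)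
    [set nu : {sigma_finite_measure set X -> \bar R} |
       is_transverse_measure mG a mu Y nu].

Definition intensity : \bar R := transverse_measure Y.

(* Y^[2] *)
Definition intersection_space : set (X * X) :=
  saturation (diag_action a) (Y `*` Y).

(* Measures on Y^[2] are extended by 0 to X * X. *)
Definition is_intersection_measure
    (m : {sigma_finite_measure set (X * X)%type -> \bar R}) :=
  [/\ m.-negligible (~` intersection_space),
      invariant_measure (diag_action a) m &
      is_transverse_measure mG (diag_action a) m (Y `*` Y)
        (transverse_measure \x transverse_measure)].

Definition intersection_measure :
    {sigma_finite_measure set (X * X)%type -> \bar R} :=
  @xget {classic {sigma_finite_measure set (X * X)%type -> \bar R}}
    (@zero_measure _ (X * X)%type R) [set m | is_intersection_measure m].

Definition intersection_covolume : \bar R :=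
  intersection_measure intersection_space.

End intersection_covolume.

Definition subgroup (G : groupType) (H : groupClosed G) := {g : G | g \in H}.

Section subgroup.
Context (G : groupType) (H : groupClosed G).

Let mem_H : pred G := fun g => g \in H.

Let subgroup_closed : group_closed mem_H.
Proof. by split=> [|u v uH vH]; [exact: gpred1|exact: gpredF]. Qed.

HB.instance Definition _ := SubChoice.on (subgroup H).
HB.instance Definition _ :=
  SubChoice_isSubGroup.Build G mem_H (subgroup H) subgroup_closed.

End subgroup.

Section lattice.
Context (R : realType) d (G : lcscGroupType d) (mG : {measure set G -> \bar R}).
Variable H : groupClosed G.

Definition discrete_subgroup :=
  exists2 U : set G, nbhs 1%g U & forall g, g \in H -> U g -> g = 1%g.

(* for the left translation action of H on G *)
Definition fundamental_domain (F : set G) :=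
  forall g : G, exists! h : subgroup H, F (val h * g)%g.

Definition lattice := discrete_subgroup /\
  exists F : set G, [/\ measurable F, fundamental_domain F & mG F < +oo].

End lattice.

Section orbit_space.
Context (Gam : groupType) d (T : measurableType d) (b : action Gam T).

Definition orbit_rel (x y : T) := `[< exists h, b h x = y >].

Lemma orbit_rel_refl : reflexive orbit_rel.
Proof. by move=> x; apply/asboolP; exists 1%g; rewrite act1. Qed.

Lemma orbit_rel_sym : symmetric orbit_rel.
Proof.
move=> x y; apply: asbool_equiv_eq; split=> -[h <-]; exists h^-1%g;
  by rewrite -actM mulVg act1.
Qed.

Lemma orbit_rel_trans : transitive orbit_rel.
Proof.
move=> y x z /asboolP[h <-] /asboolP[k <-]; apply/asboolP.
by exists (k * h)%g; rewrite actM.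
Qed.

Canonical orbit_equiv :=
  EquivRel orbit_rel orbit_rel_refl orbit_rel_sym orbit_rel_trans.

Definition orbit_space : Type := {eq_quot orbit_equiv}.

HB.instance Definition _ := EqQuotient.on orbit_space.
HB.instance Definition _ := Choice.on orbit_space.

Definition orbit_proj (x : T) : orbit_space := \pi_orbit_space x.

Lemma orbit_projE x y :
  orbit_proj x = orbit_proj y <-> exists h, b h x = y.
Proof.
split=> [/eqP|xy]; first by rewrite eqmodE => /asboolP.
by apply/eqP; rewrite eqmodE; apply/asboolP.
Qed.

Lemma orbit_projK (q : orbit_space) : orbit_proj (repr q) = q.
Proof. exact: reprK. Qed.

HB.instance Definition _ := isPointed.Build orbit_space (orbit_proj point).

Definition orbit_display : measure_display. Proof. exact: d. Qed.

Definition orbit_measurable : set (set orbit_space) :=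
  image_set_system setT orbit_proj (@measurable d T).

Let orbit_sigma_algebra : sigma_algebra setT orbit_measurable.
Proof. by apply: sigma_algebra_image; exact: sigma_algebra_measurable. Qed.

Let orbit_measurable0 : orbit_measurable set0.
Proof. by case: orbit_sigma_algebra. Qed.

Let orbit_measurableC A : orbit_measurable A -> orbit_measurable (~` A).
Proof. by case: orbit_sigma_algebra => _ + _ => /[apply]; rewrite setTD. Qed.

Let orbit_measurable_bigcup (F : (set orbit_space)^nat) :
  (forall i, orbit_measurable (F i)) -> orbit_measurable (\bigcup_i F i).
Proof. by case: orbit_sigma_algebra => _ _; apply. Qed.

HB.instance Definition _ := isMeasurable.Build orbit_display orbit_space
  orbit_measurable0 orbit_measurableC orbit_measurable_bigcup.

Lemma measurable_orbit_proj : measurable_fun setT orbit_proj.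
Proof. by []. Qed.

End orbit_space.

Section induced_action.
Context dG (G : lcscGroupType dG) (H : groupClosed G).
Context dZ (Z : measurableType dZ) (c : action (subgroup H) Z).

Definition translation_act (h : subgroup H) (p : G * Z) : G * Z :=
  ((val h * p.1)%g, c h p.2).

Lemma translation_act1 p : translation_act 1%g p = p.
Proof. by case: p => g z; rewrite /translation_act act1 val1 mul1g. Qed.

Lemma translation_actM h k p :
  translation_act (h * k)%g p = translation_act h (translation_act k p).
Proof. by rewrite /translation_act actM valM mulgA. Qed.

Definition translation_action : action (subgroup H) (G * Z)%type :=
  Action translation_act1 translation_actM.

Definition induced_space := orbit_space translation_action.
HB.instance Definition _ := Measurable.on induced_space.

Definition induced_proj : G * Z -> induced_space :=
  orbit_proj translation_action.

Definition induced_act (g : G) (q : induced_space) : induced_space :=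
  induced_proj (((repr q).1 * g^-1)%g, (repr q).2).

Lemma induced_actE g p :
  induced_act g (induced_proj p) = induced_proj ((p.1 * g^-1)%g, p.2).
Proof.
have /orbit_projE[h] := orbit_projK (induced_proj p).
rewrite /induced_act; move: (repr _) => -[g1 z1] <- /=.
by apply/orbit_projE; exists h; rewrite /= /translation_act /= mulgA.
Qed.

Lemma induced_act1 q : induced_act 1%g q = q.
Proof.
by rewrite /induced_act invg1 mulg1 -surjective_pairing; exact: orbit_projK.
Qed.

Lemma induced_actM g h q :
  induced_act (g * h)%g q = induced_act g (induced_act h q).
Proof. by rewrite {3}/induced_act induced_actE /= -mulgA -invgM. Qed.

Definition induced_action : action G induced_space :=
  Action induced_act1 induced_actM.

Context (R : realType) (mG : {measure set G -> \bar R}).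
Context (zeta : probability Z R) (F : set G) (mF : measurable F).

Let measurable_domain : measurable (F `*` [set: Z]).
Proof. exact: measurableX. Qed.

(* If F is a fundamental domain of H in G, then F * Z is one of H in G * Z. *)
Definition domain_measure : set induced_space -> \bar R :=
  pushforward (mrestr (mG \x zeta) measurable_domain) induced_proj.

Let mproj : measurable_fun setT induced_proj.
Proof. exact: measurable_orbit_proj. Qed.

Let domain_measure0 : domain_measure set0 = 0.
Proof. by rewrite /domain_measure /pushforward preimage_set0 measure0. Qed.

Let domain_measure_ge0 A : 0 <= domain_measure A.
Proof. exact: integral_ge0. Qed.

Let domain_measure_sigma_additive : semi_sigma_additive domain_measure.
Proof.
move=> B mB tB mUB; rewrite /domain_measure /pushforward preimage_bigcup.
apply: measure_semi_sigma_additive.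
- by move=> n; rewrite -[X in measurable X]setTI; exact: mproj.
- apply/trivIsetP => /= i j _ _ ij; rewrite -preimage_setI.
  by move/trivIsetP : tB => /(_ _ _ _ _ ij) ->//; rewrite preimage_set0.
- by rewrite -preimage_bigcup -[X in measurable X]setTI; exact: mproj.
Qed.

HB.instance Definition _ := isMeasure.Build _ _ _ domain_measure
  domain_measure0 domain_measure_ge0 domain_measure_sigma_additive.

(* The Dirac mass is only the default value of mnormalize, used when the mass
   to be normalized is 0 or +oo. *)
Definition induced_measure : probability induced_space R :=
  mnormalize domain_measure \d_point.

End induced_action.

Section isomorphism.
Context (R : realType) (G : groupType).
Context d1 (X1 : measurableType d1) (a1 : action G X1) (mu1 : probability X1 R).
Context d2 (X2 : measurableType d2) (a2 : action G X2) (mu2 : probability X2 R).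

Definition conull_invariant d (X : measurableType d) (a : action G X)
    (mu : probability X R) (A : set X) :=
  [/\ measurable A, mu (~` A) = 0 & forall g : G, a g @^-1` A = A].

(* isomorphism of probability preserving G-spaces, modulo null sets *)
Definition pp_isomorphic :=
  exists (A1 : set X1) (A2 : set X2) (f : X1 -> X2) (f' : X2 -> X1),
    [/\ conull_invariant a1 mu1 A1 /\ conull_invariant a2 mu2 A2,
        measurable_fun A1 f /\ measurable_fun A2 f',
        [/\ set_fun A1 A2 f, set_fun A2 A1 f',
            {in A1, cancel f f'} & {in A2, cancel f' f}],
        forall (g : G) x, A1 x -> f (a1 g x) = a2 g (f x) &
        forall B : set X2, measurable B -> mu1 (A1 `&` f @^-1` B) = mu2 B].

End isomorphism.

Definition induced_from_lattice (R : realType) dG (G : lcscGroupType dG)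
    (mG : {measure set G -> \bar R}) d (X : measurableType d) (a : action G X)
    (mu : probability X R) :=
  exists H : groupClosed G, lattice mG H /\
  exists dZ (Z : measurableType dZ) (zeta : probability Z R)
      (c : action (subgroup H) Z),
    [/\ standard_borel R Z, forall h, measurable_fun setT (c h),
        invariant_measure c zeta &
        exists (F : set G) (mF : measurable F), fundamental_domain H F /\
          pp_isomorphic a mu (induced_action c) (induced_measure c mG zeta mF)].

(* Main.v *)
Require Import Defs.
From HB Require Import structures.
From mathcomp Require Import finmap all_boot all_order all_algebra.
From mathcomp Require Import all_classical all_reals all_analysis.
From mathcomp Require Import measurable_realfun.

(** The proof passes through one kind of cross section: a set Y such that, for
    a discrete subgroup H, every point y of Y returns to Y exactly along H, that
    is, Y_y = H.  The other return sets are then cosets of H or empty, and a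
    fundamental domain F of H meets each coset exactly once.

    The tool throughout is the Campbell formula [campbell]: for f on G * X, the
    integral against mu of the sum of f (g, g.x) over the return set of x is the
    integral of f against m_G and the transverse measure nu.  It holds because
    the left side is right invariant in g, so that the uniqueness of Haar measure
    splits off m_G ([campbell_exists]).

    Induced actions.  In the space induced from H the classes of (1, z) form
    such a Y ([induced_cross_section]).  For any such Y, Campbell's formula for
    the indicator of F gives m_G(F) nu(Y) = mu(G.Y) = 1.  The set Y * Y is of the
    same kind for the diagonal action: the measure on X * X built from F and
    from the product of nu with itself ([suspension]) is an intersection
    measure, and the same formula gives the mass m_G(F) nu(Y)^2 = nu(Y) to every
    intersection measure ([coset_intersection_covolume]).

    Converse.  Let Y have equal intersection covolume and intensity.  Choose
    an integrable w > 0 on G.  For a pair (x1, x2), let phi be the part of the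
    sum of w over the return set of x1 that comes from the return set of x2, as
    a fraction of the whole sum.  Campbell's formula for Y * Y computes the
    integral of phi on Y^[2]: it is nu(Y), which by hypothesis is the mass of
    Y^[2].  As phi <= 1, phi = 1 almost everywhere: almost all return sets are
    contained in one another, hence almost all are one set L
    ([common_return_set]).  Discarding the orbits of the exceptional points
    makes L the return set of every remaining point; L is then a discrete
    subgroup H ([coset_cross_section_exists]), of finite covolume by the first
    computation.  Finally x -> [g, g.x], for any g in the return set of x,
    identifies X with the action induced from H on X with the normalized
    transverse measure ([induced_isomorphism]).

    Measurability rests on the theorem of Lusin and Novikov for sets with
    locally finite sections ([measurable_enumeration]), which is derived from
    the separation of countably many analytic sets with empty intersection
    ([novikov_separation]) in spaces coded by sequences of natural numbers. *)

Set Implicit Arguments.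
Unset Strict Implicit.
Unset Printing Implicit Defensive.
Import Order.TTheory GRing.Theory Num.Theory.
Local Open Scope classical_set_scope.

(** * Analytic sets *)

Notation baire := (nat -> nat).

Definition agree (l : nat) (c c' : baire) := forall j, (j < l)%N -> c j = c' j.

Definition finitary (Q : baire -> baire -> Prop) := exists l,
  forall c c' w w', agree l c c' -> agree l w w' -> Q c w -> Q c' w'.

(** A closed set of pairs of sequences, as an intersection of clopen sets. *)
Definition closed_code (I : Type) (Q : I -> baire -> baire -> Prop) :=
  forall i, finitary (Q i).

Definition solvable_code (I : Type) (Q : I -> baire -> baire -> Prop)
  (c : baire) := exists w, forall i, Q i c w.

(** The projection of a closed set: w is the coordinate projected away. *)
Definition analytic (T : Type) (psi : T -> baire) (A : set T) :=
  exists2 Q : nat -> baire -> baire -> Prop, closed_code Q &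
    A = [set x | solvable_code Q (psi x)].

(** Any countable index set is allowed, which leaves room for several kinds of
    conditions at once. *)
Lemma analyticP (I : countType) (Q : I -> baire -> baire -> Prop)
    (T : Type) (psi : T -> baire) (A : set T) : closed_code Q ->
  (forall x, A x <-> solvable_code Q (psi x)) -> analytic psi A.
Proof.
move=> fQ AQ.
exists (fun k => if unpickle k is Some i then Q i else fun _ _ => True).
  by move=> k; case: unpickle => [i|]; [exact: fQ|exists 0].
apply/seteqP; split => x /=.
  by move=> /AQ[w wQ]; exists w => k; case: unpickle.
by move=> [w wQ]; apply/AQ; exists w => i; have := wQ (pickle i); rewrite pickleK.
Qed.

Definition enc2 (p : nat * nat) : nat := pickle p.
Definition dec2 (n : nat) : nat * nat := odflt (0, 0)%N (unpickle n).
Arguments enc2 : simpl never.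
Arguments dec2 : simpl never.

Lemma dec2K : cancel enc2 dec2.
Proof. by move=> p; rewrite /dec2 /enc2 pickleK. Qed.

Lemma dec2K_fst (f g : baire) : fst \o dec2 \o (fun k => enc2 (f k, g k)) = f.
Proof. by apply/funext => k /=; rewrite dec2K. Qed.

Lemma dec2K_snd (f g : baire) : snd \o dec2 \o (fun k => enc2 (f k, g k)) = g.
Proof. by apply/funext => k /=; rewrite dec2K. Qed.

(** One witness w stands for a sequence of witnesses, its rows. *)
Definition row (n : nat) (w : baire) : baire := fun j => w (enc2 (n, j)).

Lemma row_agree n l : exists l', forall w w', agree l' w w' ->
  agree l (row n w) (row n w').
Proof.
exists (\max_(j < l) (enc2 (n, nat_of_ord j)).+1)%N => w w' ww' j jl.
apply: ww'; exact: (@leq_bigmax _ (fun j : 'I_l => (enc2 (n, nat_of_ord j)).+1) (Ordinal jl)).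
Qed.

Lemma agree_le l l' c c' : (l <= l')%N -> agree l' c c' -> agree l c c'.
Proof. by move=> ll' cc' j jl; apply: cc'; exact: leq_trans ll'. Qed.

Lemma ex_rows (W : nat -> baire) : exists w, forall n, row n w = W n.
Proof.
exists (fun k => W (dec2 k).1 (dec2 k).2) => n.
by apply/funext => j; rewrite /row dec2K.
Qed.

Section closure.
Context (T : Type) (psi : T -> baire).

(** The rows of a single witness serve all the sets at once. *)
Lemma analytic_bigcap (A : nat -> set T) :
  (forall n, analytic psi (A n)) -> analytic psi (\bigcap_n A n).
Proof.
move=> /(_ _)/cid2-/all_sig2[Q fQ AQ].
apply: (@analyticP _ (fun ni : nat * nat => fun c w => Q ni.1 ni.2 c (row ni.1 w))).
  move=> [n i] /=; have [l lQ] := fQ n i; have [l' ll'] := row_agree n l.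
  exists (maxn l l') => c c' w w' cc' ww'; apply: lQ.
    by apply: agree_le cc'; rewrite leq_maxl.
  by apply: ll'; apply: agree_le ww'; rewrite leq_maxr.
move=> x; split=> [Ax|[w wQ] n _].
  have /choice[W WQ] : forall n, exists w, forall i, Q n i (psi x) w.
    by move=> n; have := Ax n I; rewrite AQ.
  by have [w wW] := ex_rows W; exists w => -[n i] /=; rewrite wW.
by rewrite AQ; exists (row n w) => i; exact: (wQ (n, i)).
Qed.

(** The first term of the witness chooses the set; the others serve that set. *)
Lemma analytic_bigcup (A : nat -> set T) :
  (forall n, analytic psi (A n)) -> analytic psi (\bigcup_n A n).
Proof.
move=> /(_ _)/cid2-/all_sig2[Q fQ AQ].
apply: (@analyticP _ (fun ni : nat * nat => fun c w =>
    w 0%N = ni.1 -> Q ni.1 ni.2 c (w \o S))).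
  move=> [n i] /=; have [l lQ] := fQ n i.
  exists l.+1 => c c' w w' cc' ww' + w'0; rewrite (ww' 0%N)// => /(_ w'0).
  by apply: lQ => j jl; [apply: cc'; exact: ltnW|exact: ww'].
move=> x; split=> [[n _]|[w wQ]].
  rewrite AQ => -[w wQ].
  by exists (fun k => if k is j.+1 then w j else n) => -[m i] /= <-; exact: wQ.
by exists (w 0%N) => //; rewrite AQ; exists (w \o S) => i; exact: (wQ (w 0%N, i)).
Qed.

Lemma analyticU A B : analytic psi A -> analytic psi B -> analytic psi (A `|` B).
Proof.
by move=> aA aB; rewrite -bigcup2E; apply: analytic_bigcup => -[|[|n]] //=;
  apply: (@analyticP _ (fun (i : nat) c w => False)) => [_|x];
  [by exists 0|split=> // -[w /(_ 0%N)]].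
Qed.

Lemma analyticI A B : analytic psi A -> analytic psi B -> analytic psi (A `&` B).
Proof.
move=> aA aB.
have -> : A `&` B = \bigcap_n (if n is 0%N then A else B).
  by apply/seteqP; split=> [x [Ax Bx] [|n] _//|x AB]; split; [exact: (AB 0%N)|exact: (AB 1%N)].
by apply: analytic_bigcap => -[].
Qed.

End closure.

Definition pair_code T1 T2 (psi1 : T1 -> baire) (psi2 : T2 -> baire)
  (p : T1 * T2) : baire := fun k => enc2 (psi1 p.1 k, psi2 p.2 k).

(** A presentation of the measurable space T as a space of points of Baire
    space: what is needed of a standard Borel space in order to separate
    analytic sets. *)
Record coding d (T : measurableType d) (psi : T -> baire) := Coding {
  measurable_code : forall k i, measurable [set x | psi x k = i];
  code_range : exists2 Q : nat -> baire -> baire -> Prop, closed_code Q &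
    forall c, solvable_code Q c <-> exists x, psi x = c;
  measurable_analytic : forall A, measurable A -> analytic psi A
}.

Section pair.
Context T1 T2 (psi1 : T1 -> baire) (psi2 : T2 -> baire).
Let psi := pair_code psi1 psi2.

Let dec2_fst p : fst \o dec2 \o psi p = psi1 p.1.
Proof. by apply/funext => k /=; rewrite dec2K. Qed.
Let dec2_snd p : snd \o dec2 \o psi p = psi2 p.2.
Proof. by apply/funext => k /=; rewrite dec2K. Qed.

Lemma analytic_fst (A : set T1) : analytic psi1 A -> analytic psi (fst @^-1` A).
Proof.
case=> Q fQ ->; apply: (@analyticP _ (fun i c w => Q i (fst \o dec2 \o c) w)).
  move=> i; have [l lQ] := fQ i; exists l => c c' w w' cc' ww'.
  by apply: lQ => // j /cc' /= ->.
by move=> p; rewrite /solvable_code; under eq_exists do under eq_forall do rewrite dec2_fst.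
Qed.

Lemma analytic_snd (A : set T2) : analytic psi2 A -> analytic psi (snd @^-1` A).
Proof.
case=> Q fQ ->; apply: (@analyticP _ (fun i c w => Q i (snd \o dec2 \o c) w)).
  move=> i; have [l lQ] := fQ i; exists l => c c' w w' cc' ww'.
  by apply: lQ => // j /cc' /= ->.
by move=> p; rewrite /solvable_code; under eq_exists do under eq_forall do rewrite dec2_snd.
Qed.

(** The witness for y interleaves the code of a point x, a witness for (x, y) and
    a witness that the code is indeed that of a point. *)
Lemma analytic_proj (Q1 : nat -> baire -> baire -> Prop) (A : set (T1 * T2)) :
  closed_code Q1 -> (forall c, solvable_code Q1 c <-> exists x, psi1 x = c) ->
  analytic psi A -> analytic psi2 [set y | exists x, A (x, y)].
Proof.
move=> fQ1 Q1E [Q fQ ->].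
pose w1 (w : baire) : baire := fun k => (dec2 (w k)).1.
pose w2 (w : baire) : baire := fun k => (dec2 (dec2 (w k)).2).1.
pose w3 (w : baire) : baire := fun k => (dec2 (dec2 (w k)).2).2.
apply: (@analyticP _ (fun (i : nat + nat) c w => match i with
   | inl i => Q i (fun k => enc2 (w1 w k, c k)) (w2 w)
   | inr i => Q1 i (w1 w) (w3 w) end)).
  case=> i; [have [l lQ] := fQ i|have [l lQ] := fQ1 i];
    exists l => c c' w w' cc' ww'; apply: lQ => j jl;
    by rewrite /w1 /w2 /w3 ww'// cc'.
move=> y; split=> [[x [w wQ]]|[w wQ]].
  have /Q1E[t tQ] : exists x', psi1 x' = psi1 x by exists x.
  exists (fun k => enc2 (psi1 x k, enc2 (w k, t k))) => -[i|i].
    have -> : w2 (fun k => enc2 (psi1 x k, enc2 (w k, t k))) = w.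
      by apply/funext => k; rewrite /w2/= !dec2K.
    rewrite -[X in Q i X](_ : psi (x, y) = _)/=; first exact: wQ.
    by apply/funext => k; rewrite /w1/= dec2K.
  have -> : w1 (fun k => enc2 (psi1 x k, enc2 (w k, t k))) = psi1 x.
    by apply/funext => k; rewrite /w1/= dec2K.
  have -> // : w3 (fun k => enc2 (psi1 x k, enc2 (w k, t k))) = t.
  by apply/funext => k; rewrite /w3/= !dec2K.
have /Q1E[x xw] : solvable_code Q1 (w1 w) by exists (w3 w) => i; exact: (wQ (inr i)).
by exists x, (w2 w) => i; have := wQ (inl i); rewrite -xw.
Qed.

End pair.

Section bianalytic.
Context (T : Type) (psi : T -> baire).

(** Analytic sets are not closed under complement; sets that are analytic
    together with their complement form a sigma-algebra, which reaches all
    measurable sets from generators. *)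
Definition bianalytic : set (set T) :=
  [set A | analytic psi A /\ analytic psi (~` A)].

Lemma bianalytic_sigma_algebra : sigma_algebra setT bianalytic.
Proof.
split.
- split; first by apply: (@analyticP _ (fun (i : nat) c w => False)) => [_|x];
    [exists 0|split=> // -[w /(_ 0%N)]].
  by apply: (@analyticP _ (fun (i : nat) c w => True)) => [_|x];
    [exists 0|split=> [_|_ []]; exists id].
- by move=> A [aA aCA]; rewrite setTD; split; rewrite ?setCK.
- move=> F aF; split; first by apply: analytic_bigcup => n; case: (aF n).
  by rewrite setC_bigcup; apply: analytic_bigcap => n; case: (aF n).
Qed.

Lemma bianalytic_smallest (C : set (set T)) : C `<=` bianalytic ->
  <<s C >> `<=` bianalytic.
Proof. by move=> CB; apply: smallest_sub CB; exact: bianalytic_sigma_algebra. Qed.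

End bianalytic.

(** Besides the two coordinates being in range, a code in the range must consist
    of values of [enc2], whence the third kind of conditions. *)
Lemma coding_prod d1 d2 (T1 : measurableType d1) (T2 : measurableType d2)
    (psi1 : T1 -> baire) (psi2 : T2 -> baire) : coding psi1 -> coding psi2 ->
  coding (pair_code psi1 psi2).
Proof.
move=> c1 c2; split.
- move=> k i; have [/eqP ii|/eqP ii] := boolP (enc2 (dec2 i) == i).
    rewrite (_ : [set x | _] = [set x | psi1 x k = (dec2 i).1] `*`
                               [set x | psi2 x k = (dec2 i).2]).
      by apply: measurableX; exact: measurable_code.
    apply/seteqP; split => -[x y] /=; rewrite /pair_code/=.
      by move=> <-; rewrite dec2K.
    by move=> [-> ->]; rewrite -surjective_pairing ii.
  rewrite (_ : [set x | _] = set0)//; apply/seteqP; split=> -[x y] //=.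
  by rewrite /pair_code/= => xyi; apply: ii; rewrite -xyi dec2K.
- have [Q1 fQ1 Q1E] := code_range c1; have [Q2 fQ2 Q2E] := code_range c2.
  exists (fun k => if unpickle k is Some i then match i with
      | inl (inl i) => fun c w => Q1 i (fst \o dec2 \o c) (fst \o dec2 \o w)
      | inl (inr i) => fun c w => Q2 i (snd \o dec2 \o c) (snd \o dec2 \o w)
      | inr i => fun c w => enc2 (dec2 (c i)) = c i end else fun _ _ => True).
    move=> k; case: unpickle => [[[]i|i]|]; last by exists 0%N.
    + have [l lQ] := fQ1 i; exists l => c c' w w' cc' ww'.
      by apply: lQ => j jl /=; rewrite (cc',ww').
    + have [l lQ] := fQ2 i; exists l => c c' w w' cc' ww'.
      by apply: lQ => j jl /=; rewrite (cc',ww').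
    + by exists i.+1 => c c' w w' cc' ww'; rewrite cc'.
  move=> c; split=> [[w wQ]|[[x y] <-]].
    have /Q1E[x xc] : solvable_code Q1 (fst \o dec2 \o c).
      by exists (fst \o dec2 \o w) => i; have := wQ (pickle (inl (inl i) : nat + nat + nat)%type); rewrite pickleK.
    have /Q2E[y yc] : solvable_code Q2 (snd \o dec2 \o c).
      by exists (snd \o dec2 \o w) => i; have := wQ (pickle (inl (inr i) : nat + nat + nat)%type); rewrite pickleK.
    exists (x, y); apply/funext => k; rewrite /pair_code/= xc yc/= -surjective_pairing.
    by have := wQ (pickle (inr k : nat + nat + nat)%type); rewrite pickleK.
  have /Q1E[w1 w1Q] : exists x', psi1 x' = psi1 x by exists x.
  have /Q2E[w2 w2Q] : exists x', psi2 x' = psi2 y by exists y.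
  exists (fun k => enc2 (w1 k, w2 k)) => k.
  case: unpickle => [[[]i|i]|//].
  + by rewrite /pair_code !dec2K_fst.
  + by rewrite /pair_code !dec2K_snd.
  + by rewrite /pair_code dec2K.
- move=> A mA; suff [] : bianalytic (pair_code psi1 psi2) A by [].
  move: A mA; rewrite measurable_prod_measurableType; apply: bianalytic_smallest.
  move=> _ [A mA [B mB <-]]; split.
    rewrite (_ : _ `*` _ = fst @^-1` A `&` snd @^-1` B)//.
    by apply: analyticI; [apply: analytic_fst|apply: analytic_snd];
      apply: measurable_analytic.
  rewrite (_ : ~` _ = fst @^-1` (~` A) `|` snd @^-1` (~` B)).
    by apply: analyticU; [apply: analytic_fst|apply: analytic_snd];
      apply: measurable_analytic => //; exact: measurableC.
  apply/seteqP; split => -[x y] /=; first by move/not_andP.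
  by case=> h [? ?].
Qed.

(** * Separation *)

(** Novikov's argument by contradiction.  Witnesses for all the sets are built
    simultaneously, one term at a time, the term of rank [enc2 (n, j)] being the
    term j of the witness for the set n.  As long as the pieces of the sets
    compatible with the terms chosen cannot be separated, one more term can be
    chosen with the same property. *)
Section novikov.
Context d (T : measurableType d) (psi : T -> baire) (cT : coding psi).
Variable Q : nat -> nat -> baire -> baire -> Prop.
Hypothesis fQ : forall n, closed_code (Q n).

Let piece (s : seq nat) (n : nat) : set T := [set x | exists2 w,
  (forall j, (enc2 (n, j) < size s)%N -> w j = nth 0%N s (enc2 (n, j))) &
  forall i, Q n i (psi x) w].

Let separated (s : seq nat) := exists B : nat -> set T,
  [/\ forall n, measurable (B n), forall n, piece s n `<=` B n &
      \bigcap_n B n = set0].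

(** The next term constrains the witness of the single set n0: there, unite the
    separating sets of the extensions; for the other sets, intersect them. *)
Let separated_step s : (forall i, separated (rcons s i)) -> separated s.
Proof.
move=> /choice[B Bsep]; pose n0 := (dec2 (size s)).1.
exists (fun n => if n == n0 then \bigcup_i B i n else \bigcap_i B i n); split.
- move=> n; case: ifP => _; [apply: bigcup_measurable|apply: bigcap_measurable] => //.
    by move=> i _; case: (Bsep i).
  by move=> i _; case: (Bsep i).
- move=> n x [w ws wQ].
  have wi i : n != n0 \/ i = w (dec2 (size s)).2 -> piece (rcons s i) n x.
    move=> h; exists w => // j; rewrite size_rcons ltnS leq_eqVlt nth_rcons.
    case: ltngtP => //= [js _|nj _]; first exact: ws.
    by move: h; rewrite -nj /n0 -nj dec2K/= eqxx => -[].
  case: ifP => nn0.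
    exists (w (dec2 (size s)).2) => //.
    by case: (Bsep (w (dec2 (size s)).2)) => _ + _; apply; apply: wi; right.
  by move=> i _; case: (Bsep i) => _ + _; apply; apply: wi; left; rewrite nn0.
- rewrite -subset0 => x Bx.
  have := Bx n0 I; rewrite eqxx => -[i _ Bix].
  have [_ _ <-] := Bsep i => n _.
  by have := Bx n I; case: eqP => [-> _ //|_]; exact.
Qed.

Let selection : ~ separated [::] ->
  exists v : baire, forall m, ~ separated (mkseq v m).
Proof.
move=> s0.
have /choice[step stepP] : forall s, exists i, ~ separated s -> ~ separated (rcons s i).
  move=> s; have [[i si]|/forallNP h] := pselect (exists i, ~ separated (rcons s i)).
    by exists i.
  by exists 0%N => ns; exfalso; apply/ns/separated_step => i; apply: contrapT; exact: h.
pose S := fix S m := if m is m'.+1 then rcons (S m') (step (S m')) else [::].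
exists (step \o S) => m.
have [-> //] : mkseq (step \o S) m = S m /\ ~ separated (S m).
elim: m => [|m [mS sS]] //; split; first by rewrite mkseqS mS.
exact: stepP.
Qed.

(* The coordinate 0 of the family describes the point itself. *)
Hypothesis Q0 : forall i c w, Q 0 i c w <-> w i = c i.

(** The rows of the limit v are the witnesses wanted, and its row 0 is their common
    code.  A violated condition involves finitely many terms only, so a
    measurable condition C on finitely many terms of the code would separate
    the pieces 0 and n. *)
Let common_point : ~ separated [::] -> exists c, forall n, solvable_code (Q n) c.
Proof.
move=> /selection[v vs]; exists (row 0 v) => n; exists (row n v) => i.
apply: contrapT => nQ.
have [l lQ] := fQ n i.
pose m := (\max_(j < l) maxn (enc2 (0%N, nat_of_ord j)).+1 (enc2 (n, nat_of_ord j)).+1)%N.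
have m0 j : (j < l)%N -> (enc2 (0%N, j) < m)%N.
  move=> jl; apply: leq_trans (@leq_bigmax _ (fun j : 'I_l => maxn (enc2 (0%N, nat_of_ord j)).+1 (enc2 (n, nat_of_ord j)).+1) (Ordinal jl)).
  by rewrite leq_maxl.
have mn j : (j < l)%N -> (enc2 (n, j) < m)%N.
  move=> jl; apply: leq_trans (@leq_bigmax _ (fun j : 'I_l => maxn (enc2 (0%N, nat_of_ord j)).+1 (enc2 (n, nat_of_ord j)).+1) (Ordinal jl)).
  by rewrite leq_maxr.
pose C := [set x | forall j, (j < l)%N -> psi x j = row 0 v j].
have mC : measurable C.
  rewrite (_ : C = \bigcap_j [set x | (j < l)%N -> psi x j = row 0 v j]).
    apply: bigcap_measurable => // j _; have [jl|jl] := boolP (j < l)%N.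
      rewrite (_ : [set x | _] = [set x | psi x j = row 0 v j]); first exact: measurable_code.
      by apply/seteqP; split=> x /=; [exact|move=> + _].
    by rewrite (_ : [set x | _] = setT)//; apply/seteqP; split.
  by apply/seteqP; split => x Cx j; [move=> _ /=|]; exact: Cx.
have pieceC : piece (mkseq v m) 0 `<=` C.
  move=> x [w ws /(_ _)/Q0 wQ] j jl; rewrite -wQ ws ?size_mkseq ?m0//.
  by rewrite nth_mkseq ?m0.
have pieceN : piece (mkseq v m) n `<=` ~` C.
  move=> x [w ws wQ] Cx; apply: nQ; apply: lQ (wQ i); first exact: Cx.
  by move=> j jl; rewrite ws ?size_mkseq ?mn// nth_mkseq ?mn.
apply: (vs m).
have [n0|n0] := eqVneq n 0%N.
  exists (fun k => if k == 0%N then set0 else setT); split.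
  - by move=> k; case: ifP => _.
  - by move=> k; case: eqP => // -> x px; have := pieceC _ px; rewrite -n0 in px *; move/pieceN : px.
  - by rewrite -subset0 => x /(_ 0%N I).
exists (fun k => if k == 0%N then C else if k == n then ~` C else setT); split.
- by move=> k; case: ifP => // _; case: ifP => // _; exact: measurableC.
- by move=> k; case: eqP => [->//|_]; case: eqP => [->|].
- rewrite -subset0 => x Bx; have := Bx 0%N I; have := Bx n I.
  by rewrite /= eqxx (negbTE n0).
Qed.

Lemma common_code : (forall B : nat -> set T, (forall n, measurable (B n)) ->
    (forall n, [set x | solvable_code (Q n) (psi x)] `<=` B n) ->
    \bigcap_n B n <> set0) -> exists c, forall n, solvable_code (Q n) c.
Proof.
move=> h; apply: common_point => -[B [mB AB B0]]; apply: (h B) => // n x [w wQ].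
by apply: AB; exists w.
Qed.

End novikov.

(** The code itself and the range of the coding are added to the family, so that
    the common code found is that of a point. *)
Lemma novikov_separation d (T : measurableType d) (psi : T -> baire)
    (A : nat -> set T) : coding psi -> (forall n, analytic psi (A n)) ->
  \bigcap_n A n = set0 -> exists B : nat -> set T,
  [/\ forall n, measurable (B n), forall n, A n `<=` B n & \bigcap_n B n = set0].
Proof.
move=> cT /(_ _)/cid2-/all_sig2[Q fQ AQ] A0.
have [R fR RE] := code_range cT.
apply: contrapT => nsep.
pose P n := match n with 0 => fun i (c w : baire) => w i = c i
  | 1 => R | n.+2 => Q n end%N.
have fP n : closed_code (P n).
  case: n => [|[|n]]//= i; exists i.+1 => c c' w w' cc' ww' /=.
  by rewrite cc'// ww'.
have [//||c cP] := @common_code _ _ _ cT P fP.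
  move=> B mB PB B0; apply: nsep; exists (fun n => B n.+2); split => //.
    by move=> n; rewrite AQ; exact: (PB n.+2).
  rewrite -subset0 => x Bx; rewrite -B0 => -[|[|n]] _; last exact: Bx.
    by apply: (PB 0%N); exists (psi x).
  by apply: (PB 1%N); apply/RE; exists x.
have /RE[x xc] := cP 1%N.
suff : (\bigcap_n A n) x by rewrite A0.
by move=> n _; rewrite AQ/= xc; exact: cP n.+2.
Qed.

Lemma lusin_separation d (T : measurableType d) (psi : T -> baire)
    (A B : set T) : coding psi -> analytic psi A -> analytic psi B ->
  A `&` B = set0 -> exists C, [/\ measurable C, A `<=` C & C `&` B = set0].
Proof.
move=> cT aA aB AB0.
pose F n := match n with 0 => A | 1 => B | _ => [set: T] end%N.
have [||C [mC FC C0]] := @novikov_separation _ _ psi F cT.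
- by case=> [|[|n]]//=; exact: measurable_analytic.
- rewrite -subset0 => x Fx; rewrite -AB0; split; [exact: (Fx 0%N)|exact: (Fx 1%N)].
- exists (C 0%N); split; [by []|exact: (FC 0%N)|].
  rewrite -subset0 => x [C0x Bx]; rewrite -C0 => -[|[|n]] _ //.
    exact: (FC 1%N).
  exact: (FC n.+2).
Qed.

(** * Codes of standard Borel spaces and of locally compact groups *)

Definition countable_base (S : topologicalType) (V : nat -> set S) :=
  (forall n, open (V n)) /\
  forall x U, nbhs x U -> exists2 n, V n x & V n `<=` U.

Lemma second_countable_base (S : ptopologicalType) :
  @second_countable S -> exists V, @countable_base S V.
Proof.
move=> [B cB [oB bB]].
have [B0|[f]] : B = set0 \/ $|{surjfun [set: nat] >-> B}| by exact/pfcard_geP.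
  have [U [+ _] _] := bB point setT filterT; by rewrite B0.
exists f; split=> [n|x U /bB[W [BW Wx] WU]]; first by apply: oB; exact: funS.
by have [n _ nW] := 'surj_f BW; exists n; rewrite nW.
Qed.

(** A point is coded by the basic open sets that contain it.  The covers U k
    express completeness: a filter that contains one member of each of them has
    a cluster point. *)
Section base_code.
Context (S : topologicalType) (V : nat -> set S) (bV : countable_base V).
Hypothesis regS : regular_space S.

Let base_closure x U : nbhs x U -> exists2 n, V n x & closure (V n) `<=` U.
Proof.
move=> /regS[W xW WU]; have [n Vnx VW] := bV.2 _ _ xW.
by exists n => //; apply: subset_trans WU; exact: closure_subset.
Qed.

Let base_openE O : open O -> O = \bigcup_(n in [set n | V n `<=` O]) V n.
Proof.
move=> oO; apply/seteqP; split=> [x Ox|x [n nO /nO]//].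
by have [n Vnx VO] := bV.2 _ _ (open_nbhs_nbhs (conj oO Ox)); exists n.
Qed.

Context d (T : measurableType d) (f : T -> S).
Hypothesis sf : forall y, exists x, f x = y.
Hypothesis mT : @measurable d T = preimage_set_system setT f <<s @open S >>.

Variable U : nat -> nat -> set S.
Hypothesis coverU : forall k y, exists n, U k n y.
Hypothesis completeU : forall (u : baire) (F : set_system S), ProperFilter F ->
  (forall k, F (U k (u k))) -> exists y, cluster F y.

Definition base_code (x : T) : baire := fun i => `[< V i (f x) >].

Let open_measurable O : open O -> measurable (f @^-1` O).
Proof.
move=> oO; rewrite mT; exists O; last by rewrite setTI.
exact: sub_sigma_algebra.
Qed.

(* The closed condition at j on a point y whose code is c; the witness w gives a
   closed neighborhood of y within V j and the member of the cover U j that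
   contains y. *)
Let place (c w : baire) (j : nat) : set S := U j (dec2 (w j)).2 `&`
  [set y | (c j = 1%N /\ closure (V (dec2 (w j)).1) `<=` V j /\
              closure (V (dec2 (w j)).1) y) \/ (c j = 0%N /\ ~ V j y)].

Let cluster_closed (F : set_system S) y C : closed C -> F C -> cluster F y -> C y.
Proof. by move=> clC FC Fy; rewrite ((closure_id C).1 clC) => B yB; exact: Fy FC yB. Qed.

Let code (i : nat) (c w : baire) :=
  exists y, forall j, (j < i)%N -> place c w j y.

Let code_closed : closed_code code.
Proof.
move=> i; exists i => c c' w w' cc' ww' [y yc]; exists y => j ji.
by have := yc j ji; rewrite /place /= cc'// ww'.
Qed.

Let code_solvable c : solvable_code code c <-> exists x, base_code x = c.
Proof.
split=> [[w wc]|[x <-]]; last first.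
  have /choice[w wP] : forall j, exists n, place (base_code x) (fun=> n) j (f x).
    move=> j; have [k Ukx] := coverU j (f x).
    rewrite /place /base_code /=; case: asboolP => /= [Vjx|nVjx].
      have [n Vnx nj] := base_closure (open_nbhs_nbhs (conj (bV.1 j) Vjx)).
      exists (enc2 (n, k)); rewrite dec2K; split=> //=; left; split=> //.
      by split=> //; exact: subset_closure.
    by exists (enc2 (0%N, k)); rewrite dec2K; split=> //; right.
  by exists w => i; exists (f x) => j _; exact: wP.
pose D i := [set y | forall j, (j < i)%N -> place c w j y].
have D0 i : D i !=set0 by have [y yc] := wc i; exists y.
have DS i k : (i <= k)%N -> D k `<=` D i.
  by move=> ik y Dy j ji; apply: Dy; exact: leq_trans ik.
have PF : ProperFilter (filter_from setT D).
  apply: filter_from_proper => //; apply: filter_from_filter; first by exists 0%N.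
  move=> i k _ _; exists (maxn i k) => // y Dy.
  by split; apply: DS Dy; rewrite ?leq_maxl ?leq_maxr.
have Fplace j : filter_from setT D (place c w j).
  by exists j.+1 => // y; apply.
have [|y Fy] := @completeU (fun k => (dec2 (w k)).2) _ PF.
  by move=> k; case: (Fplace k) => i _ Di; exists i => // y /Di[].
have [x xy] := sf y; exists x; apply/funext => j; rewrite /base_code xy.
have [i _ Di] := Fplace j.
have [z /Di[_ [[cj [mj _]]|[cj _]]]] := D0 i; rewrite cj.
  suff Vjy : V j y by rewrite asboolT.
  apply: mj; apply: cluster_closed Fy; first exact: closed_closure.
  by exists i => // t /Di[_ [[_ [_]]//|[]]]; rewrite cj.
suff nVjy : ~ V j y by rewrite asboolF.
apply: (@cluster_closed _ y (~` V j)) Fy; first exact/open_closedC/bV.1.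
by exists i => // t /Di[_ [[]|[_ //]]]; rewrite cj.
Qed.

Let coordinate_analytic j v : analytic base_code [set x | base_code x j = v].
Proof.
apply: (@analyticP _ (fun (i : nat) c w => c j = v)).
  by move=> i; exists j.+1 => c c' w w' cc' _; rewrite cc'.
by move=> x; split=> [xj|[w /(_ 0%N)//]]; exists id.
Qed.

(** The sets [place] realized by one code generate a filter; its cluster point,
    given by completeness, has that code because each condition places the point
    in a closed set on which the coordinate j is constant. *)
Lemma coding_base : coding base_code.
Proof.
have base1 j : [set x | base_code x j = 1%N] = f @^-1` V j.
  by apply/seteqP; split=> x; rewrite /= /base_code; case: asboolP.
have base0 j : [set x | base_code x j = 0%N] = ~` (f @^-1` V j).
  by apply/seteqP; split=> x; rewrite /= /base_code; case: asboolP.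
split.
- move=> k [|[|i]]; [rewrite base0|rewrite base1|].
  + by apply/measurableC/open_measurable/bV.1.
  + by apply/open_measurable/bV.1.
  + rewrite (_ : [set x | _] = set0)//; apply/seteqP; split=> x //=.
    by rewrite /base_code; case: asboolP.
- by exists code.
- move=> A; rewrite mT => -[B mB <-]; rewrite setTI.
  suff : <<s @open S >> `<=` [set B | bianalytic base_code (f @^-1` B)].
    by move=> /(_ _ mB)[].
  apply: smallest_sub.
    split=> [|C [aC aC']|F aF]; rewrite /= ?preimage_set0.
    + by have [] := bianalytic_sigma_algebra base_code.
    + rewrite setTD preimage_setC.
      have [_ /(_ (f @^-1` C)) + _] := bianalytic_sigma_algebra base_code.
      by rewrite setTD; apply.
    + rewrite preimage_bigcup.
      by have [_ _] := bianalytic_sigma_algebra base_code; apply.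
  move=> O oO; rewrite /= (base_openE oO) preimage_bigcup; split.
    rewrite bigcup_mkcond; apply: analytic_bigcup => n; case: ifP => _.
      by rewrite -base1.
    by have [[]] := bianalytic_sigma_algebra base_code.
  rewrite setC_bigcup bigcap_mkcond; apply: analytic_bigcap => n; case: ifP => _.
    by rewrite -base0.
  by have [[]] := bianalytic_sigma_algebra base_code; rewrite setC0.
Qed.

End base_code.

(** A filter containing a member of each cover by small balls is a Cauchy filter. *)
Lemma coding_standard_borel (R : realType) d (X : measurableType d) :
  standard_borel R X -> exists psi : X -> baire, coding psi.
Proof.
move=> [P [f [_ scP [g fK gK] mX]]].
have [V bV] := second_countable_base scP.
pose small k n := `[< exists y, V n `<=` ball y (k.+1%:R^-1 : R)%R >].
exists (base_code V f).
apply: (@coding_base _ _ bV uniform_regular _ _ _ _ mX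
  (fun k n => if small k n then V n else set0)).
- by move=> y; exists (g y).
- move=> k y.
  have [|n Vny Vn] := bV.2 y (ball y (k.+1%:R^-1 : R)%R).
    by apply: nbhsx_ballx; rewrite invr_gt0.
  by exists n; rewrite ifT//; apply/asboolP; exists y.
- move=> u F PF FU.
  have /cauchy_cvg Fc : cauchy F.
    apply: cauchy_exP => e e0.
    have [k ke] : exists k, (k.+1%:R^-1 < e)%R.
      by have [k _ ke] := near_infty_natSinv_lt (PosNum e0); exists k; exact: ke (leqnn k).
    have := FU k; case: ifP => [/asboolP[y Vy]|_ F0]; last by have := @filter_not_empty _ F _ F0.
    move=> FV; exists y; apply: filterS FV; apply: subset_trans Vy _.
    by apply: le_ball; exact: ltW.
  by exists (lim F); rewrite cluster_cvgE; exists F => //; split.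
Qed.

Lemma lcsc_base (d : measure_display) (G : lcscGroupType d) : exists V, @countable_base G V.
Proof. exact/second_countable_base/lcsc_second_countable. Qed.

Lemma lcsc_compact_nbhs d (G : lcscGroupType d) (g : G) :
  exists K : set G, [/\ compact K, closed K & nbhs g K].
Proof.
have [K /= gK [cK clK]] := @lcsc_locally_compact _ G g I.
exists K; split=> //; have : nbhs g [set x | [set: G] x -> K x] := gK.
by apply: filterS => x /=; apply.
Qed.

Lemma lcsc_regular d (G : lcscGroupType d) : @regular_space G.
Proof.
move=> g; have [K [cK _ gK]] := lcsc_compact_nbhs g.
exact: compact_regular (@lcsc_hausdorff _ G) cK gK.
Qed.

Lemma lcsc_compact_closure d (G : lcscGroupType d) (V : nat -> set G) (g : G) :
  countable_base V -> exists2 n, V n g & compact (closure (V n)).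
Proof.
move=> bV; have [K [cK clK gK]] := lcsc_compact_nbhs g.
have [n Vng VK] := bV.2 _ _ gK; exists n => //.
apply: (subclosed_compact (closed_closure (A := V n)) cK).
by rewrite [K](closure_id _).1//; exact: closure_subset.
Qed.

(** The cover by relatively compact basic sets suffices: it gives cluster points. *)
Lemma coding_lcsc d (G : lcscGroupType d) : exists psi : G -> baire, coding psi.
Proof.
have [V bV] := lcsc_base G; exists (base_code V id).
apply: (@coding_base _ _ bV (@lcsc_regular _ G) _ _ id _ _
  (fun k n => if `[< compact (closure (V n)) >] then V n else set0)).
- by move=> y; exists y.
- by rewrite lcsc_borelE /preimage_set_system; apply/seteqP; split=> [A|A [B sB <-]];
    [exists A => //; rewrite setTI preimage_id|rewrite setTI preimage_id].
- move=> _ g; have [n Vng cVn] := lcsc_compact_closure g bV.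
  by exists n; rewrite asboolT.
- move=> u F PF /(_ 0%N); case: ifP => [/asboolP cV FV|_ F0].
    by have [y [_ Fy]] := cV _ PF (filterS (@subset_closure _ _) FV); exists y.
  by have := @filter_not_empty _ F _ F0.
Qed.

(** * Borel sets with locally finite sections *)

Lemma open_measurable_lcsc d (G : lcscGroupType d) (U : set G) :
  open U -> measurable U.
Proof. by move=> oU; rewrite lcsc_borelE; exact: sub_sigma_algebra. Qed.

Lemma closed_measurable_lcsc d (G : lcscGroupType d) (F : set G) :
  closed F -> measurable F.
Proof.
by move=> cF; rewrite -[F]setCK; apply/measurableC/open_measurable_lcsc/closed_openC.
Qed.

Lemma lcsc_finite_closed d (G : lcscGroupType d) (A : set G) :
  finite_set A -> closed A.
Proof.
exact: (accessible_finite_set_closed.1 (hausdorff_accessible (@lcsc_hausdorff _ G))).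
Qed.

Section projection.
Context dG (G : lcscGroupType dG) d (T : measurableType d) (psi : T -> baire).
Hypothesis cT : coding psi.
Variables (V : nat -> set G) (bV : countable_base V).

(** The theorem of Kunugui and Novikov for compact sections.  The section at x is
    empty if and only if K is covered by basic sets V n that miss it, that is,
    with x outside the analytic set M n.  Separation replaces the coanalytic
    complement of M n by a measurable set C n, still large enough for the
    covering; by compactness only the countably many finite covers matter. *)
Lemma measurable_proj_compact (E : set (G * T)) (K : set G) : measurable E ->
  compact K -> (forall x, [set g | E (g, x)] `<=` K) ->
  (forall x, closed [set g | E (g, x)]) -> measurable [set x | exists g, E (g, x)].
Proof.
move=> mE cK EK clE.
have [psiG cG] := coding_lcsc G.
have [QG fQG QGE] := code_range cG.
have cGT := coding_prod cG cT.
have mV n : measurable (V n) by apply/open_measurable_lcsc/bV.1.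
pose M n := [set x | exists g, (E `&` fst @^-1` V n) (g, x)].
have aM n : analytic psi (M n).
  apply: (analytic_proj fQG QGE); apply: (measurable_analytic cGT).
  by apply: measurableI => //; rewrite -[_ @^-1` _]setTI; exact: measurable_fst.
pose A n := if n is m.+1 then fst @^-1` (~` V m) `|` snd @^-1` M m else ~` E.
have [||B [mB AB B0]] := @novikov_separation _ _ _ A cGT.
- case=> [|n] /=; first by apply: (measurable_analytic cGT); exact: measurableC.
  apply: analyticU; last exact: analytic_snd.
  by apply: analytic_fst; apply: (measurable_analytic cG); exact: measurableC.
- rewrite -subset0 => -[g x] Agx; have nE := Agx 0%N I.
  have [|n Vng Vn] := bV.2 g (~` [set g | E (g, x)]).
    by apply: open_nbhs_nbhs; split=> //; exact: closed_openC.
  by have [//|[h [Ehx Vnh]]] := Agx n.+1 I; exact: (Vn h).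
pose N n := [set x | exists g, (~` B n.+1) (g, x)].
have aN n : analytic psi (N n).
  by apply: (analytic_proj fQG QGE); apply: (measurable_analytic cGT); exact: measurableC.
have /choice[C CP] : forall n, exists C, [/\ measurable C, N n `<=` C & C `&` M n = set0].
  move=> n; apply: (lusin_separation cT (aN n) (aM n)).
  by rewrite -subset0 => x [[g nB] Mnx]; apply: nB; apply: AB; right.
rewrite (_ : [set x | _] = ~` \bigcup_(l in [set l : {fset nat} | K `<=` \bigcup_(n in [set` l]) V n])
    \bigcap_(n in [set` l]) C n); last first.
  apply/seteqP; split=> x /=.
    move=> [g Egx] [l Kl Clx]; have [n nl Vng] := Kl g (EK _ _ Egx).
    have [_ _] := CP n; rewrite -subset0 => /(_ x); apply; split; first exact: Clx.
    by exists g.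
  move=> nl; apply: contrapT => /forallNP nE; apply: nl.
  have KV : K `<=` \bigcup_(n in [set n | C n x]) V n.
    move=> g _; have : ~ (\bigcap_n B n) (g, x) by rewrite B0.
    move=> /existsNP[n] /not_implyP[_ nB].
    case: n nB => [|n] nB; first by exfalso; apply/nB/AB/nE.
    have [_ NC _] := CP n; exists n; first by apply: NC; exists g.
    by apply: contrapT => nV; apply/nB/AB; left.
  have := cK; rewrite compact_cover => /(_ nat [set n | C n x] V).
  move=> /(_ (fun n _ => bV.1 n) KV)[D' D'C KD'].
  by exists D' => // n /= /D'C /set_mem.
apply: measurableC; rewrite bigcup_mkcond; apply: countable_bigcupT_measurable => // l.
case: ifP => // _; apply: bigcap_measurableType => n _.
by case: (CP n).
Qed.

(** G is a countable union of compact sets, and locally finite sets are closed. *)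
Lemma measurable_proj (E : set (G * T)) : measurable E ->
  (forall x, locally_finite [set g | E (g, x)]) ->
  measurable [set x | exists g, E (g, x)].
Proof.
move=> mE lfE.
rewrite (_ : [set x | _] = \bigcup_(n in [set n | compact (closure (V n))])
    [set x | exists g, (E `&` fst @^-1` closure (V n)) (g, x)]).
  apply: bigcup_measurable => n /= cV; apply: (@measurable_proj_compact (E `&` fst @^-1` closure (V n)) _ _ cV).
  - apply: measurableI => //; rewrite -[_ @^-1` _]setTI; apply: measurable_fst => //.
    exact/closed_measurable_lcsc/closed_closure.
  - by move=> x g /= [].
  - by move=> x; apply: lcsc_finite_closed; exact: lfE.
apply/seteqP; split=> [x [g Egx]|x [n _ [g [Egx _]]]]; last by exists g.
have [n Vng cVn] := lcsc_compact_closure g bV.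
by exists n => //; exists g; split=> //; exact: subset_closure.
Qed.

End projection.

Lemma locally_finiteS dG (G : lcscGroupType dG) (A B : set G) :
  A `<=` B -> locally_finite B -> locally_finite A.
Proof. by move=> AB lfB K /lfB; apply: sub_finite_set; exact: setSI. Qed.

Definition enumerates dG (G : lcscGroupType dG) d (T : measurableType d)
    (E : T -> set G) (D : nat -> set T) (s : nat -> T -> G) :=
  [/\ forall n, measurable (D n), forall n, measurable_fun setT (s n) &
      forall x, set_bij [set n | D n x] (E x) (s^~ x)].

(** The theorem of Lusin and Novikov.  The set R n consists of the points whose
    section is met by two disjoint basic subsets of V n; off R n, at most one
    point of the section lies in V n.  Since sections are locally finite, each
    of their points is isolated by some V n. *)
Lemma measurable_enumeration dG (G : lcscGroupType dG) d (T : measurableType d)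
    (psi : T -> baire) (E : set (G * T)) : coding psi -> measurable E ->
  (forall x, locally_finite [set g | E (g, x)]) ->
  exists (D : nat -> set T) (s : nat -> T -> G),
    enumerates (fun x => [set g | E (g, x)]) D s.
Proof.
move=> cT mE lfE.
have [V bV] := lcsc_base G.
have mfst (A : set G) : measurable A -> measurable ((fst : G * T -> G) @^-1` A).
  by move=> mA; rewrite -[_ @^-1` _]setTI; exact: measurable_fst.
have msnd (A : set T) : measurable A -> measurable ((snd : G * T -> T) @^-1` A).
  by move=> mA; rewrite -[_ @^-1` _]setTI; exact: measurable_snd.
have mV n : measurable (V n) by apply/open_measurable_lcsc/bV.1.
have mproj (F : set (G * T)) : measurable F -> measurable [set x | exists g, (E `&` F) (g, x)].
  move=> mF; apply: (measurable_proj cT bV); first exact: measurableI.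
  by move=> x; apply: locally_finiteS (lfE x) => g [].
pose hit n x := exists g, (E `&` fst @^-1` V n) (g, x).
pose R n := \bigcup_(ij in [set ij : nat * nat | [/\ V ij.1 `<=` V n, V ij.2 `<=` V n & V ij.1 `&` V ij.2 = set0]])
   ([set x | hit ij.1 x] `&` [set x | hit ij.2 x]).
have mR n : measurable (R n).
  rewrite /R bigcup_mkcond; apply: countable_bigcupT_measurable => // ij.
  by case: ifP => // _; apply: measurableI; apply: mproj; exact: mfst.
pose En n := E `&` fst @^-1` V n `\` snd @^-1` R n.
have mEn n : measurable (En n).
  apply: measurableD; last exact: msnd.
  by apply: measurableI => //; exact: mfst.
have E1 n x g h : En n (g, x) -> En n (h, x) -> g = h.
  move=> [[Eg Vg] nR] [[Eh Vh] _]; apply: contrapT => gh; apply: nR.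
  have : hausdorff_space G by exact: lcsc_hausdorff.
  rewrite open_hausdorff => /(_ g h); case/(_ (introN eqP gh)) => -[A B] /= [/set_mem Ag /set_mem Bh] [oA oB AB].
  have [i Vig iA] := bV.2 g (A `&` V n) (open_nbhs_nbhs (conj (openI oA (bV.1 n)) (conj Ag Vg))).
  have [j Vjh jB] := bV.2 h (B `&` V n) (open_nbhs_nbhs (conj (openI oB (bV.1 n)) (conj Bh Vh))).
  exists (i, j); last by split; [exists g|exists h].
  split=> /=; [by move=> t /iA[]|by move=> t /jB[]|].
  by rewrite -subset0 -(eqP AB) => t [/iA[At _] /jB[Bt _]].
have Ecover : E = \bigcup_n En n.
  apply/seteqP; split=> [[g x] Egx|p [n _ [[]]]//].
  have [K [cK _ gK]] := lcsc_compact_nbhs g.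
  pose A := ~` ([set h | E (h, x)] `&` K `\ g).
  have oA : open A.
    apply: closed_openC; apply: lcsc_finite_closed.
    by apply: sub_finite_set (lfE x K cK) => h [].
  have gA : nbhs g (A `&` K).
    by apply: filterI => //; apply: open_nbhs_nbhs; split=> // -[_]; apply.
  have [n Vng VA] := bV.2 _ _ gA; exists n => //; split; first by split.
  move=> [[i j] /= [iV jV ij0] [[h [/= Eh Vih]] [k [/= Ek Vjk]]]].
  have only t : E (t, x) -> V n t -> t = g.
    move=> Et /VA[nA Kt]; apply: contrapT => tg; apply: nA.
    by split; [split|].
  have hg : h = g by apply: only => //; exact: iV.
  have kg : k = g by apply: only => //; exact: jV.
  suff : (V i `&` V j) g by rewrite ij0.
  by split; [rewrite -hg|rewrite -kg].
pose F := seqDU En.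
have mF n : measurable (F n).
  by apply: measurableD => //; apply: bigsetU_measurable => k _.
have FE n : F n `<=` En n by apply: subset_seqDU.
pose D n := [set x | exists g, (E `&` F n) (g, x)].
pose s n x := if pselect (D n x) is left Dx then projT1 (cid Dx) else 1%g.
have sP n x : D n x -> (E `&` F n) (s n x, x).
  by move=> Dx; rewrite /s; case: pselect => // Dx'; case: cid.
have sE n x g : F n (g, x) -> D n x /\ s n x = g.
  move=> Fg; have Eg : E (g, x) by have [[]] := FE _ _ Fg.
  have Dx : D n x by exists g.
  split=> //; have [_ /FE Es] := sP _ _ Dx; exact: E1 Es (FE _ _ Fg).
exists D, s; split.
- by move=> n; exact: mproj.
- move=> n _ B mB; rewrite setTI.
  rewrite (_ : _ @^-1` _ = [set x | exists g, (E `&` (F n `&` fst @^-1` B)) (g, x)] `|`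
     (~` D n `&` [set _ | B 1%g])).
    apply: measurableU; first by apply/mproj/measurableI => //; exact: mfst.
    apply: measurableI; first exact/measurableC/mproj.
    have [B1|nB1] := pselect (B 1%g).
      by rewrite (_ : [set _ | _] = setT)//; apply/seteqP; split.
    by rewrite (_ : [set _ | _] = set0)//; apply/seteqP; split.
  apply/seteqP; split=> x /=.
    move=> Bs; have [Dx|nDx] := pselect (D n x).
      by left; exists (s n x); have [Es Fs] := sP _ _ Dx.
    by right; split=> //; move: Bs; rewrite /s; case: pselect.
  move=> [[g [_ [Fg Bg]]]|[nD B1]]; first by have [_ ->] := sE _ _ _ Fg.
  by rewrite /s; case: pselect.
- move=> x; split.
  + by move=> n /sP[].
  + move=> n m /set_mem Dn /set_mem Dm snm.
    have [_ Fn] := sP _ _ Dn; have [_ Fm] := sP _ _ Dm.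
    apply: (@trivIset_seqDU _ En n m I I); exists (s n x, x); split=> //.
    by rewrite snm.
  + move=> g /= Eg; have : E (g, x) := Eg; rewrite Ecover seqDU_bigcup_eq => -[n _ Fg].
    by have [Dn sg] := sE _ _ _ Fg; exists n.
Qed.

Local Open Scope ring_scope.
Local Open Scope ereal_scope.

(** * Sums over countable sets *)

Lemma ge0_integral_mrestr d (T : measurableType d) (R : realType)
    (m : {measure set T -> \bar R}) (D : set T) (mD : measurable D)
    (f : T -> \bar R) : measurable_fun setT f -> (forall x, 0 <= f x) ->
  \int[mrestr m mD]_x f x = \int[m]_(x in D) f x.
Proof.
move=> mf f0.
have fD0 x : 0 <= (f \_ D) x by rewrite patchE; case: ifP.
have mfD : measurable_fun setT (f \_ D).
  by apply/(measurable_restrictT _ mD); exact: measurable_funTS.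
have mDC : measurable (~` D) by exact: measurableC.
rewrite [RHS]integral_mkcond.
rewrite [RHS](_ : _ = \int[measure_add (mrestr m mD) (mrestr m mDC)]_x (f \_ D) x); last first.
  apply: eq_measure_integral => A mA _; 
  transitivity (mrestr m mD A + mrestr m mDC A); last exact/esym/measure_addE.
  rewrite /mrestr.
  rewrite -measureU//; [|exact: measurableI|exact: measurableI|].
    by rewrite -setIUr setUv setIT.
  by rewrite setIACA setICr setI0.
rewrite ge0_integral_measure_add//.
rewrite [X in _ + X](_ : _ = 0) ?adde0; last first.
  transitivity (\int[mrestr m mDC]_x cst 0 x); last exact: integral0.
  apply: ge0_ae_eq_integral => //.
  exists D; split=> //; first by rewrite /= /mrestr setICr measure0.
  move=> x /= nx; apply: contrapT => Dx; apply: nx => _.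
  by rewrite patchE memNset.
apply: ge0_ae_eq_integral => //.
exists (~` D); split=> //; first by rewrite /= /mrestr setICl measure0.
move=> x /= nx Dx; apply: nx => _; by rewrite patchE mem_set.
Qed.

Section esum.
Context (R : realType).

Lemma esum_enum (G : choiceType) (S : set G) (P : set nat) (e : nat -> G)
    (f : G -> \bar R) : set_bij P S e -> (forall g, S g -> 0 <= f g) ->
  \esum_(g in S) f g = \sum_(n <oo) ((f \o e) \_ P) n.
Proof.
move=> bij f0; rewrite (reindex_esum P S e)// esum_mkcond nneseries_esumT//.
move=> n; rewrite patchE; case: ifPn => // /set_mem Pn.
by apply: f0; case: bij => /(_ n Pn).
Qed.

Lemma integral_countable_esum (G : choiceType) (S : set G) (P : set nat) (e : nat -> G)
    d (T : measurableType d) (m : {measure set T -> \bar R})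
    (f : G -> T -> \bar R) : set_bij P S e ->
  (forall g, measurable_fun setT (f g)) -> (forall g x, 0 <= f g x) ->
  \int[m]_x (\esum_(g in S) f g x) = \esum_(g in S) \int[m]_x f g x.
Proof.
move=> bij mf f0.
under eq_integral do rewrite (esum_enum bij)//.
rewrite integral_nneseries//; last 2 first.
- move=> n; under eq_fun do rewrite patchE; case: (n \in P); [exact: mf|exact: measurable_cst].
- by move=> n x _; rewrite patchE; case: (n \in P) => //; exact: f0.
rewrite (esum_enum bij); last by move=> g _; exact: integral_ge0.
apply: eq_eseriesr => n _; rewrite patchE; case: ifPn => nP.
  by apply: eq_integral => x _; rewrite patchE nP.
by rewrite integral0_eq// => x _; rewrite patchE (negbTE nP).
Qed.

Lemma measurable_countable_esum (G : choiceType) (S : set G) (P : set nat)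
    (e : nat -> G) d (T : measurableType d) (f : G -> T -> \bar R) :
  set_bij P S e ->
  (forall g, measurable_fun setT (f g)) -> (forall g x, 0 <= f g x) ->
  measurable_fun setT (fun x => \esum_(g in S) f g x).
Proof.
move=> bij mf f0; under eq_fun do rewrite (esum_enum bij)//.
apply: ge0_emeasurable_sum => [n x _ _|n _].
  by rewrite patchE; case: (n \in P) => //; exact: f0.
by under eq_fun do rewrite patchE; case: (n \in P); [exact: mf|exact: measurable_cst].
Qed.

Context dG (G : lcscGroupType dG) d (T : measurableType d).
Variables (E : T -> set G) (D : nat -> set T) (s : nat -> T -> G).
Hypothesis enumE : enumerates E D s.
Variable h : G * T -> \bar R.
Hypotheses (mh : measurable_fun setT h) (h0 : forall p, 0 <= h p).

Let term n := (fun x => h (s n x, x)) \_ (D n).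

Let esum_term x : \esum_(g in E x) h (g, x) = \sum_(n <oo) term n x.
Proof.
by have [_ _ bij] := enumE; rewrite (esum_enum (bij x)).
Qed.

Let mterm n : measurable_fun setT (fun x => h (s n x, x)).
Proof.
have [_ ms _] := enumE; apply: (measurableT_comp mh).
exact: measurable_fun_pair.
Qed.

Let mtermD n : measurable_fun setT (term n).
Proof.
have [mD _ _] := enumE.
by apply/(measurable_restrictT _ (mD n)); exact: measurable_funTS.
Qed.

Lemma measurable_esum : measurable_fun setT (fun x => \esum_(g in E x) h (g, x)).
Proof.
under eq_fun do rewrite esum_term.
apply: ge0_emeasurable_sum => // n x _ _.
by rewrite /term patchE; case: ifP => // _; exact: h0.
Qed.

Lemma integral_esum_enum (m : {measure set T -> \bar R}) :
  \int[m]_x (\esum_(g in E x) h (g, x)) =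
  \sum_(n <oo) \int[m]_(x in D n) h (s n x, x).
Proof.
under eq_integral do rewrite esum_term.
rewrite integral_nneseries//.
  by apply: eq_eseriesr => n _; rewrite [RHS]integral_mkcond.
by move=> n x _; rewrite /term patchE; case: ifP.
Qed.

End esum.

Section image_measure.
Context d1 d2 (T1 : measurableType d1) (T2 : measurableType d2) (R : realType).
Variables (m : {measure set T1 -> \bar R}) (f : T1 -> T2).
Hypothesis mf : measurable_fun setT f.

(** The pushforward, bundled with the proof that it is a measure. *)
Definition image_measure : {measure set T2 -> \bar R} :=
  measure_function_pushforward__canonical__measure_function_Measure m mf.

Lemma image_measureE A : image_measure A = m (f @^-1` A).
Proof. by []. Qed.

Lemma ge0_integral_image (h : T2 -> \bar R) : measurable_fun setT h ->
  (forall y, 0 <= h y) -> \int[image_measure]_y h y = \int[m]_x h (f x).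
Proof.
by move=> mh h0; rewrite (ge0_integral_pushforward mf)// preimage_setT.
Qed.

End image_measure.

(** The enumeration turns the sum over E x into a countable sum of images of
    restrictions of m. *)
Lemma fiber_measure (R : realType) dG (G : lcscGroupType dG) d (T : measurableType d)
    (E : T -> set G) (D : nat -> set T) (s : nat -> T -> G)
    (m : {measure set T -> \bar R}) d' (U : measurableType d') (phi : G * T -> U) :
  enumerates E D s -> measurable_fun setT phi ->
  exists L : {measure set U -> \bar R},
    forall f : U -> \bar R, measurable_fun setT f -> (forall u, 0 <= f u) ->
    \int[L]_u f u = \int[m]_x (\esum_(g in E x) f (phi (g, x))).
Proof.
move=> enumE mphi; have [mD ms bij] := enumE.
have mphis n : measurable_fun setT (fun x => phi (s n x, x)).
  by apply: (measurableT_comp mphi); exact: measurable_fun_pair.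
exists (mseries (fun n => image_measure (mrestr m (mD n)) (mphis n)) 0).
move=> f mf f0; rewrite ge0_integral_measure_series//.
rewrite (integral_esum_enum enumE (measurableT_comp mf mphi)); last first.
  by move=> p; exact: f0.
apply: eq_eseriesr => n _.
rewrite ge0_integral_image// ge0_integral_mrestr//=.
exact: (measurableT_comp mf (mphis n)).
Qed.

(** * Haar measure *)

(** A property of m proved in the course of an argument is attached to a copy
    of m, to which results on sigma-finite or finite measures then apply. *)
Section pack.
Context d (T : measurableType d) (R : realType) (m : {measure set T -> \bar R}).

Definition with_sigma_finite (h : sigma_finite setT m) : set T -> \bar R := m.

HB.instance Definition _ h := Measure.on (with_sigma_finite h).
HB.instance Definition _ h :=
  Measure_isSigmaFinite.Build _ _ _ (with_sigma_finite h) h.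

Lemma lt_pinfty_fin_num_fun : m setT < +oo -> fin_num_fun m.
Proof.
move=> mT A mA; rewrite ge0_fin_numE//; apply: le_lt_trans mT.
by apply: le_measure; rewrite ?inE.
Qed.

Definition with_finite (h : m setT < +oo) : set T -> \bar R := m.

HB.instance Definition _ h := Measure.on (with_finite h).
HB.instance Definition _ h :=
  Measure_isFinite.Build _ _ _ (with_finite h) (lt_pinfty_fin_num_fun h).

End pack.

Section lcsc_measurability.
Context dG (G : lcscGroupType dG).

Lemma measurable_fun_mulg :
  measurable_fun setT (fun p : G * G => (p.1 * p.2)%g).
Proof.
have [V bV] := lcsc_base G.
apply: (measurability (@open G)); first by rewrite lcsc_borelE.
move=> _ [U oU <-]; rewrite setTI.
pose mul (p : G * G) := (p.1 * p.2)%g.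
rewrite (_ : _ @^-1` _ = \bigcup_(ij in [set ij : nat * nat | V ij.1 `*` V ij.2 `<=` mul @^-1` U])
  (V ij.1 `*` V ij.2)).
  rewrite bigcup_mkcond; apply: countable_bigcupT_measurable => // -[i j].
  by case: ifP => // _; apply: measurableX; apply/open_measurable_lcsc/bV.1.
apply/seteqP; split=> [[g h] Ugh|p [ij ijU /ijU]//].
have : nbhs (g, h) (mul @^-1` U).
  apply: (@mulg_continuous _ G (g, h)); exact: open_nbhs_nbhs.
move=> [[A B] /= [gA hB] AB].
have [i Vig iA] := bV.2 _ _ gA; have [j Vjh jB] := bV.2 _ _ hB.
exists (i, j) => // -[a b] [/iA Aa /jB Bb]; exact: (AB (a, b)).
Qed.

Lemma measurable_fun_invg : measurable_fun setT (fun g : G => g^-1%g).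
Proof.
apply: (measurability (@open G)); first by rewrite lcsc_borelE.
move=> _ [U oU <-]; rewrite setTI; apply: open_measurable_lcsc.
by apply: open_comp => // g _; exact: invg_continuous.
Qed.

Lemma measurable_fun_mul d (T : measurableType d) (f g : T -> G) :
  measurable_fun setT f -> measurable_fun setT g ->
  measurable_fun setT (fun x => (f x * g x)%g).
Proof.
by move=> mf mg; exact: (measurableT_comp measurable_fun_mulg (measurable_fun_pair mf mg)).
Qed.

Lemma measurable_fun_inv d (T : measurableType d) (f : T -> G) :
  measurable_fun setT f -> measurable_fun setT (fun x => (f x)^-1%g).
Proof. exact: measurableT_comp measurable_fun_invg. Qed.

End lcsc_measurability.

Section haar.
Context (R : realType) dG (G : lcscGroupType dG).

Lemma measurable_mull (g : G) : measurable_fun setT (fun h : G => (g * h)%g).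
Proof. by apply: measurable_fun_mul. Qed.
Lemma measurable_mulr (g : G) : measurable_fun setT (fun h : G => (h * g)%g).
Proof. by apply: measurable_fun_mul. Qed.

Lemma integral_mull (m : {measure set G -> \bar R}) (f : G -> \bar R) (g : G) :
  left_invariant m -> measurable_fun setT f -> (forall x, 0 <= f x) ->
  \int[m]_h f (g * h)%g = \int[m]_h f h.
Proof.
move=> lm mf f0; rewrite -(ge0_integral_image m (measurable_mull g) mf f0).
apply: eq_measure_integral => A mA _; rewrite image_measureE.
rewrite -(lm g^-1%g _ mA); congr (m _); apply/seteqP; split=> [h /= Agh|_ [h Ah <-]] /=.
  by exists (g * h)%g => //; rewrite mulKg.
by rewrite mulVKg.
Qed.

Lemma integral_mulr (m : {measure set G -> \bar R}) (f : G -> \bar R) (g : G) :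
  right_invariant m -> measurable_fun setT f -> (forall x, 0 <= f x) ->
  \int[m]_h f (h * g)%g = \int[m]_h f h.
Proof.
move=> lm mf f0; rewrite -(ge0_integral_image m (measurable_mulr g) mf f0).
apply: eq_measure_integral => A mA _; rewrite image_measureE.
rewrite -(lm g^-1%g _ mA); congr (m _); apply/seteqP; split=> [h /= Agh|_ [h Ah <-]] /=.
  by exists (h * g)%g => //; rewrite mulgK.
by rewrite mulgVK.
Qed.

Section uniqueness.
Variables (m lam : {sigma_finite_measure set G -> \bar R}).
Hypotheses (lm : left_invariant m) (rm : right_invariant m).
Hypothesis rlam : forall (f : G -> \bar R) (g : G), measurable_fun setT f ->
  (forall x, 0 <= f x) -> \int[lam]_h f (h * g)%g = \int[lam]_h f h.

(** Weil's argument: integrate f g * w (g h)^-1 in both orders, translating h by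
    g^-1 in the first and g by h^-1 in the second. *)
Lemma haar_exchange (f w : G -> \bar R) :
  measurable_fun setT f -> (forall x, 0 <= f x) ->
  measurable_fun setT w -> (forall x, 0 <= w x) ->
  \int[lam]_g f g * \int[m]_h w h^-1%g =
  \int[lam]_g w g^-1%g * \int[m]_h f h^-1%g.
Proof.
move=> mf f0 mw w0.
have mfi : measurable_fun setT (fun g : G => f g^-1%g).
  by apply: (measurableT_comp mf); exact: measurable_fun_invg.
have mwi : measurable_fun setT (fun g : G => w g^-1%g).
  by apply: (measurableT_comp mw); exact: measurable_fun_invg.
have iw0 : 0 <= \int[m]_h w h^-1%g by exact: integral_ge0.
have if0 : 0 <= \int[m]_h f h^-1%g by exact: integral_ge0.
rewrite -!ge0_integralZr//.
pose F (p : G * G) := f p.1 * w (p.1 * p.2)^-1%g.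
have mF : measurable_fun setT F.
  apply: emeasurable_funM; first by apply: (measurableT_comp mf).
  apply: (measurableT_comp mw); exact/measurable_fun_inv/measurable_fun_mul.
have F0 p : 0 <= F p by rewrite mule_ge0.
transitivity (\int[lam]_g \int[m]_h F (g, h)).
  apply: eq_integral => g _; rewrite /F/= ge0_integralZl//=; last first.
    by apply: (measurableT_comp mw); apply/measurable_fun_inv/measurable_mull.
  by rewrite (integral_mull (f := fun h => w h^-1%g) g lm).
rewrite (fubini_tonelli F)//.
pose F' (p : G * G) := f (p.1 * p.2^-1)%g * w p.1^-1%g.
have mF' : measurable_fun setT F'.
  apply: emeasurable_funM; last exact: (measurableT_comp mwi).
  by apply: (measurableT_comp mf); apply: measurable_fun_mul => //; exact/measurable_fun_inv.
have F'0 p : 0 <= F' p by rewrite mule_ge0.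
transitivity (\int[m]_h \int[lam]_g F' (g, h)).
  apply: eq_integral => h _.
  rewrite -(rlam (f := fun g => F (g, h)) h^-1%g)//.
    by apply: eq_integral => g _; rewrite /F/F'/= mulgVK.
  exact: (measurableT_comp mF).
rewrite -(fubini_tonelli F')//; apply: eq_integral => g _.
rewrite /F'/= ge0_integralZr//; last first.
  by apply: (measurableT_comp mf); apply: measurable_fun_mul => //; exact/measurable_fun_inv.
rewrite muleC; congr (_ * _).
rewrite -(integral_mulr (f := fun h => f (g * h^-1)%g) g rm)//; last first.
  by apply: (measurableT_comp mf); apply: measurable_fun_mul => //; exact/measurable_fun_inv.
by apply: eq_integral => h _; rewrite invgM mulVKg.
Qed.

End uniqueness.

Lemma mulIe (k x y : \bar R) : 0 < k -> k < +oo -> x * k = y * k -> x = y.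
Proof.
move=> k0 koo xy; have kfin : k \is a fin_num by rewrite ge0_fin_numE// ltW.
by apply/eqP; rewrite eq_le -(lee_pmul2r kfin k0) -[in X in _ && X](lee_pmul2r kfin k0) xy lexx.
Qed.

Let integral_indic_inv (m : {measure set G -> \bar R}) (K : set G) : measurable K ->
  \int[m]_g (\1_K g^-1^-1%g)%:E = m K.
Proof.
by move=> mK; under eq_integral do rewrite invgK; rewrite integral_indic// setIT.
Qed.

(** [haar_exchange] for lam = m, with w the indicator of K^-1. *)
Lemma integral_invg (m : {sigma_finite_measure set G -> \bar R}) (K : set G)
    (f : G -> \bar R) : left_invariant m -> right_invariant m ->
  measurable K -> 0 < m K -> m K < +oo ->
  measurable_fun setT f -> (forall x, 0 <= f x) ->
  \int[m]_g f g^-1%g = \int[m]_g f g.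
Proof.
move=> lm rm mK K0 Koo mf f0.
have mw : measurable_fun setT (fun g : G => (\1_K g^-1%g)%:E : \bar R).
  apply: (measurableT_comp (f := fun g : G => (\1_K g)%:E)); last exact: measurable_fun_invg.
  exact/measurable_EFinP/measurable_indic.
have := @haar_exchange m m lm rm _ f _ mf f0 mw _.
rewrite !integral_indic_inv// => h; apply: (mulIe K0 Koo).
rewrite h//; first exact: muleC.
by move=> ? ? *; exact: integral_mulr.
Qed.

(** [haar_exchange], after [integral_invg] removes the inversions. *)
Lemma haar_unique (m lam : {sigma_finite_measure set G -> \bar R}) (K : set G)
    (f : G -> \bar R) : left_invariant m -> right_invariant m ->
  (forall (f : G -> \bar R) (g : G), measurable_fun setT f ->
    (forall x, 0 <= f x) -> \int[lam]_h f (h * g)%g = \int[lam]_h f h) ->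
  measurable K -> 0 < m K -> m K < +oo ->
  measurable_fun setT f -> (forall x, 0 <= f x) ->
  \int[lam]_g f g * m K = lam K * \int[m]_g f g.
Proof.
move=> lm rm rlam mK K0 Koo mf f0.
have mw : measurable_fun setT (fun g : G => (\1_K g^-1%g)%:E : \bar R).
  apply: (measurableT_comp (f := fun g : G => (\1_K g)%:E)); last exact: measurable_fun_invg.
  exact/measurable_EFinP/measurable_indic.
have := @haar_exchange m lam lm rm rlam f _ mf f0 mw _.
rewrite (integral_invg lm rm mK K0 Koo mf f0).
by rewrite !integral_indic_inv//; apply.
Qed.

Lemma compact_finite_sigma_finite (m : {measure set G -> \bar R}) :
  (forall K : set G, compact K -> m K < +oo) -> sigma_finite setT m.
Proof.
move=> mK; have [V bV] := lcsc_base G.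
exists (fun n => if `[< compact (closure (V n)) >] then closure (V n) else set0).
  apply/seteqP; split=> // g _.
  have [n Vng cV] := lcsc_compact_closure g bV; exists n => //.
  by rewrite asboolT//; exact: subset_closure.
move=> n; case: asboolP => [cV|_]; last by rewrite measure0.
by split; [exact/closed_measurable_lcsc/closed_closure|exact: mK].
Qed.

(** G is a countable union of compact sets, which cannot all be null. *)
Lemma haar_compact (m : {measure set G -> \bar R}) : haar_measure m ->
  exists K : set G, [/\ compact K, measurable K, 0 < m K & m K < +oo].
Proof.
move=> [_ mK m0]; have [V bV] := lcsc_base G.
have mcV n : measurable (closure (V n)) by exact/closed_measurable_lcsc/closed_closure.
apply: contrapT => nK; suff m0' : m setT = 0 by rewrite m0' ltxx in m0.
pose F n := if `[< compact (closure (V n)) >] then closure (V n) else set0.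
have FT : setT = \bigcup_n F n.
  apply/seteqP; split=> // g _.
  have [n Vng cV] := lcsc_compact_closure g bV; exists n => //.
  by rewrite /F asboolT//; exact: subset_closure.
have mF n : measurable (F n) by rewrite /F; case: asboolP.
rewrite FT; apply: measure_negligible; first exact: bigcup_measurable.
apply: negligible_bigcup => n; apply/negligibleP => //.
rewrite /F; case: asboolP => [cV|_]; last by rewrite measure0.
apply: contrapT => /eqP n0; apply: nK; exists (closure (V n)); split=> //.
  by rewrite lt0e n0 measure_ge0.
exact: mK.
Qed.

End haar.

(** * Transverse measures and the Campbell formula *)

Section counting.
Context (R : realType).

Lemma counting_esum (T : choiceType) (A : set T) : finite_set A ->
  counting A = \esum_(i in A) 1 :> \bar R.
Proof.
move=> fA; rewrite /counting asboolT// esum_fset// fsbig_finite//= sumEFin.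
by rewrite big_const_seq count_predT iter_addr_0.
Qed.

End counting.

Section transverse.
Context (R : realType) dG (G : lcscGroupType dG) (mG : {measure set G -> \bar R}).
Context d (T : measurableType d) (a : action G T) (Y : set T).

(** The refined Campbell formula of the theory of point processes, with nu as
    Palm measure.  The formula that defines transverse measures is the case
    where f is a product of a weight on G and a function on T. *)
Definition campbell (mu nu : {measure set T -> \bar R}) :=
  forall f : G * T -> \bar R, measurable_fun setT f -> (forall p, 0 <= f p) ->
  \int[mu]_x (\esum_(g in return_set a Y x) f (g, a g x)) =
  \int[nu]_y \int[mG]_g f (g, y).

Lemma cross_section_enumeration (psi : T -> baire) : coding psi ->
  borel_action a -> measurable Y ->
  (forall x, locally_finite (return_set a Y x)) ->
  exists (D : nat -> set T) (s : nat -> T -> G), enumerates (return_set a Y) D s.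
Proof.
move=> cT ba mY lfY.
have mE : measurable [set p : G * T | Y (a p.1 p.2)].
  by have := ba measurableT _ mY; rewrite setTI.
exact: (measurable_enumeration cT mE lfY).
Qed.

Lemma measurable_act g : borel_action a -> measurable_fun setT (a g).
Proof.
move=> ba; have mg : measurable_fun setT (fun x : T => (g, x)).
  exact: measurable_fun_pair.
exact: (measurableT_comp ba mg).
Qed.

Lemma measurable_orbit_map : borel_action a ->
  measurable_fun setT (fun p : G * T => (p.1, a p.1 p.2)).
Proof. by move=> ba; apply: measurable_fun_pair. Qed.

Lemma integral_act (mu : {measure set T -> \bar R}) (f : T -> \bar R) g :
  borel_action a -> invariant_measure a mu ->
  measurable_fun setT f -> (forall x, 0 <= f x) ->
  \int[mu]_x f (a g x) = \int[mu]_x f x.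
Proof.
move=> ba imu mf f0; rewrite -(ge0_integral_image mu (measurable_act g ba) mf f0).
by apply: eq_measure_integral => A mA _; rewrite image_measureE imu.
Qed.

Lemma return_set_act g x h :
  return_set a Y (a g x) h <-> return_set a Y x (h * g)%g.
Proof. by rewrite /return_set /= actM. Qed.

End transverse.

Section campbell_exists.
Context (R : realType) dG (G : lcscGroupType dG).
Variable mG : {sigma_finite_measure set G -> \bar R}.
Hypotheses (haarG : haar_measure mG) (rG : right_invariant mG).
Context d (T : measurableType d) (a : action G T) (Y : set T).
Hypotheses (ba : borel_action a) (mY : measurable Y).
Variables (D : nat -> set T) (s : nat -> T -> G).
Hypothesis enumY : enumerates (return_set a Y) D s.
Variable mu : {measure set T -> \bar R}.
Hypothesis imu : invariant_measure a mu.
Hypothesis lint : forall K : set G, compact K ->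
  \int[mu]_x (\esum_(g in return_set a Y x) (\1_K g)%:E) < +oo.

Let Sum (f : G * T -> \bar R) := \int[mu]_x (\esum_(g in return_set a Y x) f (g, a g x)).

(** Moving x by h moves its return set by right multiplication: invariance of mu
    becomes right invariance in the group variable. *)
Let Sum_mulr f h : measurable_fun setT f -> (forall p, 0 <= f p) ->
  Sum (fun p => f (p.1 * h, p.2)%g) = Sum f.
Proof.
move=> mf f0.
pose phi x := \esum_(g in return_set a Y x) f (g * h, a g x)%g.
have mphi : measurable_fun setT phi.
  have mF : measurable_fun setT (fun p : G * T => f (p.1 * h, a p.1 p.2)%g).
    apply: (measurableT_comp mf); apply: measurable_fun_pair => //.
    exact: measurable_fun_mul.
  exact: (measurable_esum enumY mF).
have phi0 x : 0 <= phi x by exact: esum_ge0.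
rewrite /Sum -(integral_act h ba imu mphi phi0); apply: eq_integral => x _.
rewrite /phi (reindex_esum (return_set a Y x) (return_set a Y (a h x)) (fun k => k * h^-1)%g).
  by apply: eq_esum => g _; rewrite mulgVK -actM mulgVK.
split.
- by move=> g; rewrite /= return_set_act mulgVK.
- by move=> g k _ _ /mulIg.
- by move=> g; rewrite /= return_set_act => Yg; exists (g * h)%g => //; rewrite mulgK.
Qed.

(** The measure L that counts the pairs (g, g.x) is right invariant in g and finite
    over compact sets.  Hence, by uniqueness of Haar measure, it is the product
    of mG and of a measure that can be read off any compact K of positive
    measure. *)
Lemma campbell_exists : exists nu : {finite_measure set T -> \bar R},
  nu (~` Y) = 0 /\ campbell mG a Y mu nu.
Proof.
have [K [cK mK K0 Koo]] := haar_compact haarG.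
have [lG KG _] := haarG.
have [L LE] := fiber_measure mu enumY (measurable_orbit_map ba).
have {}LE f : measurable_fun setT f -> (forall p, 0 <= f p) -> \int[L]_p f p = Sum f.
  by move=> mf f0; rewrite LE.
have Lfin A C : compact A -> measurable A -> measurable C -> L (A `*` C) < +oo.
  move=> cA mA mC; apply: le_lt_trans (lint cA).
  have mAC : measurable (A `*` C) by exact: measurableX.
  rewrite -[A `*` C]setIT -integral_indic// LE//; last first.
    exact/measurable_EFinP/measurable_indic.
  apply: ge0_le_integral => //.
  - by move=> x _; apply: esum_ge0 => g _; rewrite lee_fin.
  - apply: (measurable_esum enumY (h := fun p => (\1_(A `*` C) (p.1, a p.1 p.2))%:E)).
      apply/measurable_EFinP; apply: (measurableT_comp (measurable_indic mAC)).
      exact: measurable_orbit_map.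
    by move=> p; rewrite lee_fin.
  - apply: (measurable_esum enumY (h := fun p => (\1_A p.1)%:E)).
      by apply/measurable_EFinP; apply: (measurableT_comp (measurable_indic mA)).
    by move=> p; rewrite lee_fin.
  - move=> x _; apply: le_esum => g _; rewrite lee_fin !indicE.
    have [gA|gA] := boolP (g \in A); first by rewrite ler_nat leq_b1.
    by rewrite memNset// => -[/mem_set/=]; rewrite (negbTE gA).
(* The measure A |-> L (A `*` C) is proportional to mG. *)
have LAC A C : measurable A -> measurable C ->
    L (A `*` C) * mG K = mG A * L (K `*` C).
  move=> mA mC.
  have mTC : measurable ([set: G] `*` C) by exact: measurableX.
  pose lam0 := image_measure (mrestr L mTC) measurable_fst.
  have lam0E B : lam0 B = L (B `*` C).
    rewrite /lam0 image_measureE /mrestr; congr (L _).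
    by apply/seteqP; split=> -[g x] /= [] // ? [].
  have lamS : sigma_finite setT lam0.
    apply: compact_finite_sigma_finite => B cB; rewrite lam0E; apply: Lfin => //.
    exact/closed_measurable_lcsc/(compact_closed (@lcsc_hausdorff _ G) cB).
  pose lam : {sigma_finite_measure set G -> \bar R} := with_sigma_finite lamS.
  pose F (f : G -> \bar R) := (f \o fst) \_ ([set: G] `*` C).
  have F0 f : (forall g, 0 <= f g) -> forall p, 0 <= F f p.
    by move=> f0 p; rewrite /F patchE; case: ifP => /=.
  have mF f : measurable_fun setT f -> measurable_fun setT (F f).
    move=> mf; apply/(measurable_restrictT _ mTC); apply: measurable_funTS.
    exact: measurableT_comp.
  have lamI f : measurable_fun setT f -> (forall g, 0 <= f g) ->
      \int[lam]_g f g = Sum (F f).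
    move=> mf f0; rewrite (ge0_integral_image (mrestr L mTC) measurable_fst mf f0).
    have mff : measurable_fun setT (fun p : G * T => f p.1) by exact: measurableT_comp.
    rewrite ge0_integral_mrestr// integral_mkcond LE//; first exact: mF.
    exact: F0.
  have rlam (f : G -> \bar R) h : measurable_fun setT f -> (forall x, 0 <= f x) ->
      \int[lam]_g f (g * h)%g = \int[lam]_g f g.
    move=> mf f0; rewrite !lamI//; last by apply: (measurableT_comp mf); exact: measurable_mulr.
    by rewrite -(Sum_mulr h (mF _ mf) (F0 _ f0)).
  have mA1 : measurable_fun setT (fun g => (\1_A g)%:E : \bar R).
    exact/measurable_EFinP/measurable_indic.
  have := @haar_unique _ _ _ mG lam K _ lG rG rlam mK K0 Koo mA1 _.
  rewrite !integral_indic// !setIT.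
  move=> h; rewrite -(lam0E A) -(lam0E K) [RHS]muleC; apply: h => g.
  by rewrite lee_fin.
have Kfin : mG K \is a fin_num by rewrite ge0_fin_numE.
have r0 : (0 <= (fine (mG K))^-1 :> R)%R by rewrite invr_ge0 fine_ge0.
have mKT : measurable (K `*` [set: T]) by exact: measurableX.
pose nu0 := mscale (NngNum r0) (image_measure (mrestr L mKT) measurable_snd).
have nu0E C : nu0 C = (fine (mG K))^-1%:E * L (K `*` C).
  rewrite /nu0 /mscale /= /pushforward /mrestr; congr (_ * L _).
  by apply/seteqP; split=> -[g x] /= [] // ? [].
have nufin : nu0 setT < +oo.
  by rewrite nu0E lte_mul_pinfty//; exact: Lfin.
pose nu : {finite_measure set T -> \bar R} := with_finite nufin.
exists nu; split.
  rewrite -[LHS]/(nu0 (~` Y)) nu0E.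
  have mKY : measurable (K `*` ~` Y) by apply: measurableX => //; exact: measurableC.
  rewrite -[K `*` ~` Y]setIT -integral_indic// LE//; last first.
    exact/measurable_EFinP/measurable_indic.
  rewrite /Sum integral0_eq ?mule0// => x _; apply: esum1 => g Yg.
  by rewrite indicE memNset// => -[].
move=> f mf f0; rewrite -[LHS]/(Sum f) -LE//.
rewrite -[RHS](fubini_tonelli2 (m1 := mG) (m2 := nu) f mf f0).
apply: eq_measure_integral => B mB _; apply/esym.
apply: product_measure_unique => // A C mA mC.
transitivity (mG A * nu0 C) => //; apply: (mulIe K0 Koo); rewrite LAC// nu0E.
rewrite -!muleA; congr (_ * _); rewrite muleC -muleA.
rewrite -[X in _ * (X * _)](fineK Kfin) -EFinM divff ?mule1//.
by rewrite fine_eq0// gt_eqF.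
Qed.

End campbell_exists.

Lemma weight_indic (R : realType) dG (G : lcscGroupType dG)
    (mG : {measure set G -> \bar R}) (K : set G) :
  measurable K -> 0 < mG K -> mG K < +oo ->
  weight mG (fun g => (fine (mG K))^-1%:E * (\1_K g)%:E).
Proof.
move=> mK K0 Koo.
have Kfin : mG K \is a fin_num by rewrite ge0_fin_numE.
have r0 : (0 <= (fine (mG K))^-1 :> R)%R by rewrite invr_ge0 fine_ge0.
split.
- apply: emeasurable_funM; first exact: measurable_cst.
  exact/measurable_EFinP/measurable_indic.
- by move=> g; rewrite mule_ge0// lee_fin.
- rewrite ge0_integralZl//; last exact/measurable_EFinP/measurable_indic.
  rewrite integral_indic// setIT -[X in _ * X](fineK Kfin) -EFinM mulVf//.
  by rewrite fine_eq0// gt_eqF.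
Qed.

Section transverse.
Context (R : realType) dG (G : lcscGroupType dG).
Variable mG : {sigma_finite_measure set G -> \bar R}.
Context d (T : measurableType d) (a : action G T) (Y : set T).
Hypotheses (ba : borel_action a) (mY : measurable Y).
Implicit Types (mu nu : {measure set T -> \bar R}).

Lemma campbell_is_transverse mu nu : nu (~` Y) = 0 -> campbell mG a Y mu nu ->
  is_transverse_measure mG a mu Y nu.
Proof.
move=> nuY cnu; split.
  by exists (~` Y); split=> //; exact: measurableC.
move=> w f [mw w0 w1] mf f0.
have fY0 y : 0 <= (f \_ Y) y by rewrite patchE; case: ifPn => // /set_mem/f0.
have mfY : measurable_fun setT (f \_ Y) by exact/(measurable_restrictT _ mY).
rewrite integral_mkcond.
transitivity (\int[mu]_x (\esum_(g in return_set a Y x) ((f \_ Y) (a g x) * w g))).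
  have mF : measurable_fun setT (fun p : G * T => (f \_ Y) p.2 * w p.1).
    by apply: emeasurable_funM; [apply: (measurableT_comp mfY)|apply: (measurableT_comp mw)].
  rewrite (cnu (fun p => (f \_ Y) p.2 * w p.1))//; last by move=> p; rewrite mule_ge0.
  apply: eq_integral => y _ /=.
  by rewrite ge0_integralZl// w1 mule1.
apply: eq_integral => x _; apply: eq_esum => g Yg.
by rewrite patchE mem_set.
Qed.

Hypothesis haarG : haar_measure mG.

Lemma is_transverse_unique mu nu nu' : is_transverse_measure mG a mu Y nu ->
  is_transverse_measure mG a mu Y nu' -> forall C, measurable C -> nu C = nu' C.
Proof.
move=> [nuY tnu] [nu'Y tnu'] C mC.
have [K [cK mK K0 Koo]] := haar_compact haarG.
have wK := weight_indic mK K0 Koo.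
have CY (m : {measure set T -> \bar R}) : m.-negligible (~` Y) ->
    m C = \int[m]_(y in Y) (\1_C y)%:E.
  move=> mY0; rewrite integral_indic// [LHS](measureDI m mC mY).
  rewrite (@measure_negligible _ _ _ m (C `\` Y)) ?add0e//.
    exact: measurableD.
  by apply: negligibleS mY0; exact: subIsetr.
have mC1 : measurable_fun Y (fun y => (\1_C y)%:E : \bar R).
  exact/measurable_EFinP/measurable_indic.
have C0 y : Y y -> 0 <= (\1_C y)%:E :> \bar R by rewrite lee_fin.
by rewrite (CY nu)// (CY nu')// (tnu _ _ wK mC1 C0) (tnu' _ _ wK mC1 C0).
Qed.

Hypothesis rG : right_invariant mG.
Variables (D : nat -> set T) (s : nat -> T -> G).
Hypothesis enumY : enumerates (return_set a Y) D s.

(** A transverse measure of finite mass bounds the number of returns in compact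
    sets; so a measure with the Campbell formula exists, and it is transverse. *)
Lemma is_transverse_campbell mu nu : invariant_measure a mu -> nu setT < +oo ->
  is_transverse_measure mG a mu Y nu -> campbell mG a Y mu nu.
Proof.
move=> imu nufin tnu.
have [K0 [cK0 mK0 K00 K0oo]] := haar_compact haarG.
have [lG KG _] := haarG.
have lint K : compact K ->
    \int[mu]_x (\esum_(g in return_set a Y x) (\1_K g)%:E) < +oo.
  move=> cK.
  have mK : measurable K.
    exact/closed_measurable_lcsc/(compact_closed (@lcsc_hausdorff _ G) cK).
  (* K itself may be null, and then carries no weight. *)
  pose K' := K `|` K0.
  have mK' : measurable K' by exact: measurableU.
  have K'0 : 0 < mG K'.
    apply: lt_le_trans K00 _; apply: le_measure; rewrite ?inE//.
    exact: subsetUr.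
  have K'oo : mG K' < +oo by apply: KG; exact: compactU.
  have K'fin : mG K' \is a fin_num by rewrite ge0_fin_numE.
  have [L LE] := fiber_measure mu enumY (measurable_orbit_map ba).
  have m1 (A : set G) : measurable A ->
      measurable_fun setT (fun p : G * T => (\1_A p.1)%:E : \bar R).
    by move=> mA; apply/measurable_EFinP; apply: (measurableT_comp (measurable_indic mA)).
  have r0 : (0 <= (fine (mG K'))^-1 :> R)%R by rewrite invr_ge0 fine_ge0.
  have LK' : (fine (mG K'))^-1%:E * \int[L]_p (\1_K' p.1)%:E = nu Y.
    have [_ /(_ _ (cst 1) (weight_indic mK' K'0 K'oo))] := tnu.
    move=> /(_ (measurable_cst _) (fun _ _ => lee01)).
    rewrite integral_cst// mul1e => ->.
    rewrite -ge0_integralZl//; last exact: m1.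
    rewrite LE.
    - by apply: eq_integral => x _; apply: eq_esum => g _; rewrite mul1e.
    - by apply: emeasurable_funM; [exact: measurable_cst|exact: m1].
    - by move=> p; rewrite mule_ge0// lee_fin.
  rewrite -[X in X < _](LE (fun p => (\1_K p.1)%:E))//; last exact: m1.
  apply: (@le_lt_trans _ _ (\int[L]_p (\1_K' p.1)%:E)).
    apply: ge0_le_integral => //.
    - exact: m1.
    - exact: m1.
    - move=> p _; rewrite lee_fin !indicE ler_nat.
      by have [/set_mem pK|//] := boolP (p.1 \in K); rewrite mem_set//; left.
  have : nu Y < +oo by apply: le_lt_trans nufin; apply: le_measure; rewrite ?inE.
  rewrite -LK'; apply: contraTT; rewrite -!leNgt !leye_eq => /eqP ->.
  by rewrite gt0_muley// lte_fin invr_gt0 fine_gt0// K'0.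
have [nu' [nu'Y cnu']] := campbell_exists haarG rG ba mY enumY imu lint.
have tnu' := campbell_is_transverse nu'Y cnu'.
have nunu' := is_transverse_unique tnu tnu'.
move=> f mf f0; rewrite cnu'//; apply: eq_measure_integral => C mC _.
exact/esym/nunu'.
Qed.

End transverse.

(** * Discrete subgroups and fundamental domains *)

Lemma esum_single (R : realType) (I : choiceType) (S : set I) (f : I -> \bar R) i :
  S i -> 0 <= f i -> (forall j, S j -> j <> i -> f j = 0) ->
  \esum_(j in S) f j = f i.
Proof.
move=> Si fi0 fS.
transitivity (\esum_(j in [set i]) f j); last by rewrite esum_set1.
rewrite esum_mkcond [RHS]esum_mkcond; apply: eq_esum => j _.
have [->|/eqP ji] := eqVneq j i; first by rewrite !mem_set.
rewrite [in RHS]memNset//; case: ifPn => // /set_mem Sj; exact: fS.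
Qed.

Section discrete.
Context dG (G : lcscGroupType dG) (H : groupClosed G).

(** The compact set is covered by finitely many basic sets small enough that
    g^-1 h lies in U for all g and h in one of them. *)
Lemma discrete_locally_finite : discrete_subgroup H ->
  locally_finite [set g : G | g \in H].
Proof.
move=> [U U1 UH] K cK; have [V bV] := lcsc_base G.
pose one n := forall g h, g \in H -> h \in H -> V n g -> V n h -> g = h.
have KV : K `<=` \bigcup_(n in [set n | one n]) V n.
  move=> g _.
  have cdiv : {for (g, g), continuous (fun p : G * G => (p.1^-1 * p.2)%g)}.
    apply: (@continuous_comp _ _ _ (fun p : G * G => (p.1^-1%g, p.2)) (fun p => (p.1 * p.2)%g)).
      apply: cvg_pair => /=; last exact: cvg_snd.
      apply: (@cvg_comp _ _ _ fst (fun g : G => g^-1%g)); first exact: cvg_fst.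
      exact: invg_continuous.
    exact: mulg_continuous.
  have : nbhs (g, g) [set p : G * G | U (p.1^-1 * p.2)%g].
    by apply: cdiv; rewrite /= mulVg.
  move=> [[A B] /= [gA gB] AB].
  have [n Vng VAB] := bV.2 _ _ (filterI gA gB); exists n => // h k hH kH /VAB[Ah _] /VAB[_ Bk].
  apply/esym/(mulgI h^-1%g); rewrite mulVg; apply: UH; first by rewrite gpredMr ?gpredV.
  exact: (AB (h, k)).
have := cK; rewrite compact_cover => /(_ nat [set n | one n] V).
move=> /(_ (fun n _ => bV.1 n) KV)[D' D'1 KD'].
apply: (@sub_finite_set _ _ (\bigcup_(n in [set` D']) (V n `&` [set g | g \in H]))).
  by move=> g [gH /KD'[n nD Vn]]; exists n.
apply: bigcup_finite; first exact: finite_fset.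
move=> n /= /D'1/set_mem one_n.
have [[g [Vg gH]]|nV] := pselect (exists g, V n g /\ g \in H).
  apply: (@sub_finite_set _ _ [set g]); last exact: finite_set1.
  by move=> h [Vh hH] /=; exact: one_n.
apply: (@sub_finite_set _ _ set0) => // h [Vh hH]; by apply: nV; exists h.
Qed.

Lemma locally_finite_countable (S : set G) : locally_finite S -> countable S.
Proof.
move=> lfS; have [V bV] := lcsc_base G.
rewrite (_ : S = \bigcup_(n in [set n | compact (closure (V n))]) (S `&` closure (V n))).
  by apply: bigcup_countable => // n cV; exact/finite_set_countable/lfS.
apply/seteqP; split=> [g Sg|g [n _ []]//].
have [n Vng cV] := lcsc_compact_closure g bV; exists n => //.
by split=> //; exact: subset_closure.
Qed.

Lemma locally_finite_enum (S : set G) : locally_finite S ->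
  exists P (e : nat -> G), set_bij P S e.
Proof.
move=> /locally_finite_countable/countable_bijP[P].
by rewrite card_eq_sym => /card_set_bijP[e bij]; exists P, e.
Qed.

End discrete.

Section fundamental_domain.
Context (R : realType) dG (G : lcscGroupType dG) (H : groupClosed G).
Variable mG : {sigma_finite_measure set G -> \bar R}.
Hypothesis lG : left_invariant mG.
Variables (P : set nat) (e : nat -> G).
Hypothesis eH : set_bij P [set g | g \in H] e.
Implicit Types (F : set G) (f : G -> \bar R).

Lemma fundamental_domainP F : fundamental_domain H F -> forall g,
  exists h, [/\ h \in H, F (h * g)%g & forall k, k \in H -> F (k * g)%g -> k = h].
Proof.
move=> fF g; have [h [Fh hu]] := fF g; exists (val h); split=> //.
  exact: (valP h).
by move=> k kH Fk; rewrite (hu (Sub k kH))// SubK.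
Qed.

Lemma esum_fundamental_domain F f g : fundamental_domain H F -> 0 <= f g ->
  \esum_(h in [set h | h \in H]) ((\1_F (h * g)%g)%:E * f g) = f g.
Proof.
move=> fF f0; have [h [hH Fh hu]] := fundamental_domainP fF g.
rewrite (@esum_single _ _ _ _ h)//.
- by rewrite indicE mem_set// mul1e.
- by rewrite mule_ge0// lee_fin.
- move=> k kH kh; rewrite indicE memNset ?mul0e// => Fk; apply: kh; exact: hu.
Qed.

(** The translates of F by H tile G. *)
Lemma unfold_integral F f : measurable F -> fundamental_domain H F ->
  measurable_fun setT f -> (forall g, 0 <= f g) ->
  \int[mG]_g (\esum_(h in [set h | h \in H]) ((\1_F g)%:E * f (h * g)%g)) =
  \int[mG]_g f g.
Proof.
move=> mF fF mf f0.
have m1 : measurable_fun setT (fun g => (\1_F g)%:E : \bar R).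
  exact/measurable_EFinP/measurable_indic.
have p1 g : 0 <= (\1_F g)%:E :> \bar R by rewrite lee_fin.
rewrite (integral_countable_esum _ eH)//; last 2 first.
- move=> h; apply: emeasurable_funM => //; apply: (measurableT_comp mf); exact: measurable_mull.
- by move=> h g; rewrite mule_ge0.
transitivity (\esum_(h in [set h | h \in H]) \int[mG]_g ((\1_F (h * g)%g)%:E * f g)).
  rewrite (reindex_esum [set h | h \in H] [set h | h \in H] (@monoid.inv G)); last first.
    split=> [h|h k _ _ /invg_inj//|h hH]; first by rewrite /= gpredV.
    by exists h^-1%g; rewrite /= ?gpredV// invgK.
  apply: eq_esum => h _.
  rewrite -(integral_mull (f := fun g => (\1_F g)%:E * f (h^-1 * g)%g) h lG)//.
  + by apply: eq_integral => g _; rewrite mulKg.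
  + by apply: emeasurable_funM => //; apply: (measurableT_comp mf); exact: measurable_mull.
  + by move=> g; rewrite mule_ge0.
rewrite -(integral_countable_esum _ eH)//; last 2 first.
- by move=> h; apply: emeasurable_funM => //; apply: (measurableT_comp m1); exact: measurable_mull.
- by move=> h g; rewrite mule_ge0.
by apply: eq_integral => g _; rewrite esum_fundamental_domain.
Qed.

(** Unfold the integral over F' along F, then fold it along F'. *)
Lemma eq_integral_fundamental_domain F F' f : measurable F -> measurable F' ->
  fundamental_domain H F -> fundamental_domain H F' ->
  measurable_fun setT f -> (forall g, 0 <= f g) ->
  (forall h g, h \in H -> f (h * g)%g = f g) ->
  \int[mG]_g ((\1_F g)%:E * f g) = \int[mG]_g ((\1_F' g)%:E * f g).
Proof.
move=> mF mF' fF fF' mf f0 invf.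
have m1 : measurable_fun setT (fun g => (\1_F' g)%:E : \bar R).
  exact/measurable_EFinP/measurable_indic.
rewrite -(@unfold_integral F (fun g => (\1_F' g)%:E * f g))//; last 2 first.
- exact: emeasurable_funM.
- by move=> g; rewrite mule_ge0// lee_fin.
apply: eq_integral => g _.
rewrite -[LHS](esum_fundamental_domain (f := fun g => (\1_F g)%:E * f g) fF').
  by apply: eq_esum => h hH; rewrite invf// muleCA.
by rewrite mule_ge0// lee_fin.
Qed.

End fundamental_domain.

(** * Cross sections whose return sets are cosets of a subgroup *)

Lemma saturationP dG (G : lcscGroupType dG) d (X : measurableType d) (a : action G X) (Y : set X) x :
  saturation a Y x <-> exists g, Y (a g x).
Proof.
split=> [[g [y [Yy <-]]]|[g Yg]].
  by exists g^-1%g; rewrite -actM mulVg act1.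
by exists g^-1%g, (a g x); split=> //; rewrite -actM mulVg act1.
Qed.

Lemma measurable_saturation dG (G : lcscGroupType dG) d (T : measurableType d)
    (a : action G T) (Y : set T) (D : nat -> set T) (s : nat -> T -> G) :
  enumerates (return_set a Y) D s -> measurable (saturation a Y).
Proof.
move=> [mD _ bij]; rewrite (_ : saturation a Y = \bigcup_n D n).
  exact: bigcup_measurable.
apply/seteqP; split=> x.
  by move=> /saturationP[g Yg]; have [_ _ /(_ g Yg)[n Dn _]] := bij x; exists n.
by move=> [n _ Dn]; apply/saturationP; exists (s n x); have [/(_ n Dn)] := bij x.
Qed.

Lemma saturation_act dG (G : lcscGroupType dG) d (X : measurableType d) (a : action G X) (Y : set X) g x :
  saturation a Y (a g x) <-> saturation a Y x.
Proof.
split=> /saturationP[h Yh]; apply/saturationP.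
  by exists (h * g)%g; rewrite actM.
by exists (h * g^-1)%g; rewrite -actM mulgVK.
Qed.

Section coset.
Context (R : realType) dG (G : lcscGroupType dG) (H : groupClosed G).
Variable mG : {sigma_finite_measure set G -> \bar R}.
Hypotheses (lG : left_invariant mG) (rG : right_invariant mG).
Variables (F : set G) (mF : measurable F) (fF : fundamental_domain H F).
Variables (P : set nat) (e : nat -> G).
Hypothesis eH : set_bij P [set g | g \in H] e.
Context d (T : measurableType d) (a : action G T) (Y : set T).
Hypotheses (ba : borel_action a) (mY : measurable Y).
Hypothesis cosetY : forall y g, Y y -> Y (a g y) <-> g \in H.
Variables (D : nat -> set T) (s : nat -> T -> G).
Hypothesis enumY : enumerates (return_set a Y) D s.

Let mulH h g x : h \in H -> Y (a g x) -> Y (a (h * g)%g x).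
Proof. by move=> hH Yg; rewrite actM; apply/cosetY. Qed.

Lemma coset_return_set g x h : Y (a g x) ->
  return_set a Y x h <-> (h * g^-1)%g \in H.
Proof.
move=> Yg; rewrite -(cosetY (h * g^-1)%g Yg) -actM mulgVK.
by split.
Qed.

(** The return set is a coset of H, which F meets once, or empty. *)
Lemma esum_coset_fundamental_domain x :
  \esum_(g in return_set a Y x) (\1_F g)%:E = (\1_(saturation a Y) x)%:E :> \bar R.
Proof.
have [xY|nxY] := pselect (saturation a Y x).
  rewrite [in RHS]indicE mem_set//; have /saturationP[g Yg] := xY.
  have [h [hH Fh hu]] := fundamental_domainP fF g.
  rewrite (@esum_single _ _ _ _ (h * g)%g).
  - by rewrite indicE mem_set.
  - exact: mulH.
  - by rewrite lee_fin.
  - move=> k Yk kh; rewrite indicE memNset// => Fk; apply: kh.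
    rewrite -(hu (k * g^-1)%g) ?mulgVK//.
    exact/(coset_return_set k Yg).
rewrite [in RHS]indicE memNset// esum1// => g Yg; exfalso; apply: nxY.
by apply/saturationP; exists g.
Qed.

Lemma coset_mass (m nu : {measure set T -> \bar R}) : campbell mG a Y m nu ->
  mG F * nu setT = m (saturation a Y).
Proof.
move=> /(_ (fun p => (\1_F p.1)%:E))/= h.
have m1 : measurable_fun setT (fun p : G * T => (\1_F p.1)%:E : \bar R).
  by apply/measurable_EFinP; apply: (measurableT_comp (measurable_indic mF)).
have := h m1 _; under eq_integral do rewrite esum_coset_fundamental_domain.
rewrite integral_indic ?setIT//; last exact: measurable_saturation enumY.
move=> ->; last by move=> p; rewrite lee_fin.
under eq_integral do rewrite integral_indic// setIT.
by rewrite integral_cst.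
Qed.

(** Replacing g by h * g permutes the return set of x and moves g.x by h, and
    costs nothing on the side of mG. *)
Lemma transverse_invariant (m nu : {measure set T -> \bar R}) :
  haar_measure mG -> campbell mG a Y m nu ->
  forall h f, h \in H -> measurable_fun setT f -> (forall y, 0 <= f y) ->
  \int[nu]_y f (a h y) = \int[nu]_y f y.
Proof.
move=> haarG cnu h f hH mf f0.
have [K [cK mK K0 Koo]] := haar_compact haarG.
have mh : measurable_fun setT (fun y => f (a h y)).
  exact: (measurableT_comp mf (measurable_act h ba)).
have m1 : measurable_fun setT (fun g : G => (\1_K g)%:E : \bar R).
  exact/measurable_EFinP/measurable_indic.
have m2 : measurable_fun setT (fun g : G => (\1_K (h^-1 * g)%g)%:E : \bar R).
  exact: (measurableT_comp m1 (measurable_mull h^-1%g)).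
have E f' w : measurable_fun setT f' -> (forall y, 0 <= f' y) ->
   measurable_fun setT w -> (forall g, 0 <= w g) -> \int[mG]_g w g = mG K ->
   \int[m]_x (\esum_(g in return_set a Y x) (w g * f' (a g x))) = (\int[nu]_y f' y) * mG K.
  move=> mf' f'0 mw w0 wK.
  have mF' : measurable_fun setT (fun p : G * T => w p.1 * f' p.2).
    by apply: emeasurable_funM; [apply: (measurableT_comp mw)|apply: (measurableT_comp mf')].
  rewrite (cnu (fun p => w p.1 * f' p.2))//=; last by move=> p; rewrite mule_ge0.
  rewrite -ge0_integralZr//; apply: eq_integral => y _.
  by rewrite ge0_integralZr// wK muleC.
apply: (mulIe K0 Koo).
rewrite -(E _ (fun g => (\1_K g)%:E))//; last by rewrite integral_indic// setIT.
rewrite -(E _ (fun g => (\1_K (h^-1 * g)%g)%:E))//; last first.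
  by rewrite (integral_mull (f := fun g => (\1_K g)%:E) _ lG)// integral_indic// setIT.
apply: eq_integral => x _.
rewrite [RHS](reindex_esum (return_set a Y x) (return_set a Y x) (fun g => h * g)%g).
  by apply: eq_esum => g _; rewrite mulKg actM.
split=> [g Yg|g k _ _ /mulgI//|g Yg]; first exact: mulH.
by exists (h^-1 * g)%g; rewrite ?mulVKg//=; apply: mulH => //; rewrite gpredV.
Qed.

Section inverse.
Variable nu : {sigma_finite_measure set T -> \bar R}.
Hypothesis nuY : nu (~` Y) = 0.
Hypothesis nuH : forall h f, h \in H -> measurable_fun setT f ->
  (forall y, 0 <= f y) -> \int[nu]_y f (a h y) = \int[nu]_y f y.

Let mFT : measurable (F `*` [set: T]).
Proof. exact: measurableX. Qed.

Let mact : measurable_fun setT (fun p : G * T => a p.1^-1%g p.2).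
Proof.
have h : measurable_fun setT (fun p : G * T => (p.1^-1%g, p.2)).
  by apply: measurable_fun_pair => //; exact/measurable_fun_inv.
exact: (measurableT_comp ba h).
Qed.

(** The invariant measure of the action induced from H, transported to T by
    (g, y) -> g^-1.y. *)
Definition suspension : {measure set T -> \bar R} :=
  image_measure (mrestr (mG \x nu) mFT) mact.

Lemma integral_suspension (f : T -> \bar R) : measurable_fun setT f ->
  (forall x, 0 <= f x) ->
  \int[suspension]_x f x = \int[mG]_g ((\1_F g)%:E * \int[nu]_y f (a g^-1%g y)).
Proof.
move=> mf f0; rewrite ge0_integral_image//.
have mfa : measurable_fun setT (fun p : G * T => f (a p.1^-1%g p.2)) by exact: measurableT_comp.
rewrite ge0_integral_mrestr// integral_mkcond.
transitivity (\int[mG \x nu]_p ((\1_F p.1)%:E * f (a p.1^-1%g p.2))).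
  apply: eq_integral => -[g y] _; rewrite patchE indicE in_setX in_setT andbT/=.
  by case: (g \in F); rewrite ?mul1e ?mul0e.
rewrite fubini_tonelli1//; last 2 first.
- apply: emeasurable_funM => //; apply/measurable_EFinP.
  exact: (measurableT_comp (measurable_indic mF)).
- by move=> p; rewrite mule_ge0// lee_fin.
apply: eq_integral => g _; rewrite /fubini_F /= ge0_integralZl ?lee_fin//.
exact: (measurableT_comp mf (measurable_act g^-1%g ba)).
Qed.

Lemma suspension_setT : suspension setT = mG F * nu setT.
Proof.
rewrite -[LHS]mul1e -integral_cst// integral_suspension//.
under eq_integral do rewrite integral_cst// mul1e.
rewrite ge0_integralZr//; last exact/measurable_EFinP/measurable_indic.
by rewrite integral_indic// setIT.
Qed.

(** The action of h replaces F by another fundamental domain, and the integral of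
    an H-invariant function does not depend on the domain. *)
Lemma suspension_invariant : invariant_measure a suspension.
Proof.
move=> h A mA.
have mA1 : measurable_fun setT (fun y => (\1_A y)%:E : \bar R).
  exact/measurable_EFinP/measurable_indic.
have mhA : measurable (a h @^-1` A).
  by have := measurable_act h ba measurableT mA; rewrite setTI.
have mhA1 : measurable_fun setT (fun y => (\1_(a h @^-1` A) y)%:E : \bar R).
  exact/measurable_EFinP/measurable_indic.
have A0 y : 0 <= (\1_A y)%:E :> \bar R by rewrite lee_fin.
rewrite -[LHS]/(suspension _) -[in LHS](setIT (a h @^-1` A)) -[in RHS](setIT A).
rewrite -!integral_indic// !integral_suspension//.
pose phi g := \int[nu]_y (\1_A (a g^-1%g y))%:E : \bar R.
have mphi : measurable_fun setT phi.
  apply: (measurable_fun_fubini_tonelli_F (fun p : G * T => (\1_A (a p.1^-1%g p.2))%:E)).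
  - exact: (measurableT_comp mA1 mact).
  - by move=> p; rewrite lee_fin.
have phi0 g : 0 <= phi g by apply: integral_ge0.
have mF' : measurable [set g | F (g * h)%g].
  by have := measurable_mulr h measurableT mF; rewrite setTI.
have fF' : fundamental_domain H [set g | F (g * h)%g].
  by move=> g; have [k [Fk ku]] := fF (g * h)%g; exists k; split=> /= [|j];
    rewrite -mulgA// => /ku.
transitivity (\int[mG]_g ((\1_F g)%:E * phi (g * h^-1)%g)).
  apply: eq_integral => g _; congr (_ * _); apply: eq_integral => y _.
  by rewrite !indicE invgM invgK actM.
rewrite -(integral_mulr (f := fun g => (\1_F g)%:E * phi (g * h^-1)%g) h rG); last 2 first.
- apply: emeasurable_funM; first exact/measurable_EFinP/measurable_indic.
  exact: (measurableT_comp mphi (measurable_mulr h^-1%g)).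
- by move=> g; rewrite mule_ge0// lee_fin.
transitivity (\int[mG]_g ((\1_[set g | F (g * h)%g] g)%:E * phi g)).
  by apply: eq_integral => g _; rewrite mulgK.
apply: (eq_integral_fundamental_domain lG eH) => // k g kH.
rewrite /phi -(nuH (f := fun y => (\1_A (a (k * g)^-1%g y))%:E) kH).
- by apply: eq_integral => y _; rewrite -actM invgM mulgVK.
- exact: (measurableT_comp mA1 (measurable_act _ ba)).
- by move=> y; rewrite lee_fin.
Qed.

(** The return set of g^-1.y is H * g when y is in Y; summing over it unfolds the
    integral over F to one over G. *)
Lemma campbell_suspension : campbell mG a Y suspension nu.
Proof.
move=> f mf f0.
have mphi : measurable_fun setT (fun x => \esum_(g in return_set a Y x) f (g, a g x)).
  apply: (measurable_esum enumY (h := fun p => f (p.1, a p.1 p.2))) => //.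
  exact: (measurableT_comp mf (measurable_orbit_map ba)).
rewrite integral_suspension//; last by move=> x; exact: esum_ge0.
have mfa : measurable_fun setT (fun p : G * T => f (p.1, p.2)).
  by apply: (measurableT_comp mf); apply: measurable_fun_pair.
have mfg g : measurable_fun setT (fun y => f (g, y)).
  by apply: (measurableT_comp mf); apply: measurable_fun_pair.
rewrite -(fubini_tonelli f)//.
have mI : measurable_fun setT (fun g => \int[nu]_y f (g, y)).
  exact: (measurable_fun_fubini_tonelli_F f).
rewrite -(unfold_integral lG eH mF fF mI)//; last first.
  by move=> g; exact: integral_ge0.
apply: eq_integral => g _.
transitivity ((\1_F g)%:E * \esum_(h in [set h | h \in H]) \int[nu]_y f (h * g, y)%g).
  congr (_ * _).
  transitivity (\int[nu]_y (\esum_(h in [set h | h \in H]) f (h * g, a h y)%g)).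
    apply: ge0_ae_eq_integral => //.
    - exact: (measurableT_comp mphi (measurable_act _ ba)).
    - apply: (measurable_countable_esum eH) => // h.
      exact: (measurableT_comp (mfg _) (measurable_act _ ba)).
    - by move=> y _; exact: esum_ge0.
    - by move=> y _; exact: esum_ge0.
    - exists (~` Y); split=> //; first exact: measurableC.
      move=> y /= nE Yy; apply: nE => _.
      rewrite (reindex_esum [set h | h \in H] (return_set a Y (a g^-1%g y)) (fun h => h * g)%g).
        by apply: eq_esum => h _; rewrite -actM mulgK.
      split.
      + by move=> h hH; rewrite /return_set /= -actM mulgK; apply/cosetY.
      + by move=> h k _ _ /mulIg.
      + move=> k; rewrite /return_set /= -actM => Yk.
        by exists (k * g^-1)%g; [exact/(cosetY _ Yy)|exact: mulgVK].
  rewrite (integral_countable_esum _ eH)//.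
  - apply: eq_esum => h hH; exact: nuH.
  - move=> h; exact: (measurableT_comp (mfg _) (measurable_act _ ba)).
have [gF|gF] := boolP (g \in F); rewrite indicE ?gF ?(negbTE gF).
  by rewrite mul1e; apply: eq_esum => h _; rewrite mul1e.
by rewrite mul0e esum1// => h _; rewrite mul0e.
Qed.

End inverse.
End coset.

(** * Intersection covolume *)

Section diagonal.
Context dG (G : lcscGroupType dG) d (T : measurableType d) (a : action G T).

Lemma borel_diag_action : borel_action a -> borel_action (diag_action a).
Proof.
move=> ba; apply: measurable_fun_pair.
  have h : measurable_fun setT (fun p : G * (T * T) => (p.1, p.2.1)).
    by apply: measurable_fun_pair => //; apply: measurableT_comp.
  exact: (measurableT_comp ba h).
have h : measurable_fun setT (fun p : G * (T * T) => (p.1, p.2.2)).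
  by apply: measurable_fun_pair => //; apply: measurableT_comp.
exact: (measurableT_comp ba h).
Qed.

Lemma return_set_diag (Y : set T) p : return_set (diag_action a) (Y `*` Y) p =
  return_set a Y p.1 `&` return_set a Y p.2.
Proof. by []. Qed.

End diagonal.

Lemma measure_null_setC (R : realType) d (T : measurableType d)
    (m : {measure set T -> \bar R}) (Y : set T) :
  measurable Y -> m (~` Y) = 0 -> m setT = m Y.
Proof.
by move=> mY mYC; rewrite -(setUv Y) measureU0//; exact: measurableC.
Qed.

Lemma measure_setC0 (R : realType) d (T : measurableType d)
    (m : {measure set T -> \bar R}) (A : set T) :
  measurable A -> m setT < +oo -> m setT = m A -> m (~` A) = 0.
Proof.
move=> mA mT mTA; rewrite -setTD.
transitivity (m setT - m (setT `&` A)); first exact: measureD.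
by rewrite setTI -mTA subee// ge0_fin_numE.
Qed.

Section product_null.
Context (R : realType) d (T : measurableType d).
Variable nu : {sigma_finite_measure set T -> \bar R}.

Lemma product_setT : (nu \x nu) setT = nu setT * nu setT.
Proof. by rewrite -setXTT product_measure1E. Qed.

Lemma product_null (Y : set T) : measurable Y -> nu (~` Y) = 0 ->
  (nu \x nu) (~` (Y `*` Y)) = 0.
Proof.
move=> mY nuY; have mCY : measurable (~` Y) by exact: measurableC.
have n1 : (nu \x nu) (~` Y `*` [set: T]) = 0.
  by transitivity (nu (~` Y) * nu setT); [exact: product_measure1E|rewrite nuY mul0e].
have n2 : (nu \x nu) ([set: T] `*` ~` Y) = 0.
  by transitivity (nu setT * nu (~` Y)); [exact: product_measure1E|rewrite nuY mule0].
have : (nu \x nu).-negligible ((~` Y `*` [set: T]) `|` ([set: T] `*` ~` Y)).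
  by apply: negligibleU; apply/negligibleP => //; exact: measurableX.
have sub : ~` (Y `*` Y) `<=` (~` Y `*` [set: T]) `|` ([set: T] `*` ~` Y).
  move=> [x y] /= nxy; have [Yx|] := pselect (Y x); last by left.
  by right; split=> // Yy; apply: nxy.
move=> /(negligibleS sub)/negligibleP; apply.
by apply: measurableC; exact: measurableX.
Qed.

End product_null.

Section cross_section.
Context (R : realType) dG (G : lcscGroupType dG).
Variable mG : {sigma_finite_measure set G -> \bar R}.
Hypotheses (haarG : haar_measure mG) (rG : right_invariant mG).
Context d (T : measurableType d) (psi : T -> baire) (cT : coding psi).
Variables (a : action G T) (ba : borel_action a).
Variables (mu : probability T R) (imu : invariant_measure a mu).
Variables (Y : set T) (lY : locally_integrable_cross_section a mu Y).

Let lG : left_invariant mG. Proof. by case: haarG. Qed.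

Let mY : measurable Y. Proof. by case: lY. Qed.

Lemma cross_section_locally_finite x : locally_finite (return_set a Y x).
Proof.
have [_ _ lfY _] := lY; have [/lfY//|nsat] := pselect (saturation a Y x).
move=> K _; apply: (@sub_finite_set _ _ set0) => // g [Yg _].
by apply: nsat; apply/saturationP; exists g.
Qed.

Lemma cross_section_enum : exists (D : nat -> set T) (s : nat -> T -> G),
  enumerates (return_set a Y) D s.
Proof. exact: cross_section_enumeration cT ba mY cross_section_locally_finite. Qed.

Lemma diag_enum : exists (D : nat -> set (T * T)) (s : nat -> T * T -> G),
  enumerates (return_set (diag_action a) (Y `*` Y)) D s.
Proof.
apply: (cross_section_enumeration (coding_prod cT cT) (borel_diag_action ba)).
  exact: measurableX.
move=> p; rewrite return_set_diag.
exact: locally_finiteS (@subIsetl _ _ _) (cross_section_locally_finite p.1).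
Qed.

Lemma cross_section_locally_integrable K : compact K ->
  \int[mu]_x (\esum_(g in return_set a Y x) (\1_K g)%:E) < +oo.
Proof.
move=> cK; have [_ _ _ /(_ _ cK)] := lY.
apply: le_lt_trans; rewrite le_eqVlt; apply/orP; left; apply/eqP.
apply: eq_integral => x _.
rewrite counting_esum; last exact: cross_section_locally_finite.
rewrite esum_mkcondr; apply: eq_esum => g _.
by rewrite indicE; case: (g \in K).
Qed.

Let nu := transverse_measure mG a mu Y.

(** By local integrability a transverse measure exists, so that the one selected
    is the transverse measure of Y. *)
Lemma transverse_measureP : [/\ nu (~` Y) = 0, nu setT < +oo & campbell mG a Y mu nu].
Proof.
have [D [s enumY]] := cross_section_enum.
have [nu' [nu'Y cnu']] := campbell_exists haarG rG ba mY enumY imu cross_section_locally_integrable.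
have tnu' := campbell_is_transverse mY nu'Y cnu'.
have tnu : is_transverse_measure mG a mu Y nu.
  pose Q : set {classic {sigma_finite_measure set T -> \bar R}} :=
    [set n : {sigma_finite_measure set T -> \bar R} | is_transverse_measure mG a mu Y n].
  have exQ : exists n, Q n by exists (nu' : {sigma_finite_measure set T -> \bar R}).
  have := @xgetPex {classic {sigma_finite_measure set T -> \bar R}} (@zero_measure d T R) Q exQ.
  exact.
have nuE := is_transverse_unique mY haarG tnu tnu'.
have nufin : nu setT < +oo.
  by rewrite nuE// -ge0_fin_numE//; exact: fin_num_measure.
split=> //; first by rewrite nuE//; exact: measurableC.
exact: (is_transverse_campbell ba mY haarG rG enumY).
Qed.

Lemma intensityE : intensity mG a mu Y = nu setT.
Proof.
have [nuY _ _] := transverse_measureP.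
exact/esym/(measure_null_setC mY nuY).
Qed.

Lemma intersection_measureP : (exists m, is_intersection_measure mG a mu Y m) ->
  let M := intersection_measure mG a mu Y in
  is_intersection_measure mG a mu Y M /\
  campbell mG (diag_action a) (Y `*` Y) M (nu \x nu).
Proof.
move=> exm M.
have iM : is_intersection_measure mG a mu Y M.
  pose Q : set {classic {sigma_finite_measure set (T * T)%type -> \bar R}} :=
    [set m | is_intersection_measure mG a mu Y m].
  have := @xgetPex {classic {sigma_finite_measure set (T * T)%type -> \bar R}}
    (@zero_measure _ (T * T)%type R) Q exm.
  exact.
split=> //; have [_ invM tM] := iM; have [D [s enumYY]] := diag_enum.
have [_ nufin _] := transverse_measureP.
apply: (is_transverse_campbell (borel_diag_action ba) _ haarG rG enumYY) => //.
  exact: measurableX.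
by rewrite /= product_setT lte_mul_pinfty// ge0_fin_numE.
Qed.

Section coset.
Variables (H : groupClosed G) (F : set G).
Hypotheses (dH : discrete_subgroup H) (mF : measurable F).
Hypotheses (fF : fundamental_domain H F) (Foo : mG F < +oo).
Hypothesis cosetY : forall y g, Y y -> Y (a g y) <-> g \in H.

Lemma coset_intensity : mG F * nu setT = 1.
Proof.
have [D [s enumY]] := cross_section_enum.
have [_ _ cnu] := transverse_measureP.
rewrite (coset_mass mF fF cosetY enumY cnu).
have msat := measurable_saturation enumY.
have [_ nsat _ _] := lY.
rewrite -(probability_setT mu) -(setUv (saturation a Y)) measureU//; last 2 first.
- exact: measurableC.
- exact: setICr.
by rewrite (measure_negligible _ nsat) ?adde0//; exact: measurableC.
Qed.

(** Y * Y is also a cross section with coset return sets, and its transverse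
    measure is the square of nu.  Its suspension shows that an intersection
    measure exists; [coset_mass] computes the mass of the one selected. *)
Lemma coset_intersection_covolume :
  intersection_covolume mG a mu Y = intensity mG a mu Y.
Proof.
have [D [s enumYY]] := diag_enum.
have [nuY nufin cnu] := transverse_measureP.
have [P [e eH]] := locally_finite_enum (discrete_locally_finite dH).
have mYY : measurable (Y `*` Y) by exact: measurableX.
have bd := borel_diag_action ba.
have cosetYY y g : (Y `*` Y) y -> (Y `*` Y) (diag_action a g y) <-> g \in H.
  move=> [Y1 Y2]; split=> [[/= Y1' _]|gH]; first exact/(cosetY g Y1).
  by split; apply/cosetY.
have [Ds [ss enumY]] := cross_section_enum.
have nuH := transverse_invariant lG ba cosetY haarG cnu.
have nu2fin : (nu \x nu) setT < +oo.
  by rewrite product_setT lte_mul_pinfty// ge0_fin_numE.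
pose nu2 : {finite_measure set (T * T)%type -> \bar R} := with_finite nu2fin.
have nu2H h f : h \in H -> measurable_fun setT f -> (forall y, 0 <= f y) ->
    \int[nu2]_y f (diag_action a h y) = \int[nu2]_y f y.
  move=> hH mf f0; rewrite -[LHS]/(\int[nu \x nu]_y f (diag_action a h y)).
  rewrite -[RHS]/(\int[nu \x nu]_y f y).
  have mfh : measurable_fun setT (fun y => f (diag_action a h y)).
    exact: (measurableT_comp mf (measurable_act h bd)).
  rewrite (fubini_tonelli1 _ mfh)//.
  transitivity (\int[nu]_x \int[nu]_y f (a h x, y)).
    apply: eq_integral => x _.
    apply: (nuH h (fun y => f (a h x, y))) => //.
    by apply: (measurableT_comp mf); apply: measurable_fun_pair.
  rewrite (fubini_tonelli1 f mf f0).
  apply: (nuH h (fun x => \int[nu]_y f (x, y))) => //.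
    exact: (measurable_fun_fubini_tonelli_F f).
  by move=> x; exact: integral_ge0.
have nu2Y : nu2 (~` (Y `*` Y)) = 0 by exact: product_null.
pose m0 := suspension mG mF bd nu2.
have m0T : m0 setT = mG F * nu2 setT by exact: suspension_setT.
have cm0 : campbell mG (diag_action a) (Y `*` Y) m0 nu2.
  exact: (campbell_suspension lG mF fF eH bd mYY cosetYY enumYY nu2Y nu2H).
have m0sat := coset_mass mF fF cosetYY enumYY cm0.
have m0fin : m0 setT < +oo.
  by rewrite m0T lte_mul_pinfty// ge0_fin_numE.
pose m : {finite_measure set (T * T)%type -> \bar R} := with_finite m0fin.
have msat := measurable_saturation enumYY.
have m0C : m0 (~` saturation (diag_action a) (Y `*` Y)) = 0.
  exact: (measure_setC0 msat m0fin (etrans m0T m0sat)).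
have mint : is_intersection_measure mG a mu Y m.
  split.
  - apply/negligibleP; first exact: measurableC.
    exact: m0C.
  - exact: (suspension_invariant lG rG mF fF eH bd nu2H).
  - exact: (campbell_is_transverse mYY nu2Y cm0).
have [_ cM] := intersection_measureP (ex_intro _ _ mint).
rewrite /intersection_covolume /intersection_space.
rewrite -(coset_mass mF fF cosetYY enumYY cM) intensityE.
by rewrite [X in _ * X]product_setT muleA coset_intensity mul1e.
Qed.

End coset.

End cross_section.

(** * From induced actions to cross sections *)

Section lcsc.
Context dG (G : lcscGroupType dG).

Lemma locally_finite_measurable (S : set G) : locally_finite S -> measurable S.
Proof.
move=> lfS; apply: countable_measurable; last exact: locally_finite_countable.
by move=> g; apply: closed_measurable_lcsc; apply: lcsc_finite_closed; exact: finite_set1.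
Qed.

Lemma compact_div (K : set G) : compact K ->
  compact [set (g.1 * g.2^-1)%g | g in K `*` K].
Proof.
move=> cK; apply: continuous_compact; last exact: compact_setX.
apply: continuous_subspaceT => p.
apply: (@continuous_comp _ _ _ (fun p : G * G => (p.1, p.2^-1%g)) (fun p => (p.1 * p.2)%g)).
  apply: cvg_pair => /=; first exact: cvg_fst.
  apply: (@cvg_comp _ _ _ snd (fun g : G => g^-1%g)); first exact: cvg_snd.
  exact: invg_continuous.
exact: mulg_continuous.
Qed.

Lemma compact_mulr (K : set G) g : compact K -> compact [set (h * g)%g | h in K].
Proof.
move=> cK; apply: continuous_compact => //; apply: continuous_subspaceT => h.
apply: (@continuous_comp _ _ _ (fun h : G => (h, g)) (fun p => (p.1 * p.2)%g)).
  by apply: cvg_pair => /=; [exact: cvg_id|exact: cvg_cst].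
exact: mulg_continuous.
Qed.

End lcsc.

Section induced.
Context dG (G : lcscGroupType dG) (H : groupClosed G).
Context dZ (Z : measurableType dZ) (c : action (subgroup H) Z).

(** The classes that meet {1} * Z, or equivalently H * Z. *)
Definition base_fiber : set (induced_space c) :=
  [set q | exists z, q = induced_proj c (1%g, z)].

Lemma base_fiberE g z : base_fiber (induced_proj c (g, z)) <-> g \in H.
Proof.
split=> [[z' /orbit_projE[h [hg _]]]|gH].
  have -> : g = (val h)^-1%g by apply: (mulgI (val h)); rewrite mulgV.
  by rewrite gpredV; exact: (valP h).
exists (c (Sub g gH : subgroup H)^-1%g z); apply/orbit_projE.
exists (Sub g gH : subgroup H)^-1%g => /=; rewrite /translation_act /= .
by rewrite mulVg.
Qed.

Lemma measurable_base_fiber : discrete_subgroup H -> measurable base_fiber.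
Proof.
move=> dH; rewrite /measurable/= /orbit_measurable /image_set_system /= setTI.
rewrite (_ : _ @^-1` _ = [set g : G | g \in H] `*` [set: Z]).
  apply: measurableX => //.
  exact/locally_finite_measurable/discrete_locally_finite.
apply/seteqP; split=> -[g z]; first by move=> /base_fiberE.
by move=> [gH _]; apply/base_fiberE.
Qed.

Lemma base_fiber_act q g : base_fiber q ->
  base_fiber (induced_action c g q) <-> g \in H.
Proof.
by move=> [z ->]; rewrite /= induced_actE base_fiberE /= mul1g gpredV.
Qed.

Lemma base_fiber_reached q : exists g, base_fiber (induced_action c g q).
Proof.
exists (repr q).1; rewrite /= /induced_act mulgV.
by exists (repr q).2.
Qed.

End induced.

Section coset_cross_section.
Context (R : realType) dG (G : lcscGroupType dG) (H : groupClosed G).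
Context d (T : measurableType d) (psi : T -> baire) (cT : coding psi).
Variables (a : action G T) (ba : borel_action a) (mu : probability T R).
Hypothesis dH : discrete_subgroup H.

(** A compact set K meets every coset of H in at most as many points as
    H meets the compact set of the quotients of elements of K. *)
Lemma coset_locally_integrable (Y : set T) : measurable Y ->
  mu.-negligible (~` saturation a Y) ->
  (forall y g, Y y -> Y (a g y) <-> g \in H) ->
  locally_integrable_cross_section a mu Y.
Proof.
move=> mY nY cosetY.
have lfH := discrete_locally_finite dH.
have retE x g : Y (a g x) -> return_set a Y x `<=` [set (h * g)%g | h in [set h | h \in H]].
  move=> Yg k Yk; exists (k * g^-1)%g; last exact: mulgVK.
  exact/(coset_return_set cosetY k Yg).
have lfY x : locally_finite (return_set a Y x).
  move=> K cK; have [[g Yg]|nY'] := pselect (exists g, Y (a g x)); last first.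
    by apply: (@sub_finite_set _ _ set0) => // g [Yg _]; apply: nY'; exists g.
  apply: (@sub_finite_set _ _ [set (h * g)%g | h in [set h | h \in H] `&`
      [set (k * g^-1)%g | k in K]]).
    move=> k [Yk Kk]; have [h hH hk] := retE _ _ Yg _ Yk.
    by exists h => //; split=> //; exists k => //; rewrite -hk mulgK.
  by apply: finite_image; apply: lfH; exact: compact_mulr.
split=> //.
move=> K cK; pose KK := [set (g.1 * g.2^-1)%g | g in K `*` K].
have fKK : finite_set ([set h | h \in H] `&` KK) by exact/lfH/compact_div.
have [D [s enumY]] := cross_section_enumeration cT ba mY lfY.
have mK : measurable K.
  exact/closed_measurable_lcsc/(compact_closed (@lcsc_hausdorff _ G) cK).
have countE x : counting (return_set a Y x `&` K) =
    \esum_(g in return_set a Y x) (\1_K g)%:E :> \bar R.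
  rewrite counting_esum; last exact: lfY.
  rewrite esum_mkcondr; apply: eq_esum => g _.
  by rewrite indicE; case: (g \in K).
apply: (@le_lt_trans _ _ (\int[mu]_x (cst (counting ([set h | h \in H] `&` KK)) x))); last first.
  rewrite integral_cst// [X in _ * X](_ : _ = 1) ?mule1; last exact: (probability_setT mu).
  by rewrite /counting asboolT// ltry.
apply: ge0_le_integral => //.
- by rewrite (_ : (fun x => _) = (fun x => \esum_(g in return_set a Y x) (\1_K g)%:E)); [|exact/funext]; apply: (measurable_esum enumY (h := fun p => (\1_K p.1)%:E));
    [apply/measurable_EFinP; apply: (measurableT_comp (measurable_indic mK))|
     move=> p; rewrite lee_fin].
- move=> x _ /=.
  have [[g [Yg Kg]]|nY'] := pselect (exists g, return_set a Y x g /\ K g); last first.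
    rewrite (_ : _ `&` K = set0); first by rewrite measure0.
    by apply/seteqP; split=> // g [Yg Kg]; apply: nY'; exists g.
  rewrite counting_esum; last exact: lfY.
  rewrite counting_esum//.
  rewrite -(esum_image (return_set a Y x `&` K) (fun k => k * g^-1)%g (fun=> 1)); last first.
    by move=> k l _ _ /mulIg.
  rewrite esum_mkcond [leRHS]esum_mkcond; apply: le_esum => k _.
  case: ifPn => [/set_mem[l [Yl Kl] <-]|_]; last by case: ifP.
  rewrite mem_set//; split; first exact/(coset_return_set cosetY l Yg).
  by exists (l, g).
Qed.

End coset_cross_section.

Section forward.
Context (R : realType) dG (G : lcscGroupType dG).
Variable mG : {sigma_finite_measure set G -> \bar R}.
Hypotheses (haarG : haar_measure mG) (rG : right_invariant mG).
Context d (T : measurableType d) (psi : T -> baire) (cT : coding psi).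
Variables (a : action G T) (ba : borel_action a).
Variables (mu : probability T R) (imu : invariant_measure a mu).

(** The base fiber, pulled back by the isomorphism f; it is cut by the conull set
    A1 on which f is known to be equivariant. *)
Lemma induced_cross_section : induced_from_lattice mG a mu ->
  exists Y : set T, locally_integrable_cross_section a mu Y /\
    intersection_covolume mG a mu Y = intensity mG a mu Y.
Proof.
move=> [H [[dH [F [mF fF Foo]]] [dZ [Z [zeta [c [_ _ _ [F2 [mF2 [_ iso]]]]]]]]]].
have [A1 [A2 [f [f' [[[mA1 A10 A1inv] _] [mf _] [fA _ _ _] feq _]]]]] := iso.
have A1act g x : A1 (a g x) = A1 x by rewrite -[in RHS](A1inv g).
pose Y := A1 `&` f @^-1` (@base_fiber _ _ H _ _ c).
have mY : measurable Y by apply: mf => //; exact: measurable_base_fiber.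
have cosetY y g : Y y -> Y (a g y) <-> g \in H.
  move=> [Ay fy]; rewrite /Y /= A1act feq// base_fiber_act//.
  by split=> [[]|].
have nY : mu.-negligible (~` saturation a Y).
  exists (~` A1); split=> //; first exact: measurableC.
  apply: subsetC => x Ax; apply/saturationP.
  have [g fg] := @base_fiber_reached _ _ _ _ _ c (f x).
  by exists g; split; rewrite /= ?A1act ?feq.
have lY := coset_locally_integrable cT ba dH mY nY cosetY.
exists Y; split=> //.
exact: (coset_intersection_covolume haarG rG cT ba imu lY dH mF fF Foo cosetY).
Qed.

End forward.

(** * Positive weights, subgroups from sets, Borel fundamental domains *)

Lemma measurable_neq0 (R : realType) d (T : measurableType d) (f : T -> \bar R) :
  measurable_fun setT f -> measurable [set x | f x <> 0].
Proof.
by move=> mf; have := mf measurableT (~` [set 0]) (measurableC (emeasurable_set1 0)); rewrite setTI.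
Qed.

Lemma ge0_integral_eq0P (R : realType) d (T : measurableType d)
    (m : {measure set T -> \bar R}) (f : T -> \bar R) :
  measurable_fun setT f -> (forall x, 0 <= f x) ->
  \int[m]_x f x = 0 <-> m [set x | f x <> 0] = 0.
Proof.
move=> mf f0.
have mN := measurable_neq0 mf.
transitivity (\int[m]_x `|f x| = 0).
  by under [in X in _ <-> X]eq_integral do rewrite gee0_abs//.
rewrite ae_eq_integral_abs//; split.
  move=> [A [mA A0 fA]]; apply/eqP; rewrite eq_le measure_ge0 andbT -[leRHS]A0.
  by apply: le_measure; rewrite ?inE// => x fx; apply: fA => /(_ I).
by move=> N0; exists [set x | f x <> 0]; split=> // x /= h fx; apply: h.
Qed.

Lemma esumZr (R : realType) (I : choiceType) (S : set I) (P : set nat) (e : nat -> I)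
    (f : I -> \bar R) (c : R) : set_bij P S e -> (forall i, 0 <= f i) -> (0 <= c)%R ->
  \esum_(i in S) (f i * c%:E) = (\esum_(i in S) f i) * c%:E.
Proof.
move=> bij f0 c0; rewrite !(esum_enum bij)//; last first.
  by move=> i _; rewrite mule_ge0.
rewrite [RHS]muleC -nneseriesZl//; last first.
  by move=> n _; rewrite patchE; case: (n \in P) => //=; exact: f0.
apply: eq_eseriesr => n _; rewrite !patchE; case: (n \in P); last by rewrite mule0.
by rewrite muleC.
Qed.

Lemma positive_weight (R : realType) d (T : measurableType d)
    (m : {sigma_finite_measure set T -> \bar R}) : exists w : T -> \bar R,
  [/\ measurable_fun setT w, forall x, 0 < w x & \int[m]_x w x < +oo].
Proof.
have /sigma_finiteP[F [FT _ mF]] := sigma_finiteT m.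
(* The series of the r n * m (F n) is bounded by that of the 2 ^- n.+1. *)
pose r n := ((1 / (2 ^ n.+1)%:R) / (1 + fine (m (F n))))%R : R.
have den0 n : (0 < 1 + fine (m (F n)) :> R)%R.
  by rewrite ltr_pwDl// fine_ge0.
have r0 n : (0 < r n)%R by rewrite divr_gt0// divr_gt0// ltr0n expn_gt0.
pose t n x := (r n)%:E * (\1_(F n) x)%:E : \bar R.
have t0 n x : 0 <= t n x by rewrite mule_ge0// lee_fin// ltW.
have mt n : measurable_fun setT (t n).
  apply: emeasurable_funM; first exact: measurable_cst.
  by apply/measurable_EFinP/measurable_indic; case: (mF n).
exists (fun x => \sum_(n <oo) t n x); split.
- by apply: ge0_emeasurable_sum => // n x _ _.
- move=> x; have : [set: T] x by []; rewrite FT => -[n _ Fnx].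
  apply: (@lt_le_trans _ _ (t n x)); first by rewrite /t indicE mem_set// mule1 lte_fin.
  by rewrite (nneseriesD1 (n := n))// leeDl// nneseries_ge0.
- rewrite integral_nneseries//.
  apply: (@le_lt_trans _ _ (\sum_(n <oo) (1 / (2 ^ n.+1)%:R)%:E)).
    apply: lee_nneseries => [n _ _|n]; first exact: integral_ge0.
    move=> _; rewrite ge0_integralZl//; last 2 first.
    + by apply/measurable_EFinP/measurable_indic; case: (mF n).
    + by rewrite lee_fin ltW.
    have [mFn Fnoo] := mF n.
    rewrite integral_indic// setIT.
    have ffin : m (F n) \is a fin_num by rewrite ge0_fin_numE.
    rewrite -[X in _ * X](fineK ffin) -EFinM lee_fin /r -[leRHS]mulr1 -[leLHS]mulrA.
    apply: ler_wpM2l; first exact: divr_ge0.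
    by rewrite mulrC ler_pdivrMr// mul1r lerDr.
  apply: (@le_lt_trans _ _ 1%:E); last exact: ltry.
  exact: epsilon_trick0.
Qed.

Section return_group.
Context (G : groupType) (S : set G).

Definition subgroup_set := S 1%g /\ forall g h, S g -> S h -> S (g * h^-1)%g.

Definition group_pred of subgroup_set : {pred G} := fun g => `[< S g >].

Variable hS : subgroup_set.

Lemma in_group_pred g : (g \in group_pred hS) = `[< S g >].
Proof. by []. Qed.

Let group_pred1 : 1%g \in group_pred hS.
Proof. by rewrite in_group_pred; apply/asboolP; case: hS. Qed.

Let group_predV : invg_closed (group_pred hS).
Proof.
move=> g; rewrite !in_group_pred => /asboolP Sg; apply/asboolP.
by rewrite -[g^-1%g]mul1g; case: hS => S1; apply.
Qed.

Let group_predM : mulg_closed (group_pred hS).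
Proof.
move=> g h; rewrite !in_group_pred => /asboolP Sg /asboolP Sh; apply/asboolP.
rewrite -[h]invgK; have [S1 SV] := hS; apply: (SV) => //.
by rewrite -[h^-1%g]mul1g; exact: SV.
Qed.

HB.instance Definition _ := isMulClosed.Build G (group_pred hS) group_predM.
HB.instance Definition _ := isMul1Closed.Build G (group_pred hS) group_pred1.
HB.instance Definition _ := isInvClosed.Build G (group_pred hS) group_predV.

Definition group_of_set : groupClosed G := group_pred hS.

End return_group.

Section fundamental_domain_exists.
Context dG (G : lcscGroupType dG) (H : groupClosed G).

Lemma locally_finite_discrete : locally_finite [set g : G | g \in H] ->
  discrete_subgroup H.
Proof.
move=> lfH; have [K [cK _ K1]] := lcsc_compact_nbhs (1%g : G).
pose A := ~` ([set h | h \in H] `&` K `\ 1%g).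
exists (A `&` K).
  apply: filterI => //; apply: open_nbhs_nbhs; split; last by case=> _; apply.
  apply: closed_openC; apply: lcsc_finite_closed.
  by apply: sub_finite_set (lfH K cK) => h [].
by move=> g gH [nA Kg]; apply: contrapT => g1; apply: nA.
Qed.

(** G is covered by basic sets V n so small that no element of H other than 1 maps
    a point of V n into V n.  Each orbit is then represented in the first such
    V n that it meets, and by one point only. *)
Lemma fundamental_domain_exists : discrete_subgroup H ->
  exists F : set G, measurable F /\ fundamental_domain H F.
Proof.
move=> dH; have cH := locally_finite_countable (discrete_locally_finite dH).
have [V bV] := lcsc_base G; have [U U1 UH] := dH.
pose sep n := forall g h, V n g -> h \in H -> V n (h * g)%g -> h = 1%g.
have sepV g : exists n, sep n /\ V n g.
  have cdiv : {for (g, g), continuous (fun p : G * G => (p.2 * p.1^-1)%g)}.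
    apply: (@continuous_comp _ _ _ (fun p : G * G => (p.2, p.1^-1%g)) (fun p => (p.1 * p.2)%g)).
      apply: cvg_pair => /=; first exact: cvg_snd.
      apply: (@cvg_comp _ _ _ fst (fun g : G => g^-1%g)); first exact: cvg_fst.
      exact: invg_continuous.
    exact: mulg_continuous.
  have : nbhs (g, g) [set p : G * G | U (p.2 * p.1^-1)%g].
    by apply: cdiv; rewrite /= mulgV.
  move=> [[A B] /= [gA gB] AB].
  have [n Vng VAB] := bV.2 _ _ (filterI gA gB); exists n; split=> //.
  move=> k h /VAB[Ak _] hH /VAB[_ Bhk]; apply: UH => //.
  by have := AB (k, (h * k)%g) (conj Ak Bhk); rewrite /= mulgK.
pose E n := if `[< sep n >] then V n else set0.
have mE n : measurable (E n).
  by rewrite /E; case: asboolP => // _; apply/open_measurable_lcsc/bV.1.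
pose HE n := \bigcup_(h in [set h | h \in H]) [set g | E n (h * g)%g].
have mHE n : measurable (HE n).
  rewrite /HE; have [P [e [eP _ eS]]] := locally_finite_enum (discrete_locally_finite dH).
  rewrite (_ : \bigcup_(_ in _) _ = \bigcup_(k in P) [set g | E n (e k * g)%g]).
    apply: bigcup_measurable => k _.
    by have := measurable_mull (e k) measurableT (mE n); rewrite setTI.
  apply/seteqP; split=> g [h hH Eh]; last by exists (e h) => //; exact: eP.
  by have [k Pk kh] := eS h hH; exists k => //; rewrite /= kh.
exists (\bigcup_n (E n `\` \bigcup_(m in [set m | (m < n)%N]) HE m)); split.
  apply: bigcup_measurable => n _; apply: measurableD => //.
  exact: bigcup_measurable.
have HEmul n g h : h \in H -> HE n (h * g)%g -> HE n g.
  by move=> hH [k kH Ek]; exists (k * h)%g; rewrite /= -?mulgA//; exact: gpredM.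
move=> g.
have exn : exists n, `[< HE n g >].
  have [n [sn Vng]] := sepV g; exists n; apply/asboolP; exists 1%g => /=.
    exact: gpred1.
  by rewrite mul1g /E asboolT.
have [n /asboolP HEn nmin] := ex_minnP exn.
have [h hH Eh] := HEn.
have notm k m : k \in H -> (m < n)%N -> ~ HE m (k * g)%g.
  move=> kH mn /(HEmul _ _ _ kH) HEm; have := nmin m (asboolT HEm).
  by rewrite leqNgt mn.
exists (Sub h hH : subgroup H); split.
  by exists n => //; split=> [|[m mn]]; rewrite ?SubK//; exact: notm.
move=> k [n' _ [Ek nk]].
have kH : val k \in H := valP k.
have nn' : n = n'.
  apply/eqP; rewrite eqn_leq; apply/andP; split.
    by apply: nmin; apply/asboolP; exists (val k).
  rewrite leqNgt; apply/negP => nn'; apply: nk; exists n => //.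
  by exists (h * (val k)^-1)%g; rewrite /= ?mulgA ?mulgVK ?gpredMr ?gpredV// -mulgA mulVKg.
subst n'; apply: val_inj => /=.
move: Ek Eh; rewrite /E; case: asboolP => // sn Vk Vh.
have := sn (val k * g)%g (h * (val k)^-1)%g Vk.
rewrite gpredMr ?gpredV// => /(_ hH); rewrite mulgA mulgVK => /(_ Vh) hk.
by rewrite -[RHS]mul1g -hk mulgVK.
Qed.

End fundamental_domain_exists.

(** * Cross sections with equal intersection covolume and intensity *)

Section reciprocal.
Context (R : realType).

(** With value 0 at 0 and at +oo, so that x * reciprocal x is 0 or 1. *)
Definition reciprocal (x : \bar R) : \bar R := ((fine x)^-1)%:E.

Lemma reciprocal_ge0 x : 0 <= x -> 0 <= reciprocal x.
Proof. by move=> x0; rewrite lee_fin invr_ge0 fine_ge0. Qed.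

Lemma mule_reciprocal x : 0 < x -> x < +oo -> x * reciprocal x = 1.
Proof.
case: x => [r||]//; rewrite lte_fin => r0 _.
by rewrite /reciprocal -EFinM mulfV// gt_eqF.
Qed.

Lemma mule_reciprocal_le1 x : 0 <= x -> x * reciprocal x <= 1.
Proof.
move=> x0; have [xoo|] := ltP x +oo; last first.
  by rewrite leye_eq => /eqP ->; rewrite /reciprocal/= invr0 mule0.
move: x0; rewrite le_eqVlt => /orP[/eqP <-|x0]; first by rewrite mul0e.
by rewrite mule_reciprocal.
Qed.

Lemma measurable_reciprocal d (T : measurableType d) (f : T -> \bar R) :
  measurable_fun setT f -> (forall x, 0 <= f x) ->
  measurable_fun setT (fun x => reciprocal (f x)).
Proof.
move=> mf f0; apply/measurable_EFinP.
under eq_fun do rewrite -powR_inv1 ?fine_ge0//.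
apply: (@measurableT_comp _ _ _ _ _ _ (fun r : R => r `^ (-1))%R _ (fun x => fine (f x))).
  exact: measurable_powR.
by apply: measurableT_comp.
Qed.

End reciprocal.

(** Fubini's theorem, in both orders. *)
Lemma null_sections (R : realType) d (T : measurableType d)
    (m : {sigma_finite_measure set T -> \bar R}) (B : set (T * T)) :
  measurable B -> (m \x m) B = 0 -> 0 < m setT ->
  exists t, m [set s | B (t, s) \/ B (s, t)] = 0.
Proof.
move=> mB B0 mT.
have m1 : measurable_fun setT (fun p => (\1_B p)%:E : \bar R).
  exact/measurable_EFinP/measurable_indic.
have h0 : \int[m \x m]_p (\1_B p)%:E = 0 by rewrite integral_indic// setIT.
have sec1 t : measurable [set s | B (t, s)].
  by have := measurable_fun_pair (measurable_cst t) (@measurable_id _ T setT)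
    measurableT mB; rewrite setTI.
have sec2 t : measurable [set s | B (s, t)].
  by have := measurable_fun_pair (@measurable_id _ T setT) (measurable_cst t)
    measurableT mB; rewrite setTI.
pose f1 t : \bar R := \int[m]_s (\1_B (t, s))%:E.
pose f2 t : \bar R := \int[m]_s (\1_B (s, t))%:E.
have f1E t : f1 t = m [set s | B (t, s)].
  by have := integral_indic m measurableT (sec1 t); rewrite setIT => <-.
have f2E t : f2 t = m [set s | B (s, t)].
  by have := integral_indic m measurableT (sec2 t); rewrite setIT => <-.
have i1 : \int[m]_t f1 t = 0.
  by transitivity (\int[m \x m]_p (\1_B p)%:E); [rewrite fubini_tonelli1|].
have i2 : \int[m]_t f2 t = 0.
  by transitivity (\int[m \x m]_p (\1_B p)%:E); [rewrite fubini_tonelli2|].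
have mf1 : measurable_fun setT f1 by exact: (measurable_fun_fubini_tonelli_F (fun p => (\1_B p)%:E)).
have mf2 : measurable_fun setT f2 by exact: (measurable_fun_fubini_tonelli_G (fun p => (\1_B p)%:E)).
have f10 t : 0 <= f1 t by exact: integral_ge0.
have f20 t : 0 <= f2 t by exact: integral_ge0.
have n1 := (ge0_integral_eq0P _ mf1 f10).1 i1.
have n2 := (ge0_integral_eq0P _ mf2 f20).1 i2.
have [t ft] : exists t, f1 t = 0 /\ f2 t = 0.
  apply: contrapT => nt; suff : m setT = 0 by move=> mT0; rewrite mT0 ltxx in mT.
  rewrite (_ : setT = [set x | f1 x <> 0] `|` [set x | f2 x <> 0]).
    by rewrite measureU0//; exact: measurable_neq0.
  apply/seteqP; split=> // t _; have [f1t|] := pselect (f1 t = 0); last by left.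
  by right=> f2t; apply: nt; exists t.
exists t; have [f1t f2t] := ft.
rewrite (_ : [set s | _] = [set s | B (t, s)] `|` [set s | B (s, t)])//.
transitivity (m [set s | B (t, s)]); last exact: etrans (esym (f1E t)) f1t.
by apply: measureU0 => //; exact: etrans (esym (f2E t)) f2t.
Qed.

Section converse.
Context (R : realType) dG (G : lcscGroupType dG).
Variable mG : {sigma_finite_measure set G -> \bar R}.
Hypotheses (haarG : haar_measure mG) (rG : right_invariant mG).
Context d (T : measurableType d) (psi : T -> baire) (cT : coding psi).
Variables (a : action G T) (ba : borel_action a).
Variables (mu : probability T R) (imu : invariant_measure a mu).
Variables (Y : set T) (lY : locally_integrable_cross_section a mu Y).

Let mY : measurable Y. Proof. by case: lY. Qed.

Let nu := transverse_measure mG a mu Y.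

Lemma saturation_full : mu (saturation a Y) = 1.
Proof.
have [D [s enumY]] := cross_section_enum cT ba lY.
have msat := measurable_saturation enumY.
have [_ nsat _ _] := lY.
rewrite -(probability_setT mu); apply/esym/measure_null_setC => //.
by apply: measure_negligible => //; exact: measurableC.
Qed.

Variable w : G -> \bar R.
Hypotheses (mw : measurable_fun setT w) (w0 : forall g, 0 < w g).
Hypothesis woo : \int[mG]_g w g < +oo.

Let w_ge0 g : 0 <= w g. Proof. exact: ltW. Qed.

Lemma weight_integral_gt0 : 0 < \int[mG]_g w g.
Proof.
rewrite lt0e integral_ge0 ?andbT//; apply/eqP => /(ge0_integral_eq0P _ mw w_ge0).1.
rewrite (_ : [set _ | _] = setT) => [m0|]; last first.
  by apply/seteqP; split=> // g _ /=; apply/eqP; rewrite gt_eqF.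
by have [_ _] := haarG; rewrite m0 ltxx.
Qed.

Let W x := \esum_(g in return_set a Y x) w g.

Let W_ge0 x : 0 <= W x. Proof. exact: esum_ge0. Qed.

Let mW : measurable_fun setT W.
Proof.
have [D [s enumY]] := cross_section_enum cT ba lY.
by apply: (measurable_esum enumY (h := fun p => w p.1)) => //; exact: measurableT_comp.
Qed.

Let W_gt0 x : saturation a Y x -> 0 < W x.
Proof.
move=> /saturationP[g Yg]; apply: (lt_le_trans (w0 g)).
rewrite -[leLHS](@esum_set1 _ _ g w)//.
rewrite esum_mkcond [leRHS]esum_mkcond; apply: le_esum => h _.
case: ifPn => [/set_mem ->|_]; last by case: ifP.
by rewrite mem_set.
Qed.

Let integral_W : \int[mu]_x W x = nu setT * \int[mG]_g w g.
Proof.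
have [_ _ cnu] := transverse_measureP haarG rG cT ba imu lY.
rewrite (cnu (fun p => w p.1))//; last exact: measurableT_comp.
transitivity (\int[nu]_y (cst (\int[mG]_g w g) y)) => //.
by rewrite integral_cst// muleC.
Qed.

Lemma transverse_gt0 : 0 < nu setT.
Proof.
rewrite lt0e measure_ge0 andbT; apply/eqP => nu0.
have := integral_W; rewrite nu0 mul0e => /(ge0_integral_eq0P _ mW W_ge0).1 W0.
have : mu (saturation a Y) <= mu [set x | W x <> 0].
  have [D [s enumY]] := cross_section_enum cT ba lY.
  apply: le_measure; rewrite ?inE.
  - exact: measurable_saturation enumY.
  - exact: measurable_neq0.
  - by move=> x /W_gt0 Wx /= W0x; rewrite W0x ltxx in Wx.
by rewrite saturation_full W0 lee_fin ler10.
Qed.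

Let u x := reciprocal (W x).

Let m_u : measurable_fun setT u. Proof. exact: measurable_reciprocal. Qed.

Let u_ge0 x : 0 <= u x. Proof. exact: reciprocal_ge0. Qed.

Let mwu : measurable_fun setT (fun p : G * T => w p.1 * u (a p.1^-1%g p.2)).
Proof.
apply: emeasurable_funM; first exact: measurableT_comp.
apply: (measurableT_comp m_u).
have h : measurable_fun setT (fun p : G * T => (p.1^-1%g, p.2)).
  by apply: measurable_fun_pair => //; exact: measurable_fun_inv.
exact: (measurableT_comp ba h).
Qed.

Let wu_ge0 p : 0 <= w p.1 * u (a p.1^-1%g p.2). Proof. by rewrite mule_ge0. Qed.

(** Spreading a unit mass over each return set in proportion to w shows that
    this transverse integral is the mass of mu. *)
Let integral_normalized :
  \int[nu]_y \int[mG]_g (w g * u (a g^-1%g y)) = 1.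
Proof.
have [_ _ cnu] := transverse_measureP haarG rG cT ba imu lY.
have [D [s enumY]] := cross_section_enum cT ba lY.
have msat := measurable_saturation enumY.
rewrite -(cnu (fun p => w p.1 * u (a p.1^-1%g p.2)))//=.
have sumE x : \esum_(g in return_set a Y x) (w g * u (a g^-1%g (a g x))) = W x * u x.
  have [P [e bij]] := locally_finite_enum (@cross_section_locally_finite _ _ _ _ _ _ _ _ lY x).
  rewrite -(esumZr bij)//; last by rewrite invr_ge0 fine_ge0.
  by apply: eq_esum => g _; rewrite -actM mulVg act1.
under eq_integral do rewrite sumE.
have iW : mu.-integrable setT W.
  apply/integrableP; split=> //; under eq_integral do rewrite gee0_abs//.
  have [_ nufin _] := transverse_measureP haarG rG cT ba imu lY.
  by rewrite integral_W lte_mul_pinfty// ge0_fin_numE.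
transitivity (\int[mu]_x (cst 1 x)); last first.
  by rewrite integral_cst// mul1e; exact: (probability_setT mu).
apply: ge0_ae_eq_integral => //.
- by apply: emeasurable_funM.
- by move=> x _; rewrite mule_ge0.
have sat_ae : \forall x \ae mu, saturation a Y x by case: lY.
have := integrable_ae measurableT iW; apply: filterS2 sat_ae => x /W_gt0 Wx Wfin _.
by rewrite /= mule_reciprocal// -ge0_fin_numE// Wfin.
Qed.

(** The fraction phi p of the w-mass of the return set of p.1 that comes from the
    return set of p.2 is at most 1, and its integral is the mass of sat2; so
    phi = 1 almost everywhere on sat2. *)
Section equal.
Hypothesis eqI : intersection_covolume mG a mu Y = intensity mG a mu Y.

Let M := intersection_measure mG a mu Y.
Let Y2 := Y `*` Y.
Let sat2 := saturation (diag_action a) Y2.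

Let M_spec : is_intersection_measure mG a mu Y M /\
  campbell mG (diag_action a) Y2 M (nu \x nu).
Proof.
apply: (intersection_measureP haarG rG cT ba imu lY); apply: contrapT => nex.
have := transverse_gt0; rewrite -(intensityE haarG rG cT ba imu lY) -eqI.
(* Without any intersection measure the covolume would be 0. *)
rewrite /intersection_covolume /intersection_measure xgetPN ?ltxx// => m mi.
by apply: nex; exists m.
Qed.

Let M_sat2 : M sat2 = nu setT.
Proof. by rewrite -(intensityE haarG rG cT ba imu lY) -eqI. Qed.

Let S p := return_set (diag_action a) Y2 p.

Let phi p := (\esum_(g in S p) w g) * u p.1.

Let le_esum_return p : \esum_(g in S p) w g <= W p.1.
Proof.
rewrite /W esum_mkcond [leRHS]esum_mkcond; apply: le_esum => g _.
case: ifPn => [/set_mem[Yg _]|_]; first by rewrite mem_set.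
by case: ifP.
Qed.

Let esum_ge0S p : 0 <= \esum_(g in S p) w g. Proof. exact: esum_ge0. Qed.

Let phi_le p : phi p <= (\1_sat2 p)%:E.
Proof.
have [sp|nsp] := pselect (sat2 p).
  rewrite indicE mem_set//; apply: le_trans (mule_reciprocal_le1 (W_ge0 p.1)).
  exact: lee_wpmul2r.
rewrite indicE memNset// /phi (_ : S p = set0) ?esum_set0 ?mul0e//.
by apply/seteqP; split=> // g Sg; apply: nsp; apply/saturationP; exists g.
Qed.

Let mphi : measurable_fun setT phi.
Proof.
have [D [s enumYY]] := diag_enum cT ba lY.
apply: emeasurable_funM; last exact: (measurableT_comp m_u).
by apply: (measurable_esum enumYY (h := fun p => w p.1)) => //; exact: measurableT_comp.
Qed.

(** In the Campbell formula for Y * Y the integrand depends on the first point only. *)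
Let integral_phi : \int[M]_p phi p = nu setT.
Proof.
have [_ cM] := M_spec.
have sumE p : \esum_(g in S p) (w g * u (a g^-1%g (diag_action a g p).1)) = phi p.
  have [P [e bij]] : exists P (e : nat -> G), set_bij P (S p) e.
    apply: locally_finite_enum; apply: locally_finiteS (@subIsetl _ _ _) _.
    exact: (@cross_section_locally_finite _ _ _ _ _ _ _ _ lY p.1).
  rewrite /phi -(esumZr bij)//; last by rewrite invr_ge0 fine_ge0.
  by apply: eq_esum => g _; rewrite /= -actM mulVg act1.
have mf : measurable_fun setT (fun p : G * (T * T) => w p.1 * u (a p.1^-1%g p.2.1)).
  have h : measurable_fun setT (fun p : G * (T * T) => (p.1, p.2.1)).
    by apply: measurable_fun_pair => //; apply: measurableT_comp.
  exact: (measurableT_comp mwu h).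
have := cM (fun p => w p.1 * u (a p.1^-1%g p.2.1)) mf => /=.
under eq_integral do rewrite sumE.
move=> ->; last by move=> q; rewrite mule_ge0.
pose F0 y := \int[mG]_g (w g * u (a g^-1%g y)).
have mF0 : measurable_fun setT F0.
  exact: (measurable_fun_fubini_tonelli_G (fun p : G * T => w p.1 * u (a p.1^-1%g p.2))).
have F00 y : 0 <= F0 y by apply: integral_ge0 => g _; exact: (wu_ge0 (g, y)).
transitivity (\int[nu \x nu]_q F0 q.1) => //.
rewrite (fubini_tonelli1 (fun q : T * T => F0 q.1))//; last exact: measurableT_comp.
transitivity (\int[nu]_x (F0 x * nu setT)).
  by apply: eq_integral => x _; rewrite -[RHS]integral_cst.
rewrite ge0_integralZr//.
by rewrite integral_normalized mul1e.
Qed.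

Let msat2 : measurable sat2.
Proof. by have [D [s enumYY]] := diag_enum cT ba lY; exact: measurable_saturation enumYY. Qed.

Let phi_ge0 p : 0 <= phi p. Proof. exact: mule_ge0. Qed.

Let phi_fin p : phi p \is a fin_num.
Proof.
by rewrite ge0_fin_numE//; apply: le_lt_trans (phi_le p) _; exact: ltry.
Qed.

Let delta p := (\1_sat2 p)%:E - phi p.

Let mdelta : measurable_fun setT delta.
Proof.
have m1 : measurable_fun setT (fun p => (\1_sat2 p)%:E : \bar R).
  exact/measurable_EFinP/measurable_indic.
exact: emeasurable_funB.
Qed.

(** Here the equality of covolume and intensity enters: phi and the indicator of
    sat2 have the same finite integral. *)
Let delta_null : M [set p | delta p <> 0] = 0.
Proof.
have m1 : measurable_fun setT (fun p => (\1_sat2 p)%:E : \bar R).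
  exact/measurable_EFinP/measurable_indic.
have delta_ge0 p : 0 <= delta p by rewrite sube_ge0// phi_fin.
apply/(ge0_integral_eq0P M mdelta delta_ge0).
have nufin : nu setT \is a fin_num.
  by have [_ nuoo _] := transverse_measureP haarG rG cT ba imu lY; rewrite ge0_fin_numE.
have : \int[M]_p (phi p + delta p) = nu setT.
  transitivity (\int[M]_p (\1_sat2 p)%:E); last by rewrite integral_indic// setIT.
  by apply: eq_integral => p _; rewrite /delta addeC subeK// phi_fin.
rewrite ge0_integralD// integral_phi addeC => h.
by rewrite -[LHS](addeK _ nufin) h subee.
Qed.

Let B := [set p : T * T | exists g, Y (a g p.1) /\ ~ Y (a g p.2)].

Let mB : measurable B.
Proof.
have [V bV] := lcsc_base G.
pose E := [set q : G * (T * T) | Y (a q.1 q.2.1) /\ ~ Y (a q.1 q.2.2)].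
have mE : measurable E.
  have h1 : measurable_fun setT (fun q : G * (T * T) => a q.1 q.2.1).
    have h : measurable_fun setT (fun p : G * (T * T) => (p.1, p.2.1)).
      by apply: measurable_fun_pair => //; apply: measurableT_comp.
    exact: (measurableT_comp ba h).
  have h2 : measurable_fun setT (fun q : G * (T * T) => a q.1 q.2.2).
    have h : measurable_fun setT (fun p : G * (T * T) => (p.1, p.2.2)).
      by apply: measurable_fun_pair => //; apply: measurableT_comp.
    exact: (measurableT_comp ba h).
  apply: measurableI.
    by have := h1 measurableT _ mY; rewrite setTI.
  by have := h2 measurableT _ (measurableC mY); rewrite setTI.
apply: (measurable_proj (coding_prod cT cT) bV mE) => p.
apply: locally_finiteS (@cross_section_locally_finite _ _ _ _ _ _ _ _ lY p.1).
by move=> g [].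
Qed.

Let B_act g p : B (diag_action a g p) <-> B p.
Proof.
split=> -[h [Y1 Y2n]].
  by exists (h * g)%g; rewrite !actM.
by exists (h * g^-1)%g; rewrite /= -!actM mulgVK.
Qed.

(** Where phi p = 1, the return set of p.2 takes all the mass of the return set of
    p.1, and w > 0 leaves no point out. *)
Let B_delta p : B p -> sat2 p -> delta p <> 0.
Proof.
move=> [g [Yg nYg]] sp dp.
have phi1 : phi p = 1.
  have : delta p + phi p = phi p by rewrite dp add0e.
  by rewrite /delta subeK ?phi_fin// indicE mem_set.
have u0 : 0 < u p.1.
  rewrite lt0e u_ge0 andbT; apply/eqP => u0; move: phi1.
  by rewrite /phi u0 mule0 => /eqP; rewrite eqe eq_sym oner_eq0.
have Woo : W p.1 < +oo.
  rewrite ltey; apply/eqP => Woo; move: u0.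
  by rewrite /u Woo /reciprocal/= invr0 ltxx.
have W0 : 0 < W p.1.
  by rewrite lt0e W_ge0 andbT; apply/eqP => W0; move: u0; rewrite /u W0 /reciprocal/= invr0 ltxx.
have WS : W p.1 = \esum_(g in S p) w g.
  apply: (mulIe u0); first exact: ltry.
  by rewrite -[RHS]/(phi p) phi1; exact: mule_reciprocal.
have Sfin : \esum_(g in S p) w g \is a fin_num by rewrite -WS ge0_fin_numE.
have : W p.1 = \esum_(g in S p) w g +
    \esum_(g in return_set a Y p.1 `&` ~` S p) w g.
  rewrite /W (esumID (S p))//; congr (_ + _); congr esum.
  by apply/seteqP; split=> h [].
rewrite -WS => /eqP; rewrite lt_eqF// lteDl ?ge0_fin_numE//.
apply: (lt_le_trans (w0 g)); rewrite -[leLHS](@esum_set1 _ _ g w)//.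
rewrite esum_mkcond [leRHS]esum_mkcond; apply: le_esum => h _.
case: ifPn => [/set_mem ->|_]; last by case: ifP.
by rewrite mem_set//; split=> // -[].
Qed.

(** B is invariant, and null in sat2; so pairs in B contribute nothing to the left
    side of the Campbell formula. *)
Let nu2B : (nu \x nu) B = 0.
Proof.
have [_ cM] := M_spec.
have m1 : measurable_fun setT (fun p => (\1_B p)%:E : \bar R).
  exact/measurable_EFinP/measurable_indic.
have mf : measurable_fun setT (fun q : G * (T * T) => w q.1 * (\1_B q.2)%:E).
  apply: emeasurable_funM; first exact: measurableT_comp.
  exact: (measurableT_comp m1).
have f0 (q : G * (T * T)) : 0 <= w q.1 * (\1_B q.2)%:E by rewrite mule_ge0// lee_fin.
have := cM _ mf f0 => /=.
pose psi2 p := \esum_(g in S p) (w g * (\1_B (diag_action a g p))%:E).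
have [D [s enumYY]] := diag_enum cT ba lY.
have mpsi2 : measurable_fun setT psi2.
  apply: (measurable_esum enumYY (h := fun q => w q.1 * (\1_B (diag_action a q.1 q.2))%:E)).
    exact: (measurableT_comp mf (measurable_orbit_map (borel_diag_action ba))).
  by move=> q; rewrite mule_ge0// lee_fin.
have psi20 p : 0 <= psi2 p by apply: esum_ge0 => g _; rewrite mule_ge0// lee_fin.
have -> : \int[M]_p psi2 p = 0.
  apply/(ge0_integral_eq0P M mpsi2 psi20).
  apply: (subset_measure0 _ _ _ delta_null).
  - exact: measurable_neq0.
  - exact: measurable_neq0.
  move=> p /= psip; apply: B_delta.
    apply: contrapT => nBp; apply: psip; apply: esum1 => g _.
    by rewrite indicE memNset ?mule0// => /B_act.
  apply: contrapT => nsp; apply: psip; apply: esum1 => g Sg.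
  by exfalso; apply: nsp; apply/saturationP; exists g.
rewrite (_ : \int[_]_y _ = (\int[mG]_g w g) * (nu \x nu) B).
  move=> /esym/eqP; rewrite mule_eq0 gt_eqF ?weight_integral_gt0//= => /eqP.
  exact.
transitivity (\int[nu \x nu]_q ((\int[mG]_g w g) * (\1_B q)%:E)).
  by apply: eq_integral => q _; rewrite ge0_integralZr// lee_fin.
rewrite ge0_integralZl//; last exact: integral_ge0.
by congr (_ * _); rewrite integral_indic// setIT.
Qed.

(** Compare all points with a point t whose return set is, for almost every y,
    contained in that of y and contains it. *)
Lemma common_return_set : exists (L : set G) (N : set T),
  [/\ measurable N, nu N = 0 & forall y, ~ N y -> return_set a Y y = L].
Proof.
have [t nt] := null_sections mB nu2B transverse_gt0.
exists (return_set a Y t), [set s | B (t, s) \/ B (s, t)]; split=> //.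
  have s1 : measurable [set s | B (t, s)].
    by have := measurable_fun_pair (measurable_cst t) (@measurable_id _ T setT)
      measurableT mB; rewrite setTI.
  have s2 : measurable [set s | B (s, t)].
    by have := measurable_fun_pair (@measurable_id _ T setT) (measurable_cst t)
      measurableT mB; rewrite setTI.
  exact: measurableU.
move=> y nB; apply/seteqP; split=> g Yg; apply: contrapT => nY; apply: nB.
  by right; exists g.
by left; exists g.
Qed.

End equal.
End converse.

Section coset_cross_section.
Context (R : realType) dG (G : lcscGroupType dG).
Variable mG : {sigma_finite_measure set G -> \bar R}.
Hypotheses (haarG : haar_measure mG) (rG : right_invariant mG).
Context d (T : measurableType d) (psi : T -> baire) (cT : coding psi).
Variables (a : action G T) (ba : borel_action a).
Variables (mu : probability T R) (imu : invariant_measure a mu).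
Variables (Y : set T) (lY : locally_integrable_cross_section a mu Y).

Let mY : measurable Y. Proof. by case: lY. Qed.

Let nu := transverse_measure mG a mu Y.

(** Campbell's formula for the returns to N, weighted by w > 0. *)
Lemma null_saturation (N : set T) : measurable N -> nu N = 0 ->
  measurable (saturation a (Y `&` N)) /\ mu (saturation a (Y `&` N)) = 0.
Proof.
move=> mN nuN.
have [w [mw w0 woo]] := positive_weight mG.
have w_ge0 g : 0 <= w g by exact: ltW.
have [_ _ cnu] := transverse_measureP haarG rG cT ba imu lY.
have [D [s enumY]] := cross_section_enum cT ba lY.
have lfYN x : locally_finite (return_set a (Y `&` N) x).
  apply: locally_finiteS (@cross_section_locally_finite _ _ _ _ _ _ _ _ lY x).
  by move=> g [].
have [D' [s' enumYN]] := cross_section_enumeration cT ba (measurableI _ _ mY mN) lfYN.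
have msat := measurable_saturation enumYN; split=> //.
have m1 : measurable_fun setT (fun p => (\1_N p)%:E : \bar R).
  exact/measurable_EFinP/measurable_indic.
have mf : measurable_fun setT (fun q : G * T => w q.1 * (\1_N q.2)%:E).
  apply: emeasurable_funM; first exact: measurableT_comp.
  exact: (measurableT_comp m1).
have f0 (q : G * T) : 0 <= w q.1 * (\1_N q.2)%:E by rewrite mule_ge0// lee_fin.
pose V x := \esum_(g in return_set a Y x) (w g * (\1_N (a g x))%:E).
have mV : measurable_fun setT V.
  apply: (measurable_esum enumY (h := fun q => w q.1 * (\1_N (a q.1 q.2))%:E)).
    exact: (measurableT_comp mf (measurable_orbit_map ba)).
  by move=> q; rewrite mule_ge0// lee_fin.
have V0 x : 0 <= V x by apply: esum_ge0 => g _; rewrite mule_ge0// lee_fin.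
have : \int[mu]_x V x = 0.
  rewrite -[LHS]/(\int[mu]_x (\esum_(g in return_set a Y x) (fun q => w q.1 * (\1_N q.2)%:E) (g, a g x))).
  rewrite (cnu _ mf f0) /=.
  transitivity (\int[nu]_y ((\int[mG]_g w g) * (\1_N y)%:E)).
    by apply: eq_integral => y _; rewrite ge0_integralZr// lee_fin.
  rewrite ge0_integralZl//; last exact: integral_ge0.
  by rewrite integral_indic// setIT [X in _ * X]nuN mule0.
move=> /(ge0_integral_eq0P mu mV V0).1; apply: subset_measure0 => //.
  exact: measurable_neq0.
move=> x /saturationP[g [Yg Ng]] /= V0x.
have := w0 g; rewrite ltNge => /negP; apply.
rewrite -V0x.
apply: (@le_trans _ _ (\esum_(h in [set g]) (w h * (\1_N (a h x))%:E))).
  by rewrite esum_set1 ?indicE ?mem_set// ?mule1// mule_ge0// lee_fin.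
rewrite esum_mkcond [leRHS]esum_mkcond; apply: le_esum => h _.
case: ifPn => [/set_mem ->|_]; last by case: ifP => // _; rewrite mule_ge0// lee_fin.
by rewrite mem_set.
Qed.

Hypothesis eqI : intersection_covolume mG a mu Y = intensity mG a mu Y.

(** Let Y0 be Y without the orbits that meet the exceptional null set.  For y in Y0
    and h in L, h.y is in Y0; its return set is L by construction of Y0, and
    L * h^-1 as that of h.y.  So L * h^-1 = L, and L is a subgroup. *)
Lemma coset_cross_section_exists : exists (H : groupClosed G) (Y0 : set T),
  [/\ discrete_subgroup H, locally_integrable_cross_section a mu Y0 &
      forall y g, Y0 y -> Y0 (a g y) <-> g \in H].
Proof.
have [w [mw w0 woo]] := positive_weight mG.
have [L [N [mN nuN YL]]] := common_return_set haarG rG cT ba imu lY mw w0 woo eqI.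
have [msN muN] := null_saturation mN nuN.
have [D [s enumY]] := cross_section_enum cT ba lY.
have msat := measurable_saturation enumY.
pose Y0 := Y `\` saturation a (Y `&` N).
have mY0 : measurable Y0 by exact: measurableD.
have Y0L y : Y0 y -> return_set a Y y = L.
  move=> [Yy nN]; apply: YL => Ny; apply: nN; apply/saturationP.
  by exists 1%g; rewrite act1.
have Y0act y g : Y0 y -> Y0 (a g y) <-> L g.
  move=> Y0y; rewrite -(Y0L _ Y0y); split=> [[]//|Yg]; split=> // /saturation_act.
  by case: Y0y.
have satY0 : saturation a Y `\` saturation a (Y `&` N) `<=` saturation a Y0.
  move=> x [/saturationP[g Yg] nN]; apply/saturationP; exists g; split=> //.
  by move=> /saturation_act.
have nY0 : mu.-negligible (~` saturation a Y0).
  exists (~` saturation a Y `|` saturation a (Y `&` N)); split.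
  - by apply: measurableU => //; exact: measurableC.
  - have [_ nsat _ _] := lY.
    rewrite measureU0//; last exact: measurableC.
    by apply: measure_negligible => //; exact: measurableC.
  - rewrite -[X in _ `<=` _ `|` X]setCK -setCI; apply: subsetC.
    exact: satY0.
have [y Y0y] : exists y, Y0 y.
  apply: contrapT => nY0'.
  have : mu.-negligible [set: T].
    apply: negligibleS nY0 => x _ /saturationP[g Y0g]; apply: nY0'.
    by exists (a g x).
  move=> /(measure_negligible measurableT); rewrite [LHS](probability_setT mu) => /eqP.
  by rewrite eqe oner_eq0.
have hL : subgroup_set L.
  split=> [|g h Lg Lh]; first by apply/(Y0act y) => //; rewrite act1.
  have Y0h : Y0 (a h y) by exact/Y0act.
  by apply/(Y0act _ _ Y0h); rewrite -actM mulgVK; exact/Y0act.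
have HL g : g \in group_of_set hL <-> L g.
  by rewrite in_group_pred; split=> /asboolP.
have dH : discrete_subgroup (group_of_set hL).
  apply: locally_finite_discrete.
  rewrite (_ : [set g : G | _] = return_set a Y y).
    exact: (@cross_section_locally_finite _ _ _ _ _ _ _ _ lY y).
  by rewrite Y0L//; apply/seteqP; split=> g /HL.
have cosetY0 z g : Y0 z -> Y0 (a g z) <-> g \in group_of_set hL.
  by move=> Y0z; rewrite Y0act// HL.
exists (group_of_set hL), Y0; split=> //.
exact: (coset_locally_integrable cT ba dH mY0 nY0 cosetY0).
Qed.

End coset_cross_section.

(** * From cross sections to induced actions *)

Section subgroup_action.
Context dG (G : lcscGroupType dG) (H : groupClosed G) (X : Type) (a : action G X).

Definition restricted_act (h : subgroup H) (x : X) : X := a (val h) x.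

Lemma restricted_act1 x : restricted_act 1%g x = x.
Proof. by rewrite /restricted_act val1 act1. Qed.

Lemma restricted_actM h k x :
  restricted_act (h * k)%g x = restricted_act h (restricted_act k x).
Proof. by rewrite /restricted_act valM actM. Qed.

Definition restricted_action := Action restricted_act1 restricted_actM.

End subgroup_action.

Lemma mnormalizeE (R : realType) d (T : measurableType d)
    (m : {measure set T -> \bar R}) (P : probability T R) (k : R) A :
  m setT = k%:E -> (0 < k)%R -> mnormalize m P A = m A * k^-1%:E.
Proof. by move=> mT k0; rewrite /mnormalize mT eqe gt_eqF. Qed.

Section induced_isomorphism.
Context (R : realType) dG (G : lcscGroupType dG) (H : groupClosed G).
Variable mG : {sigma_finite_measure set G -> \bar R}.
Hypothesis haarG : haar_measure mG.
Context d (T : measurableType d).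
Variables (a : action G T) (ba : borel_action a) (mu : probability T R).
Variables (Y : set T) (mY : measurable Y).
Hypothesis cosetY : forall y g, Y y -> Y (a g y) <-> g \in H.
Variables (D : nat -> set T) (s : nat -> T -> G).
Hypothesis enumY : enumerates (return_set a Y) D s.
Hypothesis satY : mu (~` saturation a Y) = 0.
Variables (F : set G) (mF : measurable F) (fF : fundamental_domain H F).
Variable nu : {sigma_finite_measure set T -> \bar R}.
Hypothesis cnu : campbell mG a Y mu nu.
Hypotheses (nufin : nu setT < +oo) (nuF : mG F * nu setT = 1).

Let c := restricted_action H a.

Let zeta : probability T R := mnormalize nu mu.

Let nu_gt0 : 0 < nu setT.
Proof.
rewrite lt0e measure_ge0 andbT; apply/eqP => nu0; move: nuF.
by rewrite nu0 mule0 => /eqP; rewrite eqe eq_sym oner_eq0.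
Qed.

Let zetaE A : zeta A = nu A * ((fine (nu setT))^-1)%:E.
Proof.
apply: mnormalizeE; last by rewrite fine_gt0// nu_gt0.
by rewrite fineK// ge0_fin_numE.
Qed.

Lemma restricted_action_invariant : invariant_measure c zeta.
Proof.
move=> h A mA; apply: etrans (zetaE _) _; apply: etrans _ (esym (zetaE _)).
congr (_ * _).
have [lG _ _] := haarG.
have mhA : measurable (c h @^-1` A).
  by have := measurable_act (val h) ba measurableT mA; rewrite setTI.
have m1 : measurable_fun setT (fun y => (\1_A y)%:E : \bar R).
  exact/measurable_EFinP/measurable_indic.
have A0 y : 0 <= (\1_A y)%:E :> \bar R by rewrite lee_fin.
transitivity (\int[nu]_y (\1_(c h @^-1` A) y)%:E).
  by rewrite integral_indic// setIT.
transitivity (\int[nu]_y (\1_A y)%:E); last by rewrite integral_indic// setIT.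
exact: (transverse_invariant lG ba cosetY haarG cnu (valP h) m1 A0).
Qed.

Let f x : induced_space c := let g := xget 1%g (return_set a Y x) in
  induced_proj c (g, a g x).

Let f' (q : induced_space c) : T := a (repr q).1^-1%g (repr q).2.

(** Two elements of the return set of x differ by an element of H. *)
Let fE x g : Y (a g x) -> f x = induced_proj c (g, a g x).
Proof.
move=> Yg; have Yk : Y (a (xget 1%g (return_set a Y x)) x) by exact: (xgetPex 1%g (ex_intro (return_set a Y x) g Yg)).
rewrite /f; move: (xget _ _) Yk => k Yk; apply/orbit_projE.
have hH : (g * k^-1)%g \in H by exact/(coset_return_set cosetY g Yk).
exists (Sub (g * k^-1)%g hH : subgroup H) => /=.
by rewrite /translation_act /= /restricted_act /= -actM !mulgVK.
Qed.

Let f'E g y : f' (induced_proj c (g, y)) = a g^-1%g y.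
Proof.
have /orbit_projE[h] := orbit_projK (induced_proj c (g, y)).
rewrite /f'; move: (repr _) => -[k z] /= [<- <-].
by rewrite -[RHS]actM invgM mulgVK.
Qed.

Let A2 : set (induced_space c) := [set q | exists g y, Y y /\ q = induced_proj c (g, y)].

Let A2E g y : A2 (induced_proj c (g, y)) <-> Y y.
Proof.
split=> [[k [z [Yz /orbit_projE[h [_ hy]]]]]|Yy]; last by exists g, y.
have -> : y = a (val h)^-1%g z by rewrite -hy /= /restricted_act -actM mulVg act1.
by apply/cosetY => //; rewrite gpredV; exact: (valP h).
Qed.

Let fA2 x : saturation a Y x -> A2 (f x).
Proof. by move=> /saturationP[g Yg]; rewrite (fE Yg); exact/A2E. Qed.

Let msat : measurable (saturation a Y).
Proof. exact: measurable_saturation enumY. Qed.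

Let mA2 : measurable A2.
Proof.
rewrite /measurable/= /orbit_measurable /image_set_system /= setTI.
rewrite (_ : _ @^-1` _ = [set: G] `*` Y); first exact: measurableX.
by apply/seteqP; split=> -[g y]; [move=> /A2E|move=> [_ Yy]; exact/A2E].
Qed.

Let lift (B : set (induced_space c)) : measurable B -> measurable (induced_proj c @^-1` B).
Proof. by move=> mB; have := @measurable_orbit_proj _ _ _ (translation_action c) measurableT _ mB; rewrite setTI. Qed.

Let mfA (B : set (induced_space c)) : measurable B -> measurable (saturation a Y `&` f @^-1` B).
Proof.
move=> /lift mB; have [mD ms bij] := enumY.
rewrite (_ : _ `&` _ = \bigcup_n (D n `&` [set x | (induced_proj c @^-1` B) (s n x, a (s n x) x)])).
  apply: bigcup_measurable => n _; apply: measurableI => //.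
  have h : measurable_fun setT (fun x => (s n x, a (s n x) x)).
    exact: (measurableT_comp (measurable_orbit_map ba) (measurable_fun_pair (ms n) (@measurable_id _ T setT))).
  by have := h measurableT _ mB; rewrite setTI.
have sY n x : D n x -> Y (a (s n x) x) by move=> Dn; case: (bij x) => /(_ n Dn).
apply/seteqP; split=> x.
  move=> [/saturationP[g Yg] Bf].
  have [_ _ /(_ _ Yg)[n Dn sg]] := bij x.
  by exists n => //; split=> //=; rewrite sg -(fE Yg).
move=> [n _ [/sY Yn /= Bn]]; split; first by apply/saturationP; exists (s n x).
by rewrite /= (fE Yn).
Qed.

Let k := ((fine (nu setT))^-1)%R.

Let k_gt0 : (0 < k)%R.
Proof. by rewrite invr_gt0 fine_gt0// nu_gt0. Qed.

Let domain_measureE B : measurable B ->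
  domain_measure (c := c) mG zeta mF B =
  (mG \x nu) (induced_proj c @^-1` B `&` F `*` setT) * k%:E.
Proof.
move=> /lift mB; have mA : measurable (induced_proj c @^-1` B `&` F `*` [set: T]).
  by apply: measurableI => //; exact: measurableX.
transitivity (\int[mG]_g (nu (xsection (induced_proj c @^-1` B `&` F `*` [set: T]) g) * k%:E)).
  by apply: eq_integral => g _; exact: zetaE.
rewrite ge0_integralZr//; first exact: measurable_fun_xsection.
by rewrite lee_fin ltW.
Qed.

Let induced_measureE B : measurable B ->
  induced_measure c mG zeta mF B =
  (mG \x nu) (induced_proj c @^-1` B `&` F `*` setT).
Proof.
move=> mB.
have dT : domain_measure (c := c) mG zeta mF setT = k%:E.
  apply: (etrans (domain_measureE measurableT)); rewrite preimage_setT setTI.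
  transitivity ((mG F * nu setT) * k%:E); last by rewrite nuF mul1e.
  by congr (_ * _); exact: product_measure1E.
apply: (etrans (mnormalizeE _ _ dT k_gt0)).
apply: (etrans (congr1 (fun y => y * _) (domain_measureE mB))).
by rewrite -muleA -EFinM mulfV ?gt_eqF// mule1.
Qed.

Let f_measure B : measurable B ->
  mu (saturation a Y `&` f @^-1` B) = induced_measure c mG zeta mF B.
Proof.
move=> mB; have mfB := mfA mB; have lB := lift mB.
have mlF : measurable (induced_proj c @^-1` B `&` F `*` [set: T]).
  by apply: measurableI => //; exact: measurableX.
rewrite induced_measureE//.
transitivity (\int[mu]_x (\1_(saturation a Y `&` f @^-1` B) x)%:E).
  by rewrite integral_indic// setIT.
transitivity (\int[mG \x nu]_p (\1_(induced_proj c @^-1` B `&` F `*` [set: T]) p)%:E); last first.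
  by rewrite integral_indic// setIT.
have m1 : measurable_fun setT (fun p => (\1_(induced_proj c @^-1` B `&` F `*` [set: T]) p)%:E : \bar R).
  exact/measurable_EFinP/measurable_indic.
rewrite (fubini_tonelli2 _ m1)// -(cnu m1)//.
apply: eq_integral => x _.
have [_ _ bij] := enumY.
transitivity (\esum_(g in return_set a Y x) ((\1_F g)%:E * (\1_B (f x))%:E) : \bar R); last first.
  apply: eq_esum => g Yg; rewrite !indicE -EFinM -natrM mulnb; congr (_%:R%:E).
  congr nat_of_bool; apply/andP/idP.
    by move=> [/set_mem Fg /set_mem Bf]; rewrite mem_set//; split=> //=; rewrite -(fE Yg).
  by move=> /set_mem[/= Bg [Fg _]]; rewrite !mem_set// (fE Yg).
rewrite (esumZr (bij x))//.
rewrite (esum_coset_fundamental_domain R fF cosetY) -EFinM !indicE -natrM mulnb.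
by rewrite in_setI.
Qed.

(** A class is the orbit of a pair (g, y); sending it to g^-1.y inverts f.  The
    measures agree by Campbell's formula, since each return set meets F in one
    element g, and then f x is the class of (g, g.x). *)
Lemma induced_isomorphism :
  pp_isomorphic a mu (induced_action c) (induced_measure c mG zeta mF).
Proof.
exists (saturation a Y), A2, f, f'.
have mf' : measurable_fun setT f'.
  move=> _ B mB; rewrite setTI /measurable/= /orbit_measurable /image_set_system /= setTI.
  rewrite (_ : _ @^-1` _ = (fun p : G * T => a p.1^-1%g p.2) @^-1` B).
    have h : measurable_fun setT (fun p : G * T => (p.1^-1%g, p.2)).
      by apply: measurable_fun_pair => //; exact: measurable_fun_inv.
    have hh : measurable_fun setT (fun p : G * T => a p.1^-1%g p.2) by exact: (measurableT_comp ba h).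
    by have := hh measurableT B mB; rewrite setTI.
  by apply/seteqP; split=> -[g y] /=; rewrite f'E.
split=> //.
- split; split; [exact: msat|exact: satY| |exact: mA2| |].
  + move=> g; apply/seteqP; split=> x /= Yx; first exact: (saturation_act _ _ _ _).1 Yx.
    exact: (saturation_act _ _ _ _).2 Yx.
  + apply: (etrans (esym (f_measure (measurableC mA2)))).
    rewrite (_ : _ `&` _ = set0); first exact: measure0.
    by apply/seteqP; split=> // x [/fA2].
  + move=> g; apply/seteqP; split=> q; rewrite -[q]orbit_projK; case: (repr q) => h y /=.
      by rewrite induced_actE => /A2E Yy; exact/A2E.
    by move=> /A2E Yy; rewrite induced_actE; exact/A2E.
- split; first by move=> _ B mB; exact: mfA.
  exact: measurable_funTS.
- split=> //.
  + by move=> q [g [y [Yy ->]]]; rewrite f'E; exists g^-1%g, y.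
  + move=> x /set_mem/saturationP[g Yg].
    by rewrite (fE Yg) f'E -actM mulVg act1.
  + move=> q /set_mem[g [y [Yy ->]]]; rewrite f'E.
    by rewrite (@fE _ g) -actM mulgV act1.
- move=> g x /saturationP[h Yh].
  have Yh' : Y (a (h * g^-1)%g (a g x)) by rewrite -actM mulgVK.
  by rewrite (fE Yh') (fE Yh) /= induced_actE /= -actM mulgVK.
Qed.

End induced_isomorphism.

Section converse.
Context (R : realType) dG (G : lcscGroupType dG).
Variable mG : {sigma_finite_measure set G -> \bar R}.
Hypotheses (haarG : haar_measure mG) (rG : right_invariant mG).
Context d (T : measurableType d) (sT : standard_borel R T).
Variables (a : action G T) (ba : borel_action a).
Variables (mu : probability T R) (imu : invariant_measure a mu).
Variables (H : groupClosed G) (Y : set T).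
Hypotheses (dH : discrete_subgroup H) (lY : locally_integrable_cross_section a mu Y).
Hypothesis cosetY : forall y g, Y y -> Y (a g y) <-> g \in H.

(** H acts on all of T; the normalized transverse measure is invariant under H and
    carried by Y. *)
Lemma coset_cross_section_induced : induced_from_lattice mG a mu.
Proof.
have [psi cT] := coding_standard_borel sT.
have [F [mF fF]] := fundamental_domain_exists dH.
have [D [s enumY]] := cross_section_enum cT ba lY.
have [_ nufin cnu] := transverse_measureP haarG rG cT ba imu lY.
have nuF := coset_intensity haarG rG cT ba imu lY mF fF cosetY.
have satY : mu (~` saturation a Y) = 0.
  have [_ nsat _ _] := lY; apply: measure_negligible => //.
  exact/measurableC/(measurable_saturation enumY).
have Foo : mG F < +oo.
  rewrite ltey; apply/eqP => Foo; move: nuF; rewrite Foo.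
  have [->|nu0] := eqVneq (transverse_measure mG a mu Y setT) 0.
    by rewrite mule0 => /eqP; rewrite eqe eq_sym oner_eq0.
  by rewrite gt0_mulye// lt0e nu0 measure_ge0.
exists H; split; first by split=> //; exists F.
exists d, T, (mnormalize (transverse_measure mG a mu Y) mu), (restricted_action H a).
split=> //.
- by move=> h; exact: measurable_act.
- exact: (restricted_action_invariant haarG ba cosetY cnu nufin nuF).
- exists F, mF; split=> //.
  have [mY _ _ _] := lY.
  exact: (induced_isomorphism ba mY cosetY enumY satY mF fF cnu nufin nuF).
Qed.

End converse.

Theorem corollary1p1 (R : realType) (dG : measure_display)
    (G : lcscGroupType dG) (mG : {measure set G -> \bar R})
    (dX : measure_display) (X : measurableType dX) (a : action G X)
    (mu : probability X R) :
  haar_measure mG -> unimodular R G ->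
  standard_borel R X -> borel_action a -> invariant_measure a mu ->
  ergodic a mu ->
  induced_from_lattice mG a mu <->
  exists Y : set X, locally_integrable_cross_section a mu Y /\
    intersection_covolume mG a mu Y = intensity mG a mu Y.
Proof.
move=> haarG uG sX ba imu _.
have [_ KG _] := haarG.
pose mGs : {sigma_finite_measure set G -> \bar R} :=
  with_sigma_finite (compact_finite_sigma_finite KG).
have rG : right_invariant mGs := uG mG haarG.
have [psi cX] := coding_standard_borel sX.
split; first exact: (@induced_cross_section _ _ _ mGs haarG rG _ _ _ cX a ba mu imu).
move=> [Y [lY eqI]].
have [H [Y0 [dH lY0 cosetY0]]] :=
  @coset_cross_section_exists _ _ _ mGs haarG rG _ _ _ cX a ba mu imu Y lY eqI.
exact: (@coset_cross_section_induced _ _ _ mGs haarG rG _ _ sX a ba mu imu H Y0 dH lY0 cosetY0).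
Qed.
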